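(* For $n\ge3$, the $A$-module $F_n$ is free of rank $1+\dim BMW_n^{\pm}$, where $\dim BMW_n^\pm=1\cdot3\cdots(2n-1)$ is the rank of the Birman-Wenzl-Murakami algebra on $n$ strands.
   Context: $A=\mathbb{Q}[a,x,x^{-1}]/(a^2-1)$. For $n\ge3$, $F_n$ is the unital $A$-algebra with generators $s_1,\dots,s_{n-1}$ (invertible by the cubic relation), $e_1,\dots,e_{n-1}$, $C$ and relations (for all meaningful indices): $s_is_{i+1}s_i=s_{i+1}s_is_{i+1}$; $s_is_j=s_js_i$ for $|i-j|\ge2$; $(s_i-a)(s_i^2-xs_i+1)=0$; $e_i=a\left(\frac{s_i^{-1}+s_i}{x}-1\right)$; $s_ie_i=ae_i$; $e_is_{i\pm1}e_i=e_i+C$; $e_is_{i\pm1}^{-1}e_i=e_i+C$; $s_iC=Cs_i=aC$. *)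

(* Defs.v *)
From HB Require Import structures.
From mathcomp Require Import all_boot all_order all_algebra.
From mathcomp Require Import boolp.
From mathcomp.multinomials Require Import monalg.

Set Implicit Arguments.
Unset Strict Implicit.
Unset Printing Implicit Defensive.

Import GRing.Theory.
Local Open Scope ring_scope.
Local Open Scope quotient_scope.

(* The ring Q[x, x^-1], as the subring of Q(x) of the fractions p / x^k. *)

Definition laurentQ_pred : {pred {fraction {poly rat}}} :=
  fun f => `[< exists (p : {poly rat}) (k : nat),
               f = tofrac p / tofrac 'X ^+ k >].

Lemma fracX_neq0 : tofrac ('X : {poly rat}) != 0.
Proof. by rewrite tofrac_eq0 polyX_eq0. Qed.

Fact laurentQ_subring_closed : subring_closed laurentQ_pred.
Proof.
have X0 k : tofrac ('X : {poly rat}) ^+ k != 0 by rewrite expf_neq0 // fracX_neq0.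
split.
- by apply/asboolP; exists 1, 0%N; rewrite tofrac1 expr0 divr1.
- move=> f g /asboolP[p [k ->]] /asboolP[q [l ->]]; apply/asboolP.
  exists (p * 'X^l - q * 'X^k), (k + l)%N.
  by rewrite tofracB !tofracM !tofracXn exprD -mulNr addf_div ?X0 // mulNr.
- move=> f g /asboolP[p [k ->]] /asboolP[q [l ->]]; apply/asboolP.
  by exists (p * q), (k + l)%N; rewrite tofracM exprD mulf_div.
Qed.

HB.instance Definition _ :=
  GRing.isSubringClosed.Build _ laurentQ_pred laurentQ_subring_closed.

Record laurentQ := LaurentQ {
  laurentQ_val :> {fraction {poly rat}};
  _ : laurentQ_val \in laurentQ_pred }.

HB.instance Definition _ := [isSub for laurentQ_val].
HB.instance Definition _ := [Choice of laurentQ by <:].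
HB.instance Definition _ := [SubChoice_isSubComNzRing of laurentQ by <:].

Fact laurentX_subproof : tofrac ('X : {poly rat}) \in laurentQ_pred.
Proof. by apply/asboolP; exists 'X, 0%N; rewrite expr0 divr1. Qed.

Fact laurentXV_subproof : (tofrac ('X : {poly rat}))^-1 \in laurentQ_pred.
Proof. by apply/asboolP; exists 1, 1%N; rewrite tofrac1 expr1 div1r. Qed.

Definition laurentX : laurentQ := LaurentQ laurentX_subproof.
Definition laurentXV : laurentQ := LaurentQ laurentXV_subproof.

Lemma laurentXK : laurentX * laurentXV = 1.
Proof. by apply: val_inj; rewrite /= divff // fracX_neq0. Qed.

(* The ring A = Q[a, x, x^-1] / (a^2 - 1). *)

Definition baseA : Type := {poly %/ ('X^2 - 1 : {poly laurentQ})}.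
HB.instance Definition _ := GRing.ComNzRing.on baseA.

Definition baseA_a : baseA := in_qpoly ('X^2 - 1) 'X.
Definition baseA_x : baseA := in_qpoly ('X^2 - 1) laurentX%:P.
Definition baseA_xV : baseA := in_qpoly ('X^2 - 1) laurentXV%:P.

(* [{poly %/ p}] is a quotient by [p] only for [p] monic of positive degree. *)
Lemma mk_monic_baseA : mk_monic ('X^2 - 1 : {poly laurentQ}) = 'X^2 - 1.
Proof.
by rewrite /mk_monic -polyC1 size_XnsubC // monicXnsubC.
Qed.

Lemma baseA_xxV : baseA_x * baseA_xV = 1.
Proof. by rewrite -in_qpolyM -polyCM laurentXK polyC1 in_qpoly1. Qed.

Lemma baseA_aa : baseA_a * baseA_a = 1.
Proof.
rewrite -in_qpolyM -in_qpoly1 -expr2; apply/eqP; rewrite -subr_eq0 -raddfB.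
apply/eqP/val_inj; rewrite /= mk_monic_baseA Pdiv.RingMonic.rmodpp // -polyC1.
exact: monicXnsubC.
Qed.

(* Quotient of an R-algebra B by the two-sided ideal generated by the
   differences u - v, for (u, v) ranging over a set of relations. *)

Section PresentedAlgebra.
Context (R : nzRingType) (B : lalgType R) (rels : B -> B -> Prop).

Inductive rel_ideal : B -> Prop :=
| rel_ideal_rel u v : rels u v -> rel_ideal (u - v)
| rel_ideal0 : rel_ideal 0
| rel_idealD u v : rel_ideal u -> rel_ideal v -> rel_ideal (u + v)
| rel_idealMl u v : rel_ideal v -> rel_ideal (u * v)
| rel_idealMr u v : rel_ideal u -> rel_ideal (u * v).

Lemma rel_idealN u : rel_ideal u -> rel_ideal (- u).
Proof. by move=> Iu; rewrite -mulN1r; apply: rel_idealMl. Qed.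

Definition rel_congr : rel B := fun u v => `[< rel_ideal (u - v) >].

Fact rel_congr_refl : reflexive rel_congr.
Proof. by move=> u; apply/asboolP; rewrite subrr; apply: rel_ideal0. Qed.

Fact rel_congr_sym : symmetric rel_congr.
Proof.
by move=> u v; apply/asboolP/asboolP => /rel_idealN; rewrite opprB.
Qed.

Fact rel_congr_trans : transitive rel_congr.
Proof.
move=> v u w /asboolP Iuv /asboolP Ivw; apply/asboolP.
by rewrite -(subrKA v); apply: rel_idealD.
Qed.

Canonical rel_congr_equiv :=
  EquivRel rel_congr rel_congr_refl rel_congr_sym rel_congr_trans.

Definition presented : Type := {eq_quot rel_congr}.
HB.instance Definition _ := Choice.on presented.
HB.instance Definition _ := EqQuotient.on presented.

Lemma presentedP u v : reflect (rel_ideal (u - v)) (u == v %[mod presented]).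
Proof. by rewrite piE; apply: asboolP. Qed.

Definition presented_zero : presented := lift_cst presented 0.
Definition presented_one : presented := lift_cst presented 1.
Definition presented_opp := lift_op1 presented -%R.
Definition presented_add := lift_op2 presented +%R.
Definition presented_mul := lift_op2 presented *%R.
Definition presented_scale (k : R) := lift_op1 presented ( *:%R k).

Canonical pi_presented_zero := PiConst presented_zero.
Canonical pi_presented_one := PiConst presented_one.

Lemma repr_presented u : rel_ideal (u - repr (\pi_presented u)).
Proof. by apply/presentedP; rewrite reprK. Qed.

Fact pi_presented_opp : {morph \pi_presented : u / - u >-> presented_opp u}.
Proof.
move=> u; unlock presented_opp; apply/eqP/presentedP.
by rewrite -opprD; apply: rel_idealN; apply: repr_presented.
Qed.
Canonical pi_presented_opp_morph := PiMorph1 pi_presented_opp.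

Fact pi_presented_add :
  {morph \pi_presented : u v / u + v >-> presented_add u v}.
Proof.
move=> u v; unlock presented_add; apply/eqP/presentedP.
by rewrite opprD addrACA; apply: rel_idealD; apply: repr_presented.
Qed.
Canonical pi_presented_add_morph := PiMorph2 pi_presented_add.

Fact pi_presented_mul :
  {morph \pi_presented : u v / u * v >-> presented_mul u v}.
Proof.
move=> u v; unlock presented_mul; apply/eqP/presentedP.
rewrite -(subrKA (u * repr (\pi_presented v))) -mulrBr -mulrBl.
by apply: rel_idealD; [apply: rel_idealMl | apply: rel_idealMr];
  apply: repr_presented.
Qed.
Canonical pi_presented_mul_morph := PiMorph2 pi_presented_mul.

Fact pi_presented_scale k :
  {morph \pi_presented : u / k *: u >-> presented_scale k u}.
Proof.
move=> u; unlock presented_scale; apply/eqP/presentedP.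
rewrite -scalerBr -[_ - _]mul1r scalerAl.
by apply: rel_idealMl; apply: repr_presented.
Qed.
Canonical pi_presented_scale_morph k := PiMorph1 (pi_presented_scale k).

Fact presented_addA : associative presented_add.
Proof. by move=> u v w; rewrite -[u]reprK -[v]reprK -[w]reprK !piE addrA. Qed.

Fact presented_addC : commutative presented_add.
Proof. by move=> u v; rewrite -[u]reprK -[v]reprK !piE addrC. Qed.

Fact presented_add0 : left_id presented_zero presented_add.
Proof. by move=> u; rewrite -[u]reprK !piE add0r. Qed.

Fact presented_addN : left_inverse presented_zero presented_opp presented_add.
Proof. by move=> u; rewrite -[u]reprK !piE addNr. Qed.

HB.instance Definition _ := GRing.isZmodule.Build presented
  presented_addA presented_addC presented_add0 presented_addN.

Fact presented_mulA : associative presented_mul.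
Proof. by move=> u v w; rewrite -[u]reprK -[v]reprK -[w]reprK !piE mulrA. Qed.

Fact presented_mul1 : left_id presented_one presented_mul.
Proof. by move=> u; rewrite -[u]reprK !piE mul1r. Qed.

Fact presented_mulr1 : right_id presented_one presented_mul.
Proof. by move=> u; rewrite -[u]reprK !piE mulr1. Qed.

Fact presented_mulDl : left_distributive presented_mul +%R.
Proof.
move=> u v w; rewrite -[u]reprK -[v]reprK -[w]reprK.
by apply/eqP; rewrite piE /= mulrDl.
Qed.

Fact presented_mulDr : right_distributive presented_mul +%R.
Proof.
move=> u v w; rewrite -[u]reprK -[v]reprK -[w]reprK.
by apply/eqP; rewrite piE /= mulrDr.
Qed.

HB.instance Definition _ := GRing.Zmodule_isPzRing.Build presented
  presented_mulA presented_mul1 presented_mulr1 presented_mulDl presented_mulDr.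

Fact presented_scaleA k l u :
  presented_scale k (presented_scale l u) = presented_scale (k * l) u.
Proof. by rewrite -[u]reprK !piE scalerA. Qed.

Fact presented_scale1 : left_id 1 presented_scale.
Proof. by move=> u; rewrite -[u]reprK !piE scale1r. Qed.

Fact presented_scaleDr : right_distributive presented_scale +%R.
Proof.
move=> k u v; rewrite -[u]reprK -[v]reprK.
by apply/eqP; rewrite piE /= scalerDr.
Qed.

Fact presented_scaleDl u :
  {morph presented_scale^~ u : k l / k + l}.
Proof.
move=> k l; rewrite -[u]reprK.
by apply/eqP; rewrite piE /= scalerDl.
Qed.

HB.instance Definition _ := GRing.Zmodule_isLmodule.Build R presented
  presented_scaleA presented_scale1 presented_scaleDr presented_scaleDl.

End PresentedAlgebra.

(* Generators of F_n; the index i : 'I_n.-1 stands for i + 1 in the usual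
   1-based numbering, and the s_i^-1 are adjoined as formal inverses. *)

Inductive F_gen (n : nat) : Type :=
| GenS of 'I_n.-1
| GenSV of 'I_n.-1
| GenE of 'I_n.-1
| GenC.
Arguments GenC {n}.

Section FGenCountable.
Context (n : nat).

Definition F_gen_encode (g : F_gen n) : 'I_n.-1 + 'I_n.-1 + 'I_n.-1 + unit :=
  match g with
  | GenS i => inl (inl (inl i))
  | GenSV i => inl (inl (inr i))
  | GenE i => inl (inr i)
  | GenC => inr tt
  end.

Definition F_gen_decode (c : 'I_n.-1 + 'I_n.-1 + 'I_n.-1 + unit) : F_gen n :=
  match c with
  | inl (inl (inl i)) => GenS i
  | inl (inl (inr i)) => GenSV i
  | inl (inr i) => GenE i
  | inr _ => GenC
  end.

Lemma F_gen_encodeK : cancel F_gen_encode F_gen_decode.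
Proof. by case. Qed.

HB.instance Definition _ := Countable.copy (F_gen n) (can_type F_gen_encodeK).

End FGenCountable.

Definition F_free (n : nat) : Type := {malg baseA[{fmonom (F_gen n)}]}.
HB.instance Definition _ n := GRing.Lalgebra.on (F_free n).

Definition F_var (n : nat) (g : F_gen n) : F_free n := << fmu g >>.

(* The defining relations (u, v), meaning u = v, on elements s_i, s_i^-1, e_i
   and C of an algebra over a ring with elements a, x, x^-1. *)

Section FRel.
Context (K : comNzRingType) (a x xV : K) (B : lalgType K) (n : nat).
Context (s sV e : 'I_n.-1 -> B) (C : B).

Definition adjacent (i j : 'I_n.-1) : Prop :=
  j = i.+1 :> nat \/ i = j.+1 :> nat.

Inductive F_rel : B -> B -> Prop :=
| F_rel_ssV i : F_rel (s i * sV i) 1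
| F_rel_sVs i : F_rel (sV i * s i) 1
| F_rel_braid (i j : 'I_n.-1) :
    j = i.+1 :> nat -> F_rel (s i * s j * s i) (s j * s i * s j)
| F_rel_comm (i j : 'I_n.-1) :
    (i.+2 <= j)%N \/ (j.+2 <= i)%N -> F_rel (s i * s j) (s j * s i)
| F_rel_cubic i : F_rel ((s i - a *: 1) * (s i ^+ 2 - x *: s i + 1)) 0
| F_rel_e i : F_rel (e i) (a *: (xV *: (sV i + s i) - 1))
| F_rel_se i : F_rel (s i * e i) (a *: e i)
| F_rel_ese i j : adjacent i j -> F_rel (e i * s j * e i) (e i + C)
| F_rel_esVe i j : adjacent i j -> F_rel (e i * sV j * e i) (e i + C)
| F_rel_sC i : F_rel (s i * C) (a *: C)
| F_rel_Cs i : F_rel (C * s i) (a *: C).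

Lemma F_rel_aug (phi : {lrmorphism B -> K | *%R}) (e0 := xV + xV - a) :
  a * a = 1 -> (forall i, phi (s i) = a) -> (forall i, phi (sV i) = a) ->
  (forall i, phi (e i) = e0) -> phi C = e0 * a * e0 - e0 ->
  forall u v, F_rel u v -> phi u = phi v.
Proof.
move=> aa phis phisV phie phiC u v.
have phiZ k w : phi (k *: w) = k * phi w by rewrite linearZ.
case=> [i|i|i j _|i j _|i|i|i|i j _|i j _|i|i];
  rewrite ?(rmorphM, rmorphD, rmorphN, rmorph1, rmorph0, rmorphXn, phiZ) /=;
  rewrite ?(rmorphM, rmorphD, rmorphN, rmorph1, rmorph0, rmorphXn, phiZ) /=;
  rewrite ?(phis, phisV, phie, phiC) //.
- by rewrite mulr1 subrr mul0r.
- by rewrite mulrDr mulrN1 mulrCA mulrDr aa mulrDr mulr1.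
- by rewrite addrCA subrr addr0.
- by rewrite addrCA subrr addr0.
- exact: mulrC.
Qed.

End FRel.

Definition F_relations (n : nat) : F_free n -> F_free n -> Prop :=
  F_rel baseA_a baseA_x baseA_xV (fun i => F_var (GenS i))
    (fun i => F_var (GenSV i)) (fun i => F_var (GenE i)) (F_var GenC).

Definition F (n : nat) : Type := presented (@F_relations n).
HB.instance Definition _ n := GRing.PzRing.on (F n).
HB.instance Definition _ n := GRing.Lmodule.on (F n).

Lemma malg_scaleAr (M : monomType) (K : comNzRingType) (k : K)
  (u v : {malg K[M]}) : k *: (u * v) = u * (k *: v).
Proof.
have kC (w : {malg K[M]}) : malgC k * w = w * malgC k.
  rewrite -[LHS]/(fgmul _ _) -[RHS]/(fgmul _ _) fgmulUg fgmulgU.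
  by apply: eq_bigr => m _; rewrite mul1m mulm1 mulrC.
by rewrite -(mul_malgC k (u * v)) -(mul_malgC k v) !mulrA kC.
Qed.

(* F_n is a nonzero A-algebra: it maps onto A by s_i |-> a,
   e_i |-> 2 x^-1 - a. *)

Section FAlgebra.
Context (n : nat).

Definition F_aug_gen (g : F_gen n) : baseA :=
  let e := baseA_xV + baseA_xV - baseA_a in
  match g with
  | GenS _ | GenSV _ => baseA_a
  | GenE _ => e
  | GenC => e * baseA_a * e - e
  end.

Definition F_aug_monom (m : {fmonom (F_gen n)}) : baseA :=
  \prod_(g <- (m : seq _)) F_aug_gen g.

Fact F_aug_monom_multiplicative : mmorphism F_aug_monom.
Proof.
split=> [m1 m2|]; rewrite /F_aug_monom.
  by rewrite fmM big_cat.
by rewrite fm1 big_nil.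
Qed.

HB.instance Definition _ :=
  isMultiplicative.Build {fmonom (F_gen n)} baseA F_aug_monom
    F_aug_monom_multiplicative.

Definition F_aug : F_free n -> baseA := mmap idfun F_aug_monom.

HB.instance Definition _ := GRing.LRMorphism.on F_aug.

Lemma F_aug_var g : F_aug (F_var g) = F_aug_gen g.
Proof. by rewrite /F_aug /F_var mmapU mul1r /F_aug_monom fmuE /= big_seq1. Qed.

Lemma F_aug_rel u v : F_relations u v -> F_aug u = F_aug v.
Proof.
move=> /(F_rel_aug (phi := F_aug)); apply.
- exact: baseA_aa.
- by move=> i; apply: F_aug_var.
- by move=> i; apply: F_aug_var.
- by move=> i; apply: F_aug_var.
- exact: F_aug_var.
Qed.

Lemma F_aug_ideal u : rel_ideal (@F_relations n) u -> F_aug u = 0.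
Proof.
elim=> {u} [u v /F_aug_rel uv||u v _ u0 _ v0|u v _ v0|u v _ u0].
- by rewrite raddfB /= uv subrr.
- exact: raddf0.
- by rewrite raddfD /= u0 v0 addr0.
- by rewrite rmorphM /= v0 mulr0.
- by rewrite rmorphM /= u0 mul0r.
Qed.

Fact F_one_neq0 : (1 : F n) != 0.
Proof.
rewrite !piE; apply/negP => /asboolP; rewrite subr0 => /F_aug_ideal/eqP.
by rewrite rmorph1 oner_eq0.
Qed.

HB.instance Definition _ := GRing.PzSemiRing_isNonZero.Build (F n) F_one_neq0.

Fact F_scaleAl (k : baseA) (u v : F n) : k *: (u * v) = (k *: u) * v.
Proof. by rewrite -[u]reprK -[v]reprK; apply/eqP; rewrite !piE scalerAl. Qed.

HB.instance Definition _ :=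
  GRing.Lmodule_isLalgebra.Build baseA (F n) F_scaleAl.

Fact F_scaleAr (k : baseA) (u v : F n) : k *: (u * v) = u * (k *: v).
Proof.
by rewrite -[u]reprK -[v]reprK; apply/eqP; rewrite !piE malg_scaleAr.
Qed.

HB.instance Definition _ :=
  GRing.Lalgebra_isAlgebra.Build baseA (F n) F_scaleAr.

End FAlgebra.

Definition free_of_rank (R : nzRingType) (M : lmodType R) (r : nat) : Prop :=
  exists b : 'I_r -> M, forall v : M,
    exists! c : {ffun 'I_r -> R}, v = \sum_(i < r) c i *: b i.

(* 1 * 3 * ... * (2n - 1), the rank of the Birman-Wenzl-Murakami algebra on n
   strands. *)
Definition BMW_dim (n : nat) : nat := (\prod_(0 <= i < n) (2 * i + 1))%N.

(* Main.v *)
Require Import Defs.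
From HB Require Import structures.
From mathcomp Require Import all_boot all_order all_algebra all_field.
From mathcomp Require Import boolp.
From mathcomp.finmap Require Import finmap.
From mathcomp.multinomials Require Import monalg.
From mathcomp.zify Require Import zify.
From mathcomp.algebra_tactics Require Import ring.

(* Multiplying s_i, e_i and x by a reduces the relations to s + s^-1 = x (1 + e),
   s e = e and, modulo C, e_i s_j e_i = e_i s_j^-1 e_i = e_i. Each generator
   multiplies C by a scalar, so the ideal of C is A C; modulo C, the algebra
   generated by s_k, s_(k+1), .. is spanned by the products of the elements
   s_k .. s_(k+j-1) and s_(k+j)^-1 .. s_(k+1)^-1 e_k with those of the algebra
   generated by s_(k+1), .., which leaves 1 * 3 * .. * (2n - 1) words.

   For independence, put a = eps and x = eps (q + q^-1) with eps = 1 or -1,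
   q ^ (4 l - 1) = 1 and l >= n. Starting from an empty alphabet and adding two
   letters at a time, one gets R-matrices for which the eigenvalue of s on the
   image of e is q (- q^-2)^k after k steps, hence 1 for k = 2 l: then F_n acts
   on functions of words of length 2 n in 4 l letters, with C acting by 0. Applied
   to the tensor of n nested cups, the spanning words give independent functions,
   as one sees by evaluating them at words with a single pair of extreme letters.
   As l varies this covers infinitely many x, so the coefficients of the words
   vanish. The augmentation of F_n maps C to an element that is nonzero at all
   these points, so the coefficient of C vanishes as well. *)

Set Implicit Arguments.
Unset Strict Implicit.
Unset Printing Implicit Defensive.
Import Order.TTheory GRing.Theory Num.Theory.
Local Open Scope ring_scope.

(** * R-matrices *)

(** The relation s_i e_i = a e_i prescribes the eigenvalue of s_i on the image of e_i, while the
    R-matrices below have a signed power of q there. The two agree only when q is a root of unity,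
    so these actions exist only at isolated values of x. They still suffice: a Laurent polynomial
    has a bounded number of roots, and l is chosen after it. The exponent 4 l - 1 comes from q (-
    q^-2)^(2 l) = q^(1 - 4 l); being odd, it keeps q + q^-1 away from 0, where e_i cannot be
    recovered from s_i, and from 1, where the augmentation of C vanishes. Enough levels of letters
    are needed to label the n nested cups differently. A letter of top level then marks one end of a
    strand and forces its dual at the other end, and crossings are triangular for the levels. Each
    word joins the outermost position to one of 2 m - 1 others when m strands are left; extreme
    letters select the words with a given partner, and the rest is a relation between words on m - 1
    strands. *)

Section Local.
Context (K : fieldType) (q : K).
Definition xq : K := q + q^-1.

Section Ops.
Context (I : finType).
Implicit Types (S : (I -> I -> K) -> I -> I -> K) (Om om : I -> I -> K).

Definition ctr om (F : I -> I -> K) : K := \sum_a \sum_b om a b * F a b.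
Definition op12 S (F : I -> I -> I -> K) a b c := S (fun a b => F a b c) a b.
Definition op23 S (F : I -> I -> I -> K) a b c := S (F a) b c.
Definition ins12 Om (v : I -> K) a b c := Om a b * v c.
Definition ins23 Om (v : I -> K) a b c := Om b c * v a.
Definition ctr12 om (F : I -> I -> I -> K) c := ctr om (fun a b => F a b c).
Definition ctr23 om (F : I -> I -> I -> K) a := ctr om (F a).

(* [Om] is the cup and [om] the cap; [bl_zig] and [bl_zag] straighten a strand,
   [bl_pt12] and [bl_pt23] remove a curl. *)
Record bmw_local S Om om (th : K) : Prop := BmwLocal {
  bl_lin : forall k F G,
    S (fun a b => k * F a b + G a b) = (fun a b => k * S F a b + S G a b);
  bl_quad : forall F a b,
    S (S F) a b = xq * S F a b - F a b + xq * th * ctr om F * Om a b;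
  bl_SOm : forall a b, S Om a b = th * Om a b;
  bl_omS : forall F, ctr om (S F) = th * ctr om F;
  bl_zig : forall v, ctr12 om (ins23 Om v) = v;
  bl_zag : forall v, ctr23 om (ins12 Om v) = v;
  bl_pt12 : forall v a, ctr12 om (op23 S (ins12 Om v)) a = th^-1 * v a;
  bl_pt23 : forall v a, ctr23 om (op12 S (ins23 Om v)) a = th^-1 * v a;
  bl_loop : xq * (ctr om Om + 1) = th + th^-1;
  bl_braid : forall F,
    op12 S (op23 S (op12 S F)) = op23 S (op12 S (op23 S F)) }.
End Ops.

(** * Sliding strands through cups and caps *)

Section Theory.
Context (I : finType) (S : (I -> I -> K) -> I -> I -> K) (Om om : I -> I -> K).
Context (th : K) (HS : bmw_local S Om om th).
Hypothesis th0 : th != 0.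
Hypothesis x0 : xq != 0.

Definition lc2 k (F G : I -> I -> K) a b := k * F a b + G a b.
Definition lc3 k (F G : I -> I -> I -> K) a b c := k * F a b c + G a b c.

Lemma S_lc2 k F G : S (lc2 k F G) = lc2 k (S F) (S G).
Proof. exact: (bl_lin HS). Qed.

Lemma S_0 : S (fun _ _ => 0) = fun _ _ => 0.
Proof.
have := bl_lin HS (-1) (fun _ _ => 0) (fun _ _ => 0).
have -> : (fun (a b : I) => -1 * (0 : K) + 0) = fun _ _ => 0.
  by apply/funext=> a; apply/funext => b; rewrite mulr0 addr0.
by move=> ->; apply/funext=> a; apply/funext => b; rewrite mulN1r addNr.
Qed.

Lemma S_scale k F : S (fun a b => k * F a b) = fun a b => k * S F a b.
Proof.
have := bl_lin HS k F (fun _ _ => 0); rewrite S_0.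
have E (G : I -> I -> K) : (fun a b => k * G a b + 0) = fun a b => k * G a b.
  by apply/funext=> a; apply/funext => b; rewrite addr0.
by rewrite !E.
Qed.

Lemma s1_lc k F G : op12 S (lc3 k F G) = lc3 k (op12 S F) (op12 S G).
Proof.
apply/funext=> a; apply/funext=> b; apply/funext=> c.
rewrite /op12 /lc3 /=.
by rewrite (S_lc2 k (fun a b => F a b c) (fun a b => G a b c)).
Qed.

Lemma s2_lc k F G : op23 S (lc3 k F G) = lc3 k (op23 S F) (op23 S G).
Proof.
apply/funext=> a; apply/funext=> b; apply/funext=> c.
by rewrite /op23 /lc3 /= (S_lc2 k (F a) (G a)).
Qed.

Lemma s1_scale k F :
  op12 S (fun a b c => k * F a b c) = fun a b c => k * op12 S F a b c.
Proof.
apply/funext=> a; apply/funext=> b; apply/funext=> c.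
by rewrite /op12 (S_scale k (fun a b => F a b c)).
Qed.

Lemma s2_scale k F :
  op23 S (fun a b c => k * F a b c) = fun a b c => k * op23 S F a b c.
Proof.
apply/funext=> a; apply/funext=> b; apply/funext=> c.
by rewrite /op23 (S_scale k (F a)).
Qed.

Lemma ctr_lin k F G : ctr om (fun a b => k * F a b + G a b) =
  k * ctr om F + ctr om G.
Proof.
rewrite /ctr mulr_sumr -big_split /=; apply: eq_bigr => a _.
rewrite mulr_sumr -big_split /=; apply: eq_bigr => b _; ring.
Qed.

Lemma ctr_scale k F : ctr om (fun a b => k * F a b) = k * ctr om F.
Proof.
rewrite /ctr mulr_sumr; apply: eq_bigr => a _.
rewrite mulr_sumr; apply: eq_bigr => b _; ring.
Qed.

Lemma ctr_eq0 F : (forall a b, F a b = 0) -> ctr om F = 0.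
Proof.
by move=> F0; rewrite /ctr big1 // => a _; rewrite big1 // => b _; rewrite F0 mulr0.
Qed.

(** [bl_quad] solved for the cup-cap composite: as a polynomial in the crossing, it inherits the
    braid relation. *)
Lemma e12_poly F a b c : ins12 Om (ctr12 om F) a b c =
  xq^-1 * th^-1 * (op12 S (op12 S F) a b c - xq * op12 S F a b c + F a b c).
Proof.
rewrite /op12 (bl_quad HS) /ins12 /ctr12; field.
by rewrite th0 x0.
Qed.

Lemma e23_poly F a b c : ins23 Om (ctr23 om F) a b c =
  xq^-1 * th^-1 * (op23 S (op23 S F) a b c - xq * op23 S F a b c + F a b c).
Proof.
rewrite /op23 (bl_quad HS (F a)) /ins23 /ctr23; field.
by rewrite th0 x0.
Qed.

Lemma e12_lc F : ins12 Om (ctr12 om F) =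
  lc3 (xq^-1 * th^-1) (op12 S (op12 S F))
     (lc3 (- th^-1) (op12 S F) (fun a b c => xq^-1 * th^-1 * F a b c)).
Proof.
apply/funext=> a; apply/funext=> b; apply/funext=> c.
rewrite e12_poly /lc3; field; by rewrite th0 x0.
Qed.

Lemma e23_lc F : ins23 Om (ctr23 om F) =
  lc3 (xq^-1 * th^-1) (op23 S (op23 S F))
     (lc3 (- th^-1) (op23 S F) (fun a b c => xq^-1 * th^-1 * F a b c)).
Proof.
apply/funext=> a; apply/funext=> b; apply/funext=> c.
rewrite e23_poly /lc3; field; by rewrite th0 x0.
Qed.

Lemma s1s2_e12 F : op12 S (op23 S (ins12 Om (ctr12 om F))) =
  ins23 Om (ctr23 om (op12 S (op23 S F))).
Proof.
rewrite e12_lc e23_lc !s2_lc !s1_lc s2_scale s1_scale.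
by rewrite !(bl_braid HS).
Qed.

Lemma s2s1_e23 F : op23 S (op12 S (ins23 Om (ctr23 om F))) =
  ins12 Om (ctr12 om (op23 S (op12 S F))).
Proof.
rewrite e12_lc e23_lc !s1_lc !s2_lc s1_scale s2_scale.
by rewrite -!(bl_braid HS).
Qed.

Lemma s1_ins12 v : op12 S (ins12 Om v) = fun a b c => th * ins12 Om v a b c.
Proof.
apply/funext=> a; apply/funext=> b; apply/funext=> c.
rewrite /op12 /ins12.
have -> : (fun a b => Om a b * v c) = fun a b => v c * Om a b.
  by apply/funext=> a'; apply/funext=> b'; rewrite mulrC.
by rewrite S_scale (bl_SOm HS); ring.
Qed.

Lemma s2_ins23 v : op23 S (ins23 Om v) = fun a b c => th * ins23 Om v a b c.
Proof.
apply/funext=> a; apply/funext=> b; apply/funext=> c.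
rewrite /op23 /ins23.
have -> : (fun b c => Om b c * v a) = fun b c => v a * Om b c.
  by apply/funext=> b'; apply/funext=> c'; rewrite mulrC.
by rewrite S_scale (bl_SOm HS); ring.
Qed.

(** A strand slides through a cup. By [bl_zig] the left cup is a cup-cap composite applied to the
    right one, so [s1s2_e12] applies; the factor [th] of the crossing on the cup and [th^-1] of the
    partial trace cancel. *)
Lemma s1s2_ins12 v : op12 S (op23 S (ins12 Om v)) = ins23 Om v.
Proof.
have := s1s2_e12 (ins23 Om v); rewrite (bl_zig HS) => ->.
rewrite s2_ins23 s1_scale; congr (ins23 Om _); apply/funext => a.
rewrite /ctr23 ctr_scale.
by have := bl_pt23 HS v a; rewrite /ctr23 => ->; field.
Qed.

Lemma s2s1_ins23 v : op23 S (op12 S (ins23 Om v)) = ins12 Om v.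
Proof.
have := s2s1_e23 (ins12 Om v); rewrite (bl_zag HS) => ->.
rewrite s1_ins12 s2_scale; congr (ins12 Om _); apply/funext => a.
rewrite /ctr12 ctr_scale.
by have := bl_pt12 HS v a; rewrite /ctr12 => ->; field.
Qed.

Lemma ctr12_s2s1 F : ctr12 om (op23 S (op12 S F)) = ctr23 om F.
Proof.
have := congr1 (ctr23 om) (s2s1_e23 F); rewrite (bl_zag HS) => <-.
by rewrite s2s1_ins23 (bl_zag HS).
Qed.

Lemma ctr23_s1s2 F : ctr23 om (op12 S (op23 S F)) = ctr12 om F.
Proof.
have := congr1 (ctr12 om) (s1s2_e12 F); rewrite (bl_zig HS) => <-.
by rewrite s1s2_ins12 (bl_zig HS).
Qed.

(* Both sides are [s_1^-1 s_1 s_2] of a cup, rewritten with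
   [s + s^-1 = x (1 + e)]. *)
Lemma s1_ins23_s2_ins12 v a b c :
  op12 S (ins23 Om v) a b c + op23 S (ins12 Om v) a b c =
  xq * (ins12 Om v a b c + ins23 Om v a b c).
Proof.
have := e12_poly (op23 S (ins12 Om v)) a b c.
have -> : ctr12 om (op23 S (ins12 Om v)) = fun c => th^-1 * v c.
  by apply/funext => d; rewrite (bl_pt12 HS).
rewrite s1s2_ins12 => /(congr1 (fun y => xq * th * y)).
rewrite /ins12 => H.
have {}H : xq * (Om a b * v c) = op12 S (ins23 Om v) a b c
   - xq * ins23 Om v a b c + op23 S (fun a b c => Om a b * v c) a b c.
  apply: etrans (etrans H _); field; by rewrite ?th0 ?x0.
rewrite mulrDr H; rewrite /ins12; ring.
Qed.

(** Nested cups let a crossing pass from their left ends to their right ends. Adding to either side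
    the crossing of the inner ends of two cups placed side by side gives the same combination of
    uncrossed cups, by [s1_ins23_s2_ins12] on the first and on the last three letters. *)
Lemma S_nested a b c d :
  S (fun a b => Om b c * Om a d) a b = S (fun c d => Om b c * Om a d) c d.
Proof.
have := s1_ins23_s2_ins12 (fun a => Om a d) a b c.
have := s1_ins23_s2_ins12 (fun d => Om a d) b c d.
rewrite /op12 /op23 /ins12 /ins23.
have -> : (fun b c => Om c d * Om a b) = fun b c => Om a b * Om c d.
  by apply/funext => ?; apply/funext => ?; rewrite mulrC.
move=> /(canRL (addKr _)) -> /(canRL (addrK _)) ->; ring.
Qed.

(** The dual of [s1_ins23_s2_ins12], with caps in place of cups. *)
Lemma ctr12_s2_ctr23_s1 F a :
  ctr12 om (op23 S F) a + ctr23 om (op12 S F) a =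
  xq * (ctr12 om F a + ctr23 om F a).
Proof.
have := congr1 (fun v => v a) (ctr12_s2s1 (op12 S F)) => /=.
have -> : op12 S (op12 S F) = lc3 xq (op12 S F)
   (lc3 (-1) F (fun a b c => xq * th * ins12 Om (ctr12 om F) a b c)).
  apply/funext=> d; apply/funext=> b; apply/funext=> c.
  rewrite /lc3 /op12 (bl_quad HS) /ins12 /ctr12; ring.
rewrite !s2_lc s2_scale /lc3 /ctr12 !ctr_lin ctr_scale.
have := bl_pt12 HS (ctr12 om F) a; rewrite /ctr12 => ->.
have := congr1 (fun v => v a) (ctr12_s2s1 F); rewrite /ctr12 /= => ->.
move=> <-; field; by [].
Qed.
End Theory.

(** * Adding a pair of dual letters *)

Section Glue.
Context (I : finType) (S : (I -> I -> K) -> I -> I -> K) (Om om : I -> I -> K).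
Context (th : K) (HS : bmw_local S Om om th).
Hypothesis th0 : th != 0.
Hypothesis x0 : xq != 0.
Hypothesis q0 : q != 0.

Definition glue_th : K := - th / q ^+ 2.
Definition glue_g : K := - th / q.
Local Notation g := glue_g.
Local Notation I' := (I + bool)%type.
Local Notation tp := (inr true : I').
Local Notation tm := (inr false : I').

(* The outermost pair of letters [tm], [tp], dual to each other, is added to [I]:
   on the other pairs of letters the action of [s] is the Hecke one, and [glue_g]
   and [glue_th] are forced by the BMW relations. *)
Definition glue_S (F : I' -> I' -> K) (a b : I') : K :=
  match a, b with
  | inl v, inl w =>
      S (fun v w => F (inl v) (inl w)) v w + xq * Om v w * F tp tm
  | inl v, inr true => - F tp (inl v)
  | inr true, inl v => F (inl v) tp + xq * F tp (inl v)
  | inl v, inr false => - F tm (inl v) + xq * F (inl v) tm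
  | inr false, inl v => F (inl v) tm
  | inr true, inr true => q * F tp tp
  | inr false, inr false => q * F tm tm
  | inr false, inr true => q^-1 * F tp tm
  | inr true, inr false => q^-1 * F tm tp + xq * (1 + g) * F tp tm
      + xq * g * ctr om (fun v w => F (inl v) (inl w))
  end.

Definition glue_Om (a b : I') : K :=
  match a, b with
  | inl v, inl w => Om v w
  | inr true, inr false => g
  | inr false, inr true => 1
  | _, _ => 0
  end.

Definition glue_om (a b : I') : K :=
  match a, b with
  | inl v, inl w => om v w
  | inr true, inr false => 1
  | inr false, inr true => g^-1
  | _, _ => 0
  end.

Lemma glue_ctr F : ctr glue_om F = 
  ctr om (fun v w => F (inl v) (inl w)) + F tp tm + g^-1 * F tm tp.
Proof.
rewrite /ctr big_sumType big_bool /= !big_sumType !big_bool /=.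
have z (G : I -> K) : \sum_a 0 * G a = 0 by apply: big1 => i _; rewrite mul0r.
rewrite !z.
rewrite !mul0r !addr0 !add0r mul1r addrA; congr (_ + _ + _).
apply: eq_bigr => a _; rewrite big_sumType big_bool /=; ring.
Qed.

Let g0 : g != 0.
Proof. by rewrite /g mulf_neq0 ?oppr_eq0 // invr_neq0. Qed.

Lemma glue_lin k F G : glue_S (fun a b => k * F a b + G a b) =
  (fun a b => k * glue_S F a b + glue_S G a b).
Proof.
apply/funext => -[v|[]]; apply/funext => -[w|[]] /=; try ring.
- rewrite (bl_lin HS k (fun v w => F (inl v) (inl w))); ring.
- rewrite (ctr_lin om k (fun v w => F (inl v) (inl w))); ring.
Qed.

Lemma glue_SOm a b : glue_S glue_Om a b = glue_th * glue_Om a b.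
Proof.
case: a b => [v|[]] [w|[]] /=; try ring.
- rewrite (bl_SOm HS) /glue_th /g /xq; field; by [].
- have -> : xq * g * ctr om (fun v w => Om v w) = g * (th + th^-1 - xq).
    by rewrite -(bl_loop HS); ring.
  rewrite /glue_th /g /xq; field; by rewrite th0 q0.
- rewrite /glue_th /g; field; by [].
Qed.

Lemma glue_S_VV F c : S (fun v w => S F v w + xq * Om v w * c) =
  fun v w => S (S F) v w + xq * th * Om v w * c.
Proof.
have -> : (fun v w => S F v w + xq * Om v w * c) = lc2 (xq * c) Om (S F).
  by apply/funext => v; apply/funext => w; rewrite /lc2; ring.
rewrite (S_lc2 HS); apply/funext => v; apply/funext => w.
by rewrite /lc2 (bl_SOm HS); ring.
Qed.

Lemma glue_ctr_VV F c : ctr om (fun v w => S F v w + xq * Om v w * c) =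
  th * ctr om F + (th + th^-1 - xq) * c.
Proof.
have -> : (fun v w => S F v w + xq * Om v w * c) =
   fun v w => (xq * c) * Om v w + S F v w.
  by apply/funext => v; apply/funext => w; ring.
rewrite ctr_lin (bl_omS HS) -(bl_loop HS); ring.
Qed.

Lemma glue_omS F : ctr glue_om (glue_S F) = glue_th * ctr glue_om F.
Proof.
rewrite !glue_ctr /= glue_ctr_VV.
set c := ctr _ _; rewrite /glue_th /g /xq; field.
by rewrite oppr_eq0 th0 q0.
Qed.

Lemma glue_quad F a b :
  glue_S (glue_S F) a b = xq * glue_S F a b - F a b
    + xq * glue_th * ctr glue_om F * glue_Om a b.
Proof.
rewrite glue_ctr; case: a b => [v|[]] [w|[]] /=;
  try by [ring | rewrite /xq; field; rewrite ?q0 ?g0].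
- rewrite glue_S_VV (bl_quad HS).
  set c := ctr _ _; rewrite /glue_th /g /xq; field.
  by rewrite oppr_eq0 th0 q0.
- rewrite glue_ctr_VV.
  set c := ctr _ _; rewrite /glue_th /g /xq; field.
  by rewrite oppr_eq0 th0 q0.
- set c := ctr _ _; rewrite /glue_th /g /xq; field.
  by rewrite oppr_eq0 th0 q0.
Qed.

Lemma glue_zig v : ctr12 glue_om (ins23 glue_Om v) = v.
Proof.
have zig w : ctr om (fun a b => Om b w * v (inl a)) = v (inl w).
  have := congr1 (fun f => f w) (bl_zig HS (fun a => v (inl a))).
  by [].
apply/funext => -[w|[]]; rewrite /ctr12 glue_ctr /ins23 /= ?zig;
  rewrite ?(mul0r, mul1r, mulr0, addr0, add0r) //.
- by rewrite ctr_eq0 ?add0r ?mulVKf ?mulKf // => a b; rewrite mul0r.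
- by rewrite ctr_eq0 ?add0r ?mulVKf ?mulKf // => a b; rewrite mul0r.
Qed.

Lemma glue_zag v : ctr23 glue_om (ins12 glue_Om v) = v.
Proof.
have zag w : ctr om (fun b c => Om w b * v (inl c)) = v (inl w).
  have := congr1 (fun f => f w) (bl_zag HS (fun a => v (inl a))).
  by [].
apply/funext => -[w|[]]; rewrite /ctr23 glue_ctr /ins12 /= ?zag;
  rewrite ?(mul0r, mul1r, mulr0, addr0, add0r) //.
- by rewrite ctr_eq0 ?add0r ?mulVKf ?mulKf // => a b; rewrite mul0r.
- by rewrite ctr_eq0 ?add0r ?mulVKf ?mulKf // => a b; rewrite mul0r.
Qed.

(** The new letters add g + g^-1 to the loop value, and x (g + g^-1) is exactly what turns th +
    th^-1 into the same expression in [glue_th]. *)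
Lemma glue_loop : xq * (ctr glue_om glue_Om + 1) = glue_th + glue_th^-1.
Proof.
rewrite glue_ctr /=.
have -> : xq * (ctr om (fun v w => Om v w) + g + g^-1 * 1 + 1) =
  th + th^-1 + xq * (g + g^-1) by rewrite -(bl_loop HS); ring.
rewrite /glue_th /g /xq; field.
by rewrite oppr_eq0 th0 q0.
Qed.

Lemma glue_pt12 v a :
  ctr12 glue_om (op23 glue_S (ins12 glue_Om v)) a = glue_th^-1 * v a.
Proof.
rewrite /ctr12 glue_ctr; case: a => [w|[]]; rewrite /op23 /ins12 /=.
- have -> : ctr om (fun a b => S (fun b c => Om a b * v (inl c)) b w
      + xq * Om b w * (0 * v tm)) = th^-1 * v (inl w).
    have := bl_pt12 HS (fun a => v (inl a)) w; rewrite /ctr12 => <-.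
    by congr (ctr om _); apply/funext => a; apply/funext => b;
      rewrite mul0r mulr0 addr0.
  rewrite /glue_th /g /xq; field; by rewrite ?oppr_eq0 ?q0 ?th0.
- rewrite ctr_eq0 => [|b c]; last by rewrite mul0r oppr0.
  rewrite /glue_th /g /xq; field; by rewrite ?oppr_eq0 ?q0 ?th0.
- rewrite (ctr_eq0 om (F := fun b c => _ * v (inl c))) => [|b c]; last first.
    by rewrite mul0r.
  have -> : ctr om (fun a b => - (0 * v (inl b)) + xq * (Om a b * v tm)) =
     xq * ctr om Om * v tm.
    rewrite /ctr !mulr_sumr mulr_suml; apply: eq_bigr => b _.
    rewrite !mulr_sumr mulr_suml; apply: eq_bigr => c _; ring.
  have -> : xq * ctr om Om = th + th^-1 - xq by rewrite -(bl_loop HS); ring.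
  rewrite /glue_th /g /xq; field; by rewrite ?oppr_eq0 ?q0 ?th0.
Qed.

Lemma glue_pt23 v a :
  ctr23 glue_om (op12 glue_S (ins23 glue_Om v)) a = glue_th^-1 * v a.
Proof.
rewrite /ctr23 glue_ctr; case: a => [w|[]]; rewrite /op12 /ins23 /=.
- have -> : ctr om (fun b c => S (fun a b => Om b c * v (inl a)) w b
      + xq * Om w b * (0 * v tp)) = th^-1 * v (inl w).
    have := bl_pt23 HS (fun a => v (inl a)) w; rewrite /ctr23 => <-.
    by congr (ctr om _); apply/funext => a; apply/funext => b;
      rewrite mul0r mulr0 addr0.
  rewrite /glue_th /g /xq; field; by rewrite ?oppr_eq0 ?q0 ?th0.
- rewrite (ctr_eq0 om (F := fun b c => _ * v (inl b))) => [|b c]; last first.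
    by rewrite mul0r.
  have -> : ctr om (fun b c => 0 * v (inl b) + xq * (Om b c * v tp)) =
     xq * ctr om Om * v tp.
    rewrite /ctr !mulr_sumr mulr_suml; apply: eq_bigr => b _.
    rewrite !mulr_sumr mulr_suml; apply: eq_bigr => c _; ring.
  have -> : xq * ctr om Om = th + th^-1 - xq by rewrite -(bl_loop HS); ring.
  rewrite /glue_th /g /xq; field; by rewrite ?oppr_eq0 ?q0 ?th0.
- rewrite ctr_eq0 => [|b c]; last by rewrite mul0r.
  rewrite /glue_th /g /xq; field; by rewrite ?oppr_eq0 ?q0 ?th0.
Qed.

Definition add12 (G : I -> I -> I -> K) (v : I -> K) a b c := G a b c + xq * Om a b * v c.
Definition add23 (G : I -> I -> I -> K) (v : I -> K) a b c := G a b c + xq * Om b c * v a.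

Lemma add12E G v : add12 G v = lc3 xq (ins12 Om v) G.
Proof.
by apply/funext=> a; apply/funext=> b; apply/funext=> c;
  rewrite /add12 /lc3 /ins12; ring.
Qed.

Lemma add23E G v : add23 G v = lc3 xq (ins23 Om v) G.
Proof.
by apply/funext=> a; apply/funext=> b; apply/funext=> c;
  rewrite /add23 /lc3 /ins23; ring.
Qed.

Lemma ins23_scale k v : ins23 Om (fun a => k * v a) =
  fun a b c => k * ins23 Om v a b c.
Proof.
by apply/funext=> a; apply/funext=> b; apply/funext=> c; rewrite /ins23; ring.
Qed.

(** At inner letters, [glue_S] reads outer ones only through [F tp tm]. Hence besides the inner part
    [G] only the slices [P], [Q], [R] with [tp] before [tm] occur; they enter multiplied by cups,
    which slide by [s1s2_ins12] and [s2s1_ins23]. *)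
Lemma glue_braid_VVV F a b c :
  op12 glue_S (op23 glue_S (op12 glue_S F)) (inl a) (inl b) (inl c) =
  op23 glue_S (op12 glue_S (op23 glue_S F)) (inl a) (inl b) (inl c).
Proof.
pose G a b c := F (inl a) (inl b) (inl c).
pose P c := F tp tm (inl c); pose Q c := F tp (inl c) tm.
pose R c := F (inl c) tp tm.
transitivity (add12 (op12 S (add23 (op23 S (add12 (op12 S G) P)) (fun a => - Q a)))
  (fun c => R c + xq * Q c) a b c); first by [].
transitivity (add23 (op23 S (add12 (op12 S (add23 (op23 S G) R)) Q))
  (fun c => - (- P c + xq * Q c)) a b c); last by [].
have nQ : (fun a => - Q a) = fun a => (-1) * Q a.
  by apply/funext => d; rewrite mulN1r.
rewrite nQ !(add12E, add23E) ins23_scale.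
rewrite !(s1_lc HS, s2_lc HS) (s1_scale HS).
rewrite (s1s2_ins12 HS) // (s2s1_ins23 HS) // (bl_braid HS) /lc3.
have := s1_ins23_s2_ins12 HS th0 x0 Q a b c => /(canRL (addrK _)) ->.
rewrite /ins12 /ins23; ring.
Qed.

Section SlicesVVV.
Context (G : I -> I -> I -> K) (P Q R : I -> K).

(** This and the next three contractions are those that the entry ([tp], [tm]) of [glue_S] produces
    when one inner letter is left over. *)
Lemma ctr23_add12_s1 a :
  ctr23 om (add12 (op12 S G) P) a = ctr23 om (op12 S G) a + xq * P a.
Proof.
rewrite add12E /ctr23 /lc3 ctr_lin.
have := congr1 (fun v => v a) (bl_zag HS P); rewrite /ctr23 /= => ->; ring.
Qed.

Lemma ctr12_add23_s2 a :
  ctr12 om (add23 (op23 S G) R) a = ctr12 om (op23 S G) a + xq * R a.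
Proof.
rewrite add23E /ctr12 /lc3 ctr_lin.
have := congr1 (fun v => v a) (bl_zig HS R); rewrite /ctr12 /= => ->; ring.
Qed.

Lemma ctr23_slice a :
  ctr23 om (add12 (op12 S (add23 (op23 S G) R)) Q) a =
  ctr12 om G a + xq * th^-1 * R a + xq * Q a.
Proof.
rewrite add23E (s1_lc HS) -(ctr23_s1s2 HS th0 x0) add12E /ctr23 /lc3 !ctr_lin.
have := congr1 (fun v => v a) (bl_zag HS Q); rewrite /ctr23 /= => ->.
have := bl_pt23 HS R a; rewrite /ctr23 => ->; ring.
Qed.

Lemma ctr12_slice a :
  ctr12 om (add23 (op23 S (add12 (op12 S G) P)) (fun c => - Q c)) a =
  ctr23 om G a + xq * th^-1 * P a - xq * Q a.
Proof.
rewrite add12E (s2_lc HS) -(ctr12_s2s1 HS th0 x0) add23E /ctr12 /lc3 !ctr_lin.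
have := congr1 (fun v => v a) (bl_zig HS (fun c => - Q c)); rewrite /ctr12 /= => ->.
have := bl_pt12 HS P a; rewrite /ctr12 => ->; ring.
Qed.
End SlicesVVV.

(** Linearity in a shape that serves every case of [glue_braid]; shorter combinations are padded
    with zero multiples of [Om]. *)
Lemma S_ext k1 k2 k3 k4 F F1 F2 F3 F4 :
  (forall v w, F v w = k1 * F1 v w + k2 * F2 v w + k3 * F3 v w + k4 * F4 v w) ->
  forall a b,
  S F a b = k1 * S F1 a b + k2 * S F2 a b + k3 * S F3 a b + k4 * S F4 a b.
Proof.
move=> FE a b.
have -> : F = lc2 k1 F1 (lc2 k2 F2 (lc2 k3 F3 (fun v w => k4 * F4 v w))).
  by apply/funext => v; apply/funext => w; rewrite FE /lc2; ring.
by rewrite !(S_lc2 HS) (S_scale HS) /lc2; ring.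
Qed.

Lemma ctr_ext k1 k2 k3 k4 F F1 F2 F3 F4 :
  (forall v w, F v w = k1 * F1 v w + k2 * F2 v w + k3 * F3 v w + k4 * F4 v w) ->
  ctr om F =
    k1 * ctr om F1 + k2 * ctr om F2 + k3 * ctr om F3 + k4 * ctr om F4.
Proof.
move=> FE.
have -> : F = lc2 k1 F1 (lc2 k2 F2 (lc2 k3 F3 (fun v w => k4 * F4 v w))).
  by apply/funext => v; apply/funext => w; rewrite FE /lc2; ring.
by rewrite /lc2 !ctr_lin ctr_scale; ring.
Qed.

Lemma glue_braid F a b c : 
  op12 glue_S (op23 glue_S (op12 glue_S F)) a b c =
  op23 glue_S (op12 glue_S (op23 glue_S F)) a b c.
Proof.
pose G a b c := F (inl a) (inl b) (inl c).
pose P c := F tp tm (inl c); pose Q c := F tp (inl c) tm.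
pose R c := F (inl c) tp tm.
pose Fp1 v w := F tp (inl v) (inl w); pose Fm1 v w := F tm (inl v) (inl w).
pose Fp2 v w := F (inl v) tp (inl w); pose Fm2 v w := F (inl v) tm (inl w).
pose Fp3 v w := F (inl v) (inl w) tp; pose Fm3 v w := F (inl v) (inl w) tm.

have S_m a' b' : S (fun v w => - F (inl v) tm (inl w) + xq * F (inl v) (inl w) tm)
    a' b' = - S Fm2 a' b' + xq * S Fm3 a' b'.
  rewrite (S_ext (k1 := -1) (F1 := Fm2) (k2 := xq) (F2 := Fm3) (k3 := 0)
     (F3 := Om) (k4 := 0) (F4 := Om)); first by ring.
  by move=> v w; rewrite /Fm2 /Fm3; ring.
have S_p a' b' : S (fun v w => F (inl v) tp (inl w) + xq * F tp (inl v) (inl w))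
    a' b' = S Fp2 a' b' + xq * S Fp1 a' b'.
  rewrite (S_ext (k1 := 1) (F1 := Fp2) (k2 := xq) (F2 := Fp1) (k3 := 0)
     (F3 := Om) (k4 := 0) (F4 := Om)); first by ring.
  by move=> v w; rewrite /Fp2 /Fp1; ring.
have S_opp a' b' : S (fun v w => - F (inl v) tp (inl w)) a' b' = - S Fp2 a' b'.
  rewrite (S_ext (k1 := -1) (F1 := Fp2) (k2 := 0) (F2 := Om) (k3 := 0)
     (F3 := Om) (k4 := 0) (F4 := Om)); first by ring.
  by move=> v w; rewrite /Fp2; ring.
pose Fm v w := - (- Fm1 v w + xq * Fm2 v w) +
  xq * (S Fm3 v w + xq * Om v w * F tp tm tm).
have S_mm a' b' : S Fm a' b' = S Fm1 a' b' - xq * S Fm2 a' b'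
    + xq * S (S Fm3) a' b' + xq * xq * F tp tm tm * S Om a' b'.
  rewrite (S_ext (k1 := 1) (F1 := Fm1) (k2 := - xq) (F2 := Fm2) (k3 := xq)
     (F3 := S Fm3) (k4 := xq * xq * F tp tm tm) (F4 := Om)); first by ring.
  by move=> v w; rewrite /Fm; ring.
pose Fp v w := Fp3 v w + xq * Fp2 v w +
  xq * (S Fp1 v w + xq * Om v w * F tp tp tm).
have S_pp a' b' : S Fp a' b' = S Fp3 a' b' + xq * S Fp2 a' b'
    + xq * S (S Fp1) a' b' + xq * xq * F tp tp tm * S Om a' b'.
  rewrite (S_ext (k1 := 1) (F1 := Fp3) (k2 := xq) (F2 := Fp2) (k3 := xq)
     (F3 := S Fp1) (k4 := xq * xq * F tp tp tm) (F4 := Om)); first by ring.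
  by move=> v w; rewrite /Fp; ring.
have loop : ctr om Om = (th + th^-1) / xq - 1.
  by rewrite -(bl_loop HS); field.
(* This is the side condition met when [field] clears the denominator [xq] of the loop value. *)
have x1 : q ^+ 2 + 1 != 0.
  have xE : xq = (q ^+ 2 + 1) / q by rewrite /xq; field.
  by apply: contraNneq x0 => h; rewrite xE h mul0r.
(* Of the 27 triples of letters, those left after [ring] and [field] have an expression under [S] or
   [ctr] that must be simplified first. *)
case: a b c => [a|[]] [b|[]] [c|[]]; first (by apply: glue_braid_VVV);
 rewrite /op12 /op23 /=;
 try by [ring | field; rewrite ?q0 | rewrite /xq; field; rewrite ?q0 ?g0].
all: try by rewrite /xq /g; field; rewrite ?q0 ?th0.
- rewrite -/Fp1 (_ : (fun v w => - - Fp1 v w) = Fp1); last first.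
    by apply/funext => v; apply/funext => w; rewrite opprK.
  field; exact: q0.
- rewrite S_m -/Fm S_mm (bl_quad HS) (bl_SOm HS) -/Fm1 -/Fm3 /glue_g /xq.
  rewrite /Fm3 /=; field; by rewrite ?th0 ?q0.
- rewrite S_p S_opp -/Fp1 /xq; field; by rewrite ?th0 ?q0.
- set c := ctr om (fun v w => S _ a v + _).
  have -> : c = _ := ctr23_slice G Q R a.
  rewrite /Q /R /ctr12 /G /glue_g /xq.
  by field; rewrite ?th0 ?q0.
- rewrite S_m -/Fm2 -/Fm3 /xq; field; by rewrite ?th0 ?q0.
- rewrite S_p -/Fp S_pp (bl_quad HS) (bl_SOm HS) -/Fp3 -/Fp1 /glue_g /xq.
  rewrite /Fp1 /=; field; by rewrite ?th0 ?q0.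
- set c := ctr om (fun v w => S _ b v + _).
  have -> : c = _ := ctr23_add12_s1 G P b.
  set d := ctr om (fun v w => S _ w b + _).
  have -> : d = _ := ctr12_add23_s2 G R b.
  have := ctr12_s2_ctr23_s1 HS th0 x0 G b => /(canRL (addrK _)) ->.
  rewrite /P /R /ctr12 /ctr23 /G /glue_g /xq.
  by field; rewrite ?th0 ?q0.
- rewrite (ctr_ext (F := Fp) (k1 := 1) (F1 := Fp3) (k2 := xq) (F2 := Fp2)
    (k3 := xq) (F3 := S Fp1) (k4 := xq * xq * F tp tp tm) (F4 := Om)); last first.
    by move=> v w; rewrite /Fp; ring.
  rewrite (ctr_ext (F := fun v w => F (inl v) tp (inl w) + _)
    (k1 := 1) (F1 := Fp2) (k2 := xq) (F2 := Fp1) (k3 := 0)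
     (F3 := Om) (k4 := 0) (F4 := Om)); last first.
    by move=> v w; rewrite /Fp1 /Fp2; ring.
  rewrite (ctr_ext (F := fun v w => - F (inl v) tp (inl w))
    (k1 := -1) (F1 := Fp2) (k2 := 0) (F2 := Om) (k3 := 0)
     (F3 := Om) (k4 := 0) (F4 := Om)); last first.
    by move=> v w; rewrite /Fp2; ring.
  rewrite (bl_omS HS) loop -/Fp3 -/Fp1 /glue_g /xq.
  by field; rewrite ?th0 ?q0 -?expr2 ?x1.
- set d := ctr om (fun v w => S _ w c + _).
  have -> : d = _ := ctr12_slice G P Q c.
  rewrite /P /Q /ctr12 /ctr23 /G /glue_g /xq.
  by field; rewrite ?th0 ?q0.
- rewrite -/Fp1 (_ : (fun v w => - - Fp1 v w) = Fp1); last first.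
    by apply/funext => v; apply/funext => w; rewrite opprK.
  by rewrite -/Fp1 /glue_g /xq; field; rewrite ?th0 ?q0.
- rewrite (ctr_ext (F := Fm) (k1 := 1) (F1 := Fm1) (k2 := - xq) (F2 := Fm2)
    (k3 := xq) (F3 := S Fm3) (k4 := xq * xq * F tp tm tm) (F4 := Om)); last first.
    by move=> v w; rewrite /Fm; ring.
  rewrite (ctr_ext (F := fun v w => - F (inl v) tm (inl w) + _)
    (k1 := -1) (F1 := Fm2) (k2 := xq) (F2 := Fm3) (k3 := 0)
     (F3 := Om) (k4 := 0) (F4 := Om)); last first.
    by move=> v w; rewrite /Fm2 /Fm3; ring.
  rewrite (bl_omS HS) loop -/Fm1 -/Fm3 /glue_g /xq.
  by field; rewrite ?th0 ?q0 -?expr2 ?x1.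
Qed.

Lemma glue_local : bmw_local glue_S glue_Om glue_om glue_th.
Proof.
split; [exact: glue_lin | exact: glue_quad | exact: glue_SOm | exact: glue_omS
 | exact: glue_zig | exact: glue_zag | exact: glue_pt12 | exact: glue_pt23
 | exact: glue_loop | move=> F].
by do 3 apply/funext => ?; apply: glue_braid.
Qed.
End Glue.

(** * The tower of alphabets and its triangularity *)

Record rdata := RData {
  rI : finType;
  rS : (rI -> rI -> K) -> rI -> rI -> K;
  rOm : rI -> rI -> K;
  rom : rI -> rI -> K;
  rk : rI -> int }.

(** The inverse of the crossing, from s + s^-1 = x (1 + e). *)
Definition rT (D : rdata) F a b :=
  xq * (F a b + rOm a b * ctr (@rom D) F) - @rS D F a b.

(* Letters are signed levels; [rk_S] and [rk_T] say that a letter crossing to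
   the other side can only be replaced by a higher one. *)
Record rgood (D : rdata) (k : nat) (th : K) : Prop := RGood {
  rg_local : bmw_local (@rS D) (@rOm D) (@rom D) th;
  rk_inj : injective (@rk D);
  rk_bound : forall a : rI D, (0 < `|rk a| <= k)%N;
  rk_surj : forall z : int, (0 < `|z| <= k)%N -> exists a : rI D, rk a = z;
  rk_Om : forall a b : rI D, (rOm a b != 0) = (rk b == - rk a);
  rk_om : forall a b : rI D, (rom a b != 0) = (rk b == - rk a);
  rk_S : forall c d : rI D, exists2 cf : K, cf != 0 & forall F,
    (forall a b, (rk c < rk b)%R -> F a b = 0) -> rS F c d = cf * F d c;
  rk_T : forall c d : rI D, exists2 cf : K, cf != 0 & forall F,
    (forall a b, (rk d < rk a)%R -> F a b = 0) -> rT F c d = cf * F d c }.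

Definition rdata0 : rdata := @RData void (fun F => F) (fun _ _ => 0) (fun _ _ => 0)
  (fun _ => 0).

(** With no letters everything is void except the loop relation, which becomes q + q^-1 = th + th^-1
    and explains the initial value q of [th]. *)
Lemma rgood0 : q != 0 -> rgood rdata0 0 q.
Proof.
move=> q0; split=> //=; try by case.
- split=> //=; try by move=> *; apply/funext => -[]; try by case.
  + by move=> *; rewrite /ctr !big1 ?mulr0 //; case.
  + by rewrite /ctr big1 ?add0r ?mulr1 //; case.
- by case=> [[|z]|z].
Qed.

(** The letter [tp] must be the lowest: the entry of [glue_S] at ([tp], [tm]) reads all pairs of
    dual letters, the one at ([tm], [tp]) only [F tp tm]. *)
Definition rglue (D : rdata) (k : nat) (th : K) : rdata :=
  @RData (rI D + bool)%type (glue_S (@rS D) (@rOm D) (@rom D) th)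
    (glue_Om (@rOm D) th) (glue_om (@rom D) th)
    (fun a => match a with
      | inl v => rk v | inr true => - k.+1%:Z | inr false => k.+1%:Z end).

(** The added letters have the two extreme ranks. Under the vanishing assumptions of [rk_S] and
    [rk_T], every term of an entry other than the exchanged one either contains too high a letter or
    cancels. *)
Lemma rgood_glue D k th : q != 0 -> xq != 0 -> th != 0 ->
  rgood D k th -> rgood (rglue D k th) k.+1 (glue_th th).
Proof.
move=> q0 x0 th0 G; have HS := rg_local G.
have bnd (v : rI D) : (- k.+1%:Z < rk v < k.+1%:Z)%R.
  by have := rk_bound G v; lia.
have g0 : glue_g th != 0 by rewrite mulf_neq0 ?oppr_eq0 // invr_neq0.
split.
- exact: glue_local.
- move=> [v|[]] [w|[]] //= E; try (by have := bnd v; lia);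
    try (by have := bnd w; lia); try (exfalso; lia).
  by rewrite (rk_inj G E).
- by case=> [v|[]] /=; [have := rk_bound G v; lia | lia | lia].
- move=> z hz; have [/(rk_surj G)[a Ea]|zk] := boolP (0 < `|z| <= k)%N.
    by exists (inl a).
  by have [z0|z0] := leP 0 z; [exists (inr false) | exists (inr true)] => /=; lia.
- case=> [v|[]] [w|[]] /=; rewrite ?(rk_Om G) ?eqxx ?g0 ?oner_eq0 //;
   symmetry; try (apply/eqP => E); try (by have := bnd v; lia);
    try (by have := bnd w; lia); lia.
- case=> [v|[]] [w|[]] /=; rewrite ?(rk_om G) ?eqxx ?invr_eq0 ?g0 ?oner_eq0 //;
   symmetry; try (apply/eqP => E); try (by have := bnd v; lia);
    try (by have := bnd w; lia); lia.
- case=> [v|[]] [w|[]] /=.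
  + have [cf cf0 Hcf] := rk_S G v w; exists cf => // F hF.
    rewrite (hF (inr true) (inr false)) ?mulr0 ?addr0 /=; last first.
      by have := bnd v; lia.
    by rewrite (Hcf (fun v w => F (inl v) (inl w))) // => a b hab; apply: hF.
  + by exists (-1) => [|F hF]; rewrite ?oppr_eq0 ?oner_eq0 // mulN1r.
  + exists (-1) => [|F hF]; rewrite ?oppr_eq0 ?oner_eq0 // mulN1r.
    by rewrite (hF (inl v) (inr false)) ?mulr0 ?addr0 //=; have := bnd v; lia.
  + exists 1 => [|F hF]; rewrite ?oner_eq0 // mul1r.
    by rewrite (hF (inr true) (inl w)) ?mulr0 ?addr0 //=; have := bnd w; lia.
  + by exists q.
  + exists q^-1 => [|F hF]; rewrite ?invr_eq0 //.
    rewrite (hF (inr true) (inr false)) /=; last by lia.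
    rewrite ctr_eq0 ?mulr0 ?addr0 // => a b; apply: hF => /=.
    by have := bnd b; lia.
  + by exists 1 => [|F hF]; rewrite ?oner_eq0 // mul1r.
  + by exists q^-1 => [|F hF]; rewrite ?invr_eq0.
  + by exists q.
- case=> [v|[]] [w|[]] /=; rewrite /rT /=.
  + have [cf cf0 Hcf] := rk_T G v w; exists cf => // F hF.
    rewrite glue_ctr (hF (inr false) (inr true)) /=; last first.
      by have := bnd w; lia.
    rewrite -(Hcf (fun v w => F (inl v) (inl w))) => [|a b hab]; last exact: hF.
    rewrite /rT; ring.
  + exists 1 => [|F hF]; rewrite ?oner_eq0 //.
    by rewrite (hF (inl v) (inr true)) /=; [ring | have := bnd v; lia].
  + by exists 1 => [|F hF]; rewrite ?oner_eq0 //; ring.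
  + by exists (-1) => [|F hF]; rewrite ?oppr_eq0 ?oner_eq0 //; ring.
  + by exists q^-1 => [|F hF]; rewrite ?invr_eq0 // /xq; ring.
  + exists q => // F hF; rewrite glue_ctr /xq; field.
    by rewrite ?oppr_eq0 ?th0 ?q0 ?g0.
  + exists (-1) => [|F hF]; rewrite ?oppr_eq0 ?oner_eq0 //.
    by rewrite (hF (inr false) (inl w)) /=; [ring | have := bnd w; lia].
  + exists q => // F hF; rewrite glue_ctr (hF (inr false) (inr true)) /=; last lia.
    rewrite ctr_eq0 => [|a b]; last by apply: hF => /=; have := bnd a; lia.
    by rewrite /xq; ring.
  + by exists q^-1 => [|F hF]; rewrite ?invr_eq0 // /xq; ring.
Qed.

Fixpoint rtower (k : nat) : rdata * K :=
  if k is k'.+1 then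
    let: (D, th) := rtower k' in (rglue D k' th, glue_th th)
  else (rdata0, q).

Lemma rtower_good k : q != 0 -> xq != 0 ->
  rgood (rtower k).1 k (rtower k).2 /\ (rtower k).2 = q * (- q ^- 2) ^+ k.
Proof.
move=> q0 x0; elim: k => [|k [IH Eth]].
  by rewrite expr0 mulr1; split=> //; apply: rgood0.
move: IH Eth; rewrite /=; case: (rtower k) => D th /= IH Eth.
have th0 : th != 0.
  by rewrite Eth mulf_neq0 // expf_neq0 // oppr_eq0 invr_neq0 // expf_neq0.
split; first exact: rgood_glue.
by rewrite /glue_th Eth (exprSr _ k) mulrA mulrN mulNr.
Qed.
End Local.

(** * Spanning words *)

(* [Bs i], [Bt i] and [Be i] stand for s_i, s_i^-1 and e_i. *)
Inductive bgen := Bs of nat | Bt of nat | Be of nat.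

Definition bgen_encode (g : bgen) : nat + nat + nat :=
  match g with Bs i => inl (inl i) | Bt i => inl (inr i) | Be i => inr i end.
Definition bgen_decode (c : nat + nat + nat) : bgen :=
  match c with inl (inl i) => Bs i | inl (inr i) => Bt i | inr i => Be i end.
Lemma bgen_encodeK : cancel bgen_encode bgen_decode. Proof. by case. Qed.
HB.instance Definition _ := Equality.copy bgen (can_type bgen_encodeK).

(* [dwd k m] is s_k .. s_(k+m-1) and [uwd k m] is s_(k+m)^-1 .. s_(k+1)^-1. *)
Fixpoint dwd k m := if m is m'.+1 then rcons (dwd k m') (Bs (k + m')) else [::].
Fixpoint uwd k m := if m is m'.+1 then Bt (k + m'.+1) :: uwd k m' else [::].

(** With m strands there are m chains of the first kind and m - 1 of the second, as many as possible
    partners of one point among 2 m. The chain [dwd] stands to the right of [b] so that it reaches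
    the nested cups first and can be moved to their other ends. *)
Fixpoint nf_words k m : seq (seq bgen) :=
  if m is m'.+1 then
    [seq b ++ dwd k j | j <- iota 0 m, b <- nf_words k.+1 m'] ++
    [seq uwd k j ++ Be k :: b | j <- iota 0 m', b <- nf_words k.+1 m']
  else [:: [::]].

Lemma size_nf_words k m : size (nf_words k m) = (\prod_(0 <= i < m) (2 * i + 1))%N.
Proof.
elim: m k => [|m IH] k; first by rewrite big_nil.
rewrite big_nat_recr //.
rewrite -[nf_words _ _]/([seq b ++ dwd k j | j <- iota 0 m.+1, b <- nf_words k.+1 m]
  ++ [seq uwd k j ++ Be k :: b | j <- iota 0 m, b <- nf_words k.+1 m]).
rewrite size_cat !size_allpairs !size_iota IH -mulnDl mulnC.
by congr (_ * _)%N; lia.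
Qed.

(** * Consequences of the Birman-Wenzl-Murakami relations *)

Section Span.
Context (R : comPzRingType) (B : pzRingType) (iota : {rmorphism R -> B}).
Context (x xV : R) (n : nat) (s t e : nat -> B).

Record bmw_rel : Prop := BmwRel {
  br_central : forall k u, iota k * u = u * iota k;
  br_xxV : x * xV = 1;
  br_st : forall i, (i.+1 < n)%N -> s i * t i = 1;
  br_ts : forall i, (i.+1 < n)%N -> t i * s i = 1;
  br_e : forall i, (i.+1 < n)%N -> e i = iota xV * (s i + t i) - 1;
  br_se : forall i, (i.+1 < n)%N -> s i * e i = e i;
  br_braid : forall i, (i.+2 < n)%N ->
    s i * s i.+1 * s i = s i.+1 * s i * s i.+1;
  br_comm : forall i j, (i.+1 < j)%N -> (j.+1 < n)%N -> s i * s j = s j * s i;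
  br_ese : forall i j, (i.+1 < n)%N -> (j.+1 < n)%N ->
    j = i.+1 \/ i = j.+1 -> e i * s j * e i = e i;
  br_ete : forall i j, (i.+1 < n)%N -> (j.+1 < n)%N ->
    j = i.+1 \/ i = j.+1 -> e i * t j * e i = e i }.

Hypothesis H : bmw_rel.

Notation adj i j := (j = i.+1 \/ i = j.+1).

Lemma es i : (i.+1 < n)%N -> e i * s i = e i.
Proof.
move=> hi; rewrite -[RHS](br_se H hi).
have E : s i * (s i + t i) = (s i + t i) * s i.
  by rewrite mulrDr mulrDl (br_st H hi) (br_ts H hi).
rewrite (br_e H hi) mulrBl mulrBr mul1r mulr1 mulrA -(br_central H).
by rewrite -!mulrA E.
Qed.

Lemma te i : (i.+1 < n)%N -> t i * e i = e i.
Proof. by move=> hi; rewrite -{1}(br_se H hi) mulrA (br_ts H hi) mul1r. Qed.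

Lemma et i : (i.+1 < n)%N -> e i * t i = e i.
Proof. by move=> hi; rewrite -{1}(es hi) -mulrA (br_st H hi) mulr1. Qed.

Lemma ee i : (i.+1 < n)%N -> e i * e i = iota xV * (e i + e i) - e i.
Proof.
move=> hi; rewrite {1}(br_e H hi) mulrBl mul1r -mulrA mulrDl.
by rewrite (br_se H hi) (te hi).
Qed.

Lemma s_skein i : (i.+1 < n)%N -> s i + t i = iota x * (1 + e i).
Proof.
move=> hi; rewrite (br_e H hi) addrCA subrr addr0 mulrA -rmorphM.
by rewrite (br_xxV H) rmorph1 mul1r.
Qed.

Lemma sE i : (i.+1 < n)%N -> s i = iota x * (1 + e i) - t i.
Proof. by move=> hi; rewrite -(s_skein hi) addrK. Qed.

Lemma tE i : (i.+1 < n)%N -> t i = iota x * (1 + e i) - s i.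
Proof. by move=> hi; rewrite -(s_skein hi) addrC addKr. Qed.

Lemma tt i : (i.+1 < n)%N -> t i * t i = iota x * t i - 1 + iota x * e i.
Proof.
move=> hi; rewrite {1}(tE hi) mulrBl (br_st H hi) -mulrA mulrDl mul1r (et hi).
by rewrite mulrDr addrAC.
Qed.

Lemma ss i : (i.+1 < n)%N -> s i * s i = iota x * s i - 1 + iota x * e i.
Proof.
move=> hi; rewrite {1}(sE hi) mulrBl (br_ts H hi) -mulrA mulrDl mul1r (es hi).
by rewrite mulrDr addrAC.
Qed.

Lemma eXV i : (i.+1 < n)%N -> e i = iota xV * (t i * t i + 1) - t i.
Proof.
move=> hi; rewrite (tt hi) addrAC addrNK -mulrDr mulrA -rmorphM.
by rewrite mulrC (br_xxV H) rmorph1 mul1r addrC addKr.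
Qed.

Lemma braid_adj i j : (i.+1 < n)%N -> (j.+1 < n)%N -> adj i j ->
  s i * s j * s i = s j * s i * s j.
Proof.
by move=> hi hj [] E; subst; [apply: (br_braid H) | symmetry; apply: (br_braid H)].
Qed.

(* Inverses and the idempotents [e] are handled uniformly: any element
   commuting with a word commutes with its inverse and with [e]. *)
Lemma conj_t u v i j : (i.+1 < n)%N -> (j.+1 < n)%N ->
  u * s i = s j * v -> t j * u = v * t i.
Proof.
move=> hi hj E.
rewrite -[LHS]mulr1 -(br_st H hi) !mulrA -(mulrA (t j)) E !mulrA.
by rewrite (br_ts H hj) mul1r.
Qed.

Lemma conj_st u i j : (i.+1 < n)%N -> (j.+1 < n)%N ->
  u * s i = s j * u -> u * t i = t j * u.
Proof. by move=> hi hj E; rewrite (conj_t hi hj E). Qed.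

Lemma conj_se u i j : (i.+1 < n)%N -> (j.+1 < n)%N ->
  u * s i = s j * u -> u * e i = e j * u.
Proof.
move=> hi hj E; rewrite (br_e H hi) (br_e H hj) mulrBr mulrBl mulr1 mul1r.
rewrite mulrA -(br_central H) -!mulrA; congr (iota _ * _ - _).
by rewrite mulrDr mulrDl E (conj_st hi hj E).
Qed.

Lemma conj_ts u i j : (i.+1 < n)%N -> (j.+1 < n)%N ->
  u * t i = t j * u -> u * s i = s j * u.
Proof.
move=> hi hj E; rewrite -[LHS]mul1r -(br_st H hj) -!mulrA (mulrA (t j)) -E.
by rewrite -mulrA (br_ts H hi) mulr1.
Qed.

Lemma far_ss i j : (i.+1 < n)%N -> (j.+1 < n)%N -> (i.+1 < j)%N || (j.+1 < i)%N ->
  s i * s j = s j * s i.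
Proof.
by move=> hi hj /orP[h|h]; [apply: (br_comm H) | symmetry; apply: (br_comm H)].
Qed.

Definition far i j := [&& (i.+1 < n)%N, (j.+1 < n)%N & (i.+1 < j)%N || (j.+1 < i)%N].

Lemma farC i j : far i j = far j i.
Proof. by rewrite /far andbCA orbC. Qed.

Lemma far_s_s i j : far i j -> s i * s j = s j * s i.
Proof. by case/and3P => *; apply: far_ss. Qed.
Lemma far_s_t i j : far i j -> s i * t j = t j * s i.
Proof. by move=> f; case/and3P: (f) => *; apply: conj_st => //; apply: far_s_s. Qed.
Lemma far_s_e i j : far i j -> s i * e j = e j * s i.
Proof. by move=> f; case/and3P: (f) => *; apply: conj_se => //; apply: far_s_s. Qed.
Lemma far_t_t i j : far i j -> t i * t j = t j * t i.
Proof.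
move=> f; case/and3P: (f) => *; apply: conj_st => //; symmetry; apply: far_s_t.
by rewrite farC.
Qed.
Lemma far_t_e i j : far i j -> t i * e j = e j * t i.
Proof.
move=> f; case/and3P: (f) => *; apply: conj_se => //; symmetry; apply: far_s_t.
by rewrite farC.
Qed.
Lemma far_e_e i j : far i j -> e i * e j = e j * e i.
Proof.
move=> f; case/and3P: (f) => *; apply: conj_se => //; symmetry; apply: far_s_e.
by rewrite farC.
Qed.

Section Adjacent.
Context (i j : nat) (hi : (i.+1 < n)%N) (hj : (j.+1 < n)%N) (a : adj i j).

Lemma adjC : adj j i. Proof. by case: a => ->; auto. Qed.

Lemma ss_e : s i * s j * e i = e j * (s i * s j).
Proof. by apply: conj_se => //; rewrite braid_adj // mulrA. Qed.

Lemma tt_t : t i * t j * t i = t j * t i * t j.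
Proof.
have E := braid_adj hi hj a.
have K : t j * t i * t j * (s j * s i * s j) = 1.
  rewrite -!mulrA (mulrA (t j) (s j)) (br_ts H hj) mul1r.
  by rewrite (mulrA (t i)) (br_ts H hi) mul1r (br_ts H hj).
have K' : s i * s j * s i * (t i * t j * t i) = 1.
  rewrite -!mulrA (mulrA (s i) (t i)) (br_st H hi) mul1r.
  by rewrite (mulrA (s j)) (br_st H hj) mul1r (br_st H hi).
by rewrite -[RHS]mulr1 -K' E mulrA K mul1r.
Qed.

Lemma tt_e : t i * t j * e i = e j * (t i * t j).
Proof.
apply: conj_se => //; apply: conj_ts => //; first by rewrite tt_t mulrA.
Qed.

Lemma eee : e i * e j * e i = e i.
Proof.
rewrite (br_e H hj) mulrBr mulr1 mulrBl mulrA -(br_central H) -!mulrA.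
rewrite mulrDl mulrDr !mulrA (br_ese H hi hj a) (br_ete H hi hj a) (ee hi).
by rewrite opprB addrCA subrr addr0.
Qed.

End Adjacent.

Section AdjacentE.
Context (i j : nat) (hi : (i.+1 < n)%N) (hj : (j.+1 < n)%N) (a : adj i j).

(** Insert [e j * s i * e j] for [e j]: its last two factors are rewritten by [ss_e], which leaves
    [e i * e j * e i] in front. *)
Lemma ee_ss : e i * e j = e i * (s j * s i).
Proof.
have aj := adjC a.
have E : s i * e j = t j * (e i * (s j * s i)).
  by rewrite -(ss_e hj hi aj) !mulrA (br_ts H hj) mul1r.
rewrite -[in LHS](br_ese H hj hi aj) -(mulrA (e j)) E.
by rewrite (mulrA (e j)) (et hj) !mulrA (eee hi hj a).
Qed.

Lemma ee_tt : e i * e j = e i * (t j * t i).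
Proof.
have aj := adjC a.
have E : t i * e j = s j * (e i * (t j * t i)).
  by rewrite -(tt_e hj hi aj) !mulrA (br_st H hj) mul1r.
rewrite -[in LHS](br_ete H hj hi aj) -(mulrA (e j)) E.
by rewrite (mulrA (e j)) (es hj) !mulrA (eee hi hj a).
Qed.

Lemma ss_ee : s j * s i * e j = e i * e j.
Proof. by rewrite ee_ss (ss_e hj hi (adjC a)). Qed.

Lemma tt_ee : t j * t i * e j = e i * e j.
Proof. by rewrite ee_tt (tt_e hj hi (adjC a)). Qed.

Lemma se_adj : s i * e j = t j * (e i * e j).
Proof. by rewrite -ss_ee !mulrA (br_ts H hj) mul1r. Qed.

Lemma eet_adj : e i * e j * t i = e i * s j.
Proof. by rewrite ee_ss -!mulrA (br_st H hi) mulr1. Qed.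

Lemma ees_adj : e i * e j * s i = e i * t j.
Proof. by rewrite ee_tt -!mulrA (br_ts H hi) mulr1. Qed.

Lemma ses_adj : s i * e j * s i = t j * e i * t j.
Proof. by rewrite se_adj -!mulrA (mulrA (e i)) ees_adj. Qed.
End AdjacentE.

(** * Subalgebras generated by some of the [s i] *)

Inductive Alg (P : nat -> bool) : B -> Prop :=
| Alg1 : Alg P 1
| AlgD u v : Alg P u -> Alg P v -> Alg P (u + v)
| AlgZ c u : Alg P u -> Alg P (iota c * u)
| Alg_s i u : P i -> (i.+1 < n)%N -> Alg P u -> Alg P (s i * u).

Lemma AlgN P u : Alg P u -> Alg P (- u).
Proof. by move=> Au; rewrite -mulN1r -(rmorphN1 iota); apply: AlgZ. Qed.

Lemma AlgM P u v : Alg P u -> Alg P v -> Alg P (u * v).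
Proof.
move=> Au Av; elim: Au => [|u1 u2 _ h1 _ h2|c u1 _ h1|i u1 ki i_n _ h1].
- by rewrite mul1r.
- by rewrite mulrDl; apply: AlgD.
- by rewrite -mulrA; apply: AlgZ.
- by rewrite -mulrA; apply: Alg_s.
Qed.

Lemma AlgS (P Q : nat -> bool) u : (forall i, P i -> Q i) -> Alg P u -> Alg Q u.
Proof.
move=> PQ; elim=> [|u1 u2 _ h1 _ h2|c u1 _ h1|i u1 Pi i_n _ h1].
- exact: Alg1.
- exact: AlgD.
- exact: AlgZ.
- by apply: Alg_s => //; apply: PQ.
Qed.

Lemma Alg_sg (P : nat -> bool) i : P i -> (i.+1 < n)%N -> Alg P (s i).
Proof. by move=> Pi i_n; rewrite -[s i]mulr1; apply: Alg_s => //; apply: Alg1. Qed.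

Lemma eXVs i : (i.+1 < n)%N -> e i = iota xV * (s i * s i + 1) - s i.
Proof.
move=> hi; rewrite (ss hi) addrAC addrNK -mulrDr mulrA -rmorphM.
by rewrite mulrC (br_xxV H) rmorph1 mul1r addrC addKr.
Qed.

Lemma Alg_eg (P : nat -> bool) i : P i -> (i.+1 < n)%N -> Alg P (e i).
Proof.
move=> Pi i_n; rewrite (eXVs i_n); have As := Alg_sg Pi i_n.
apply: AlgD; last exact: AlgN.
by apply: AlgZ; apply: AlgD; [apply: AlgM | apply: Alg1].
Qed.

Lemma Alg_tg (P : nat -> bool) i : P i -> (i.+1 < n)%N -> Alg P (t i).
Proof.
move=> Pi i_n; rewrite (tE i_n); apply: AlgD; last exact/AlgN/Alg_sg.
by apply: AlgZ; apply: AlgD; [apply: Alg1 | apply: Alg_eg].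
Qed.

Lemma Alg_comm (P : nat -> bool) u y : Alg P u ->
  (forall i, P i -> (i.+1 < n)%N -> s i * y = y * s i) -> u * y = y * u.
Proof.
move=> Au h; elim: Au => [|u1 u2 _ h1 _ h2|c u1 _ h1|i u1 Pi i_n _ h1].
- by rewrite mulr1 mul1r.
- by rewrite mulrDl h1 h2 mulrDr.
- by rewrite -mulrA h1 !mulrA (br_central H).
- by rewrite -mulrA h1 !mulrA h.
Qed.

Lemma Alg_comm2 (P Q : nat -> bool) u v : Alg P u -> Alg Q v ->
  (forall i j, P i -> Q j -> (i.+1 < n)%N -> (j.+1 < n)%N ->
    (i.+1 < j)%N || (j.+1 < i)%N) -> u * v = v * u.
Proof.
move=> Au Av h; apply: (Alg_comm Au) => i Pi hi; symmetry.
by apply: (Alg_comm Av) => j Qj hj; symmetry; apply: far_s_s; apply/and3P; split; auto.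
Qed.

(** * Chains of generators sliding past each other *)

Fixpoint Dw k m : B := if m is m'.+1 then Dw k m' * s (k + m') else 1.
Fixpoint Uw k m : B := if m is m'.+1 then t (k + m'.+1) * Uw k m' else 1.
Fixpoint Ew k m : B := if m is m'.+1 then e (k + m') * Ew k m' else 1.

Lemma DwS k m : Dw k m.+1 = s k * Dw k.+1 m.
Proof.
elim: m => [|m IH]; first by rewrite /= mul1r mulr1 addn0.
by rewrite -[LHS]/(Dw k m.+1 * s (k + m.+1)) IH -mulrA /= addSnnS.
Qed.

Lemma UwS k m : Uw k m.+1 = Uw k.+1 m * t k.+1.
Proof.
elim: m => [|m IH]; first by rewrite /= mul1r mulr1 addn1.
by rewrite -[LHS]/(t (k + m.+2) * Uw k m.+1) IH mulrA /= addSnnS.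
Qed.

Lemma EwS k m : Ew k m.+1 = Ew k.+1 m * e k.
Proof.
elim: m => [|m IH]; first by rewrite /= mul1r mulr1 addn0.
by rewrite -[LHS]/(e (k + m.+1) * Ew k m.+1) IH mulrA /= addSnnS.
Qed.

Lemma Dw_cat k m m' : Dw k (m + m') = Dw k m * Dw (k + m) m'.
Proof.
elim: m' => [|m' IH]; first by rewrite addn0 mulr1.
by rewrite addnS /= IH mulrA addnA.
Qed.

Lemma Alg_Dw k m : (k + m < n)%N -> Alg (fun i => k <= i < k + m)%N (Dw k m).
Proof.
elim: m => [|m IH] h; first exact: Alg1.
apply: AlgM; last by apply: Alg_sg; lia.
by apply: AlgS (IH _) => [i|]; lia.
Qed.
Lemma Alg_Uw k m : (k + m.+1 < n)%N -> Alg (fun i => k < i <= k + m)%N (Uw k m).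
Proof.
elim: m => [|m IH] h; first exact: Alg1.
apply: AlgM; first by apply: Alg_tg; lia.
by apply: AlgS (IH _) => [i|]; lia.
Qed.
Lemma Alg_Ew k m : (k + m < n)%N -> Alg (fun i => k <= i < k + m)%N (Ew k m).
Proof.
elim: m => [|m IH] h; first exact: Alg1.
apply: AlgM; first by apply: Alg_eg; lia.
by apply: AlgS (IH _) => [i|]; lia.
Qed.

(** Passing through the chain raises an index by one: the factors i + 1 and i of the chain are
    passed by the braid relation, all others commute. *)
Lemma t_Uw i k m : (k < i < k + m)%N -> (k + m.+1 < n)%N ->
  t i * Uw k m = Uw k m * t i.+1.
Proof.
elim: m => [|m IH] hi hn; first lia.
have [i_m|i_m] := ltnP i (k + m).
  rewrite /= mulrA far_t_t; last by rewrite /far; lia.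
  by rewrite -mulrA IH ?mulrA //; lia.
have Ei : i = (k + m)%N by lia.
case: m => [|m] in IH hi hn i_m Ei *; first lia.
rewrite /= !mulrA addnS -Ei (@tt_t i i.+1); try lia.

rewrite -!mulrA; congr (_ * (_ * _)).
apply: (Alg_comm2 (P := pred1 i.+1) _ (Alg_Uw _)); try lia.
  by apply: Alg_tg; rewrite /= ?eqxx //; lia.
by move=> i' j /eqP ->; lia.
Qed.

Lemma e_Uw i k m : (k < i < k + m)%N -> (k + m.+1 < n)%N ->
  e i * Uw k m = Uw k m * e i.+1.
Proof.
move=> hi hn; symmetry; apply: conj_se; try lia.
by apply: conj_ts; try lia; symmetry; apply: t_Uw.
Qed.

Lemma Ew_Uw k m M : (m < M)%N -> (k + M.+1 < n)%N ->
  Ew k.+1 m * Uw k M = Uw k M * Ew k.+2 m.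
Proof.
elim: m => [|m IH] hm hn; first by rewrite mulr1 mul1r.
rewrite /= -mulrA IH ?mulrA; try lia.
by rewrite e_Uw ?addSn //; lia.
Qed.

Lemma Dw_s k j i : (k <= i < k + j)%N -> (k + j.+1 < n)%N ->
  Dw k j.+1 * s i = s i.+1 * Dw k j.+1.
Proof.
elim: j => [|j IH] hi hn; first lia.
have [i_m|i_m] := ltnP i (k + j).
  rewrite -[Dw k j.+2]/(Dw k j.+1 * s (k + j.+1)) -mulrA.
  rewrite -(far_s_s (i := i)); last by rewrite /far; lia.
  by rewrite mulrA IH ?mulrA //; lia.
have -> : i = (k + j)%N by lia.
rewrite /= !addnS -!mulrA (mulrA (s (k + j)%N)) braid_adj; try lia.
rewrite !mulrA; congr (_ * _ * _).
apply: (Alg_comm2 (Q := pred1 (k + j).+1) (Alg_Dw _)); try lia.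
  by apply: Alg_sg; rewrite /= ?eqxx //; lia.
by move=> i' j' ? /eqP ->; lia.
Qed.

Lemma Dw_Dw k j m : (m <= j)%N -> (k + j.+1 < n)%N ->
  Dw k j.+1 * Dw k m = Dw k.+1 m * Dw k j.+1.
Proof.
elim: m => [|m IH] hm hn; first by rewrite mulr1 mul1r.
rewrite -[Dw k m.+1]/(Dw k m * s (k + m)%N) mulrA IH ?(ltnW hm) //.
by rewrite -mulrA Dw_s ?mulrA ?addSn //; lia.
Qed.

(* The closed-up crossings unwind: strand [k] runs under the cup. *)
Lemma e_Uw_e k m : (k + m.+2 < n)%N -> exists2 c, Alg (leq k.+2) c &
  e (k + m.+1) * Uw k m * e k = Ew k m.+2 * c.
Proof.
elim: m => [|m IH] hn; first by exists 1; [exact: Alg1 | rewrite /= !mulr1 addn0].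
have [|c Ac Ec] := IH; first lia.
have hs : ((k + m.+2).+1 < n)%N by lia.
exists (c * s (k + m.+2)); first by apply: AlgM => //; apply: Alg_sg; lia.
rewrite /= !mulrA.
have -> : e (k + m.+2) * t (k + m.+1) =
    e (k + m.+2) * e (k + m.+1) * s (k + m.+2).
  by rewrite ees_adj //; try lia.
have -> : e (k + m.+2) * e (k + m.+1) * s (k + m.+2) * Uw k m * e k =
    e (k + m.+2) * (e (k + m.+1) * Uw k m * e k) * s (k + m.+2).
  rewrite -!mulrA; congr (_ * (_ * _)); rewrite mulrA.
  rewrite (Alg_comm2 (P := pred1 (k + m.+2)) _ (Alg_Uw _)); try lia.
  - by rewrite -mulrA far_s_e //; rewrite /far; lia.
  - by apply: Alg_sg; rewrite /= ?eqxx.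
  - by move=> i j /eqP ->; lia.
by rewrite Ec /= !mulrA.
Qed.

Lemma Ew_ek k m : (k.+2 + m < n)%N -> Ew k.+2 m * e k = e k * Ew k.+2 m.
Proof.
move=> hm; apply: (Alg_comm2 (Q := pred1 k) (Alg_Ew hm)).
  by apply: Alg_eg; rewrite /= ?eqxx //; lia.
by move=> i i' ? /eqP ->; lia.
Qed.

Lemma Uw_high k m j y : (k + m.+1 < j)%N -> (j.+1 < n)%N -> Alg (pred1 j) y ->
  y * Uw k m = Uw k m * y.
Proof.
move=> hj hn Ay; apply: (Alg_comm2 Ay (Alg_Uw _)); first lia.
by move=> i i' /eqP ->; lia.
Qed.

(** Two crossings disappear: with p = k + j + 1, the product e_(p+1) e_p t_(p+1) is e_(p+1) s_p, and
    this s_p cancels the next factor t_p of the chain. *)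
Lemma Ew_Uw_wrap0 k j : (k + j.+3 < n)%N ->
  Ew k.+1 j.+2 * Uw k j.+2 * e k * e k.+1 = Uw k j * e k * Ew k.+1 j.+2.
Proof.
move=> hn.
have -> : Ew k.+1 j.+2 * Uw k j.+2 =
    e (k + j.+2) * (e (k + j.+1) * t (k + j.+2)) * (Ew k.+1 j * Uw k j.+1).
  rewrite -[Ew k.+1 j.+2]/(e (k.+1 + j.+1) * (e (k.+1 + j) * Ew k.+1 j)).
  rewrite -[Uw k j.+2]/(t (k + j.+2) * Uw k j.+1) !addSnnS.
  rewrite -!mulrA (mulrA (Ew _ _)).
  rewrite (Alg_comm2 (Q := pred1 (k + j.+2)) (Alg_Ew _)); try lia.
  - by rewrite -!mulrA.
  - by apply: Alg_tg; rewrite /= ?eqxx //; lia.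
  - by move=> i i' ? /eqP ->; lia.
rewrite (mulrA (e (k + j.+2))) (@eet_adj (k + j.+2) (k + j.+1)); try lia.
rewrite Ew_Uw; try lia.
rewrite -[Uw k j.+1]/(t (k + j.+1) * Uw k j) -!mulrA (mulrA (s _)).
rewrite (br_st H) ?mul1r; last by lia.
rewrite mulrA (Uw_high (y := e (k + j.+2)) (j := k + j.+2)); try lia; last first.
  by apply: Alg_eg; rewrite /= ?eqxx //; lia.
rewrite -!mulrA; congr (_ * _).
have -> : e (k + j.+2) * (Ew k.+2 j * (e k * e k.+1)) =
    Ew k.+2 j.+1 * e k * e k.+1.
  by rewrite /= !addSnnS !mulrA.
rewrite Ew_ek; last by lia.
by rewrite -mulrA -(EwS k.+1).
Qed.

Lemma Ew_Uw_wrap k m j : (j.+1 < m)%N -> (k + m.+1 < n)%N ->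
  Ew k.+1 m * Uw k j.+2 * e k * e k.+1 = Uw k j * e k * Ew k.+1 m.
Proof.
elim: m => [|m IH] hj hm; first by [].
have [j_m|m_j] := ltnP j.+1 m; last first.
  have E : m = j.+1 by lia. rewrite E; apply: Ew_Uw_wrap0. lia.
rewrite -[Ew k.+1 m.+1]/(e (k.+1 + m) * Ew k.+1 m).
rewrite -!mulrA; rewrite -!mulrA in IH; rewrite IH //; last by lia.
rewrite !mulrA; congr (_ * _).
rewrite (Uw_high (y := e (k.+1 + m)) (j := k.+1 + m)); try lia; last first.
  by apply: Alg_eg; rewrite /= ?eqxx //; lia.
by rewrite -!mulrA far_e_e // /far; lia.
Qed.

(** Only the part involving strand k is normalised; [b] is any element of the next subalgebra,
    expanded later in [Alg_lspan]. The bounds differ by one because [Dw k m] ends with index k + m -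
    1 while [Uw k m] begins with k + m. *)
Inductive NF (k : nat) : B -> Prop :=
| NF0 : NF k 0
| NFD u v : NF k u -> NF k v -> NF k (u + v)
| NF_D m b : Alg (leq k.+1) b -> (k + m < n)%N -> NF k (b * Dw k m)
| NF_U m b : Alg (leq k.+1) b -> (k + m.+1 < n)%N -> NF k (Uw k m * e k * b).

Lemma NFZ k c u : NF k u -> NF k (iota c * u).
Proof.
elim=> [|u1 u2 _ h1 _ h2|m b Ab hm|m b Ab hm].
- by rewrite mulr0; apply: NF0.
- by rewrite mulrDr; apply: NFD.
- by rewrite mulrA; apply: NF_D => //; apply: AlgZ.
- rewrite mulrA (br_central H) -mulrA.
  by apply: NF_U => //; apply: AlgZ.
Qed.

Lemma NFN k u : NF k u -> NF k (- u).
Proof. by move=> Gu; rewrite -mulN1r -(rmorphN1 iota); apply: NFZ. Qed.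

Lemma NF_e k b : (k.+1 < n)%N -> Alg (leq k.+1) b -> NF k (e k * b).
Proof.
by move=> hk Ab; have := @NF_U k 0 b Ab; rewrite /= mul1r; apply; lia.
Qed.

(** * Multiplication of normal forms by generators *)

Section Step.
Context (k : nat).
Hypothesis IH : (k.+1 < n)%N -> forall u, Alg (leq k.+1) u -> NF k.+1 u.

Lemma comm_Alg2 b (hk : (k.+1 < n)%N) : Alg (leq k.+2) b ->
  [/\ b * s k = s k * b, b * t k = t k * b & b * e k = e k * b].
Proof.
move=> Ab; split; apply: (Alg_comm Ab) => i ki i_n.
- by apply: far_s_s; rewrite /far; lia.
- by apply: far_s_t; rewrite /far; lia.
- by apply: far_s_e; rewrite /far; lia.
Qed.

(** A chain of [e] of length at least 2 has neither shape. Splitting [t k.+1] off [b] turns its end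
    into a crossing, as e_(k+1) e_k t_(k+1) = e_(k+1) s_k, and the normal form of s_(k+1) b at k + 1
    provides the chain that this crossing prolongs. *)
Lemma NF_Ew m b : (k + m.+2 < n)%N -> Alg (leq k.+1) b -> NF k (Ew k m.+2 * b).
Proof.
move=> hm Ab.
have hk1 : (k.+2 < n)%N by lia.
have hk : (k.+1 < n)%N by lia.
have -> : b = t k.+1 * (s k.+1 * b) by rewrite mulrA (br_ts H) // mul1r.
have Asb : Alg (leq k.+1) (s k.+1 * b) by apply: AlgM => //; apply: Alg_sg.
have eet : e k.+1 * e k * t k.+1 = e k.+1 * s k by rewrite eet_adj //; right.
have Ee : Ew k m.+2 * t k.+1 = Ew k.+1 m.+1 * s k.
  by rewrite EwS EwS -!mulrA (mulrA (e k.+1)) eet.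
elim: (IH hk Asb) => [|u1 u2 _ h1 _ h2|j c Ac hj|j c Ac hj].
- by rewrite !mulr0; apply: NF0.
- by rewrite !mulrDr; apply: NFD.
- have [Es _ _] := comm_Alg2 hk Ac.
  rewrite !mulrA Ee -(mulrA _ (s k)) -Es.
  rewrite mulrA -(mulrA _ (s k)) -DwS; apply: NF_D; last by lia.
  apply: AlgM; last by apply: AlgS Ac => i; lia.
  by apply: AlgS (Alg_Ew _) => [i|]; lia.
have [Es Et Ec] := comm_Alg2 hk Ac.
have E1 : s k * Uw k.+1 j * e k.+1 = Uw k.+1 j * t k.+1 * e k * e k.+1.
  rewrite (Alg_comm2 (P := pred1 k) _ (Alg_Uw _)); try lia.
  - by rewrite -!mulrA se_adj //; left.
  - by apply: Alg_sg; rewrite /= ?eqxx.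
  - by move=> i i' /eqP ->; lia.
have -> : Ew k m.+2 * (t k.+1 * (Uw k.+1 j * e k.+1 * c)) =
    Ew k.+1 m.+1 * Uw k j.+1 * e k * e k.+1 * c.
  transitivity (Ew k.+1 m.+1 * (s k * Uw k.+1 j * e k.+1) * c).
    by rewrite !mulrA Ee.
  by rewrite E1 UwS !mulrA.
have Ae1 : Alg (leq k.+1) (e k.+1) by apply: Alg_eg.
have Ac1 : Alg (leq k.+1) c by apply: AlgS Ac => i; lia.
(* A longer chain of crossings lets the chain of [e] slide through; otherwise the chain of [e]
   absorbs crossings. *)
have [m_j|j_m] := ltnP m j.
  rewrite Ew_Uw; try lia.
  have -> : Uw k j.+1 * Ew k.+2 m.+1 * e k * e k.+1 * c =
      Uw k j.+1 * e k * (Ew k.+2 m.+1 * e k.+1 * c).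
    by rewrite -(mulrA (Uw k _)) Ew_ek ?mulrA //; lia.
  apply: NF_U; last by lia.
  apply: AlgM => //; apply: AlgM => //.
  by apply: AlgS (Alg_Ew _) => [i|]; lia.
case: j => [|j] in hj j_m E1 *.
  rewrite /= mulr1 addn1 -[e (k.+1 + m) * _]/(Ew k.+1 m.+1) EwS.
  have -> : Ew k.+2 m * e k.+1 * t k.+1 * e k * e k.+1 * c =
      Ew k.+2 m * (e k.+1 * t k.+1 * e k * e k.+1) * c by rewrite !mulrA.
  rewrite et // eee //; last by right.
  rewrite -EwS -[_ * c]mulr1; apply: (NF_D (m := 0)); last lia.
  by apply: AlgM => //; apply: AlgS (Alg_Ew _) => [i|]; lia.
rewrite Ew_Uw_wrap; try lia.
rewrite -mulrA; apply: NF_U; last by lia.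
by apply: AlgM => //; apply: AlgS (Alg_Ew _) => [i|]; lia.
Qed.

(** On [Uw k m * e k * b], the factor [t i] slides through or prolongs the chain unless i = k + m.
    There [t i] is squared, and the term with [e] in the quadratic relation becomes, by [e_Uw_e], a
    chain covered by [NF_Ew]. *)
Lemma NF_t i u : (k < i)%N -> (i.+1 < n)%N -> NF k u -> NF k (t i * u).
Proof.
move=> ki hi; elim=> [|u1 u2 _ h1 _ h2|m b Ab hm|m b Ab hm].
- by rewrite mulr0; apply: NF0.
- by rewrite mulrDr; apply: NFD.
- by rewrite mulrA; apply: NF_D => //; apply: AlgM => //; apply: Alg_tg.
have [i_m|m_i] := ltnP i (k + m).
  rewrite !mulrA t_Uw; try lia.
  rewrite -(mulrA (Uw k m)) far_t_e ?mulrA; last by rewrite /far; lia.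
  rewrite -mulrA; apply: NF_U => //; apply: AlgM => //; apply: Alg_tg; lia.
have [i_m2|m_i2] := ltnP (k + m.+1) i.
  rewrite !mulrA (Uw_high (y := t i) (j := i)); try lia; last first.
    by apply: Alg_tg; rewrite /= ?eqxx //; lia.
  rewrite -(mulrA (Uw k m)) far_t_e ?mulrA; last by rewrite /far; lia.
  by rewrite -mulrA; apply: NF_U => //; apply: AlgM => //; apply: Alg_tg; lia.
have [i_m1|Ei] : i = (k + m.+1)%N \/ i = (k + m)%N by lia.
  rewrite i_m1 !mulrA -[t _ * Uw k m]/(Uw k m.+1); apply: NF_U => //; lia.
case: m => [|m] in hm m_i m_i2 Ei *; first lia.
rewrite /= -Ei !mulrA tt // !(mulrBl, mulrDl) mul1r.
apply: NFD; first apply: NFD.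
- rewrite -!mulrA; apply: NFZ; rewrite !mulrA Ei.
  exact: (NF_U (m := m.+1)).
- by apply: NFN; apply: NF_U => //; lia.
- rewrite -!mulrA; apply: NFZ; rewrite !mulrA Ei addnS -addnS.
  have [|c Ac ->] := e_Uw_e (k := k) (m := m); first lia.
  rewrite -mulrA; apply: NF_Ew; first lia.
  by apply: AlgM => //; apply: AlgS Ac => j; lia.
Qed.

(** Since [Uw] is made of inverses, stability was proved for [t i]. It passes to [s i] because s = x
    (1 + e) - t and e is a polynomial in t. *)
Lemma NF_left b u : Alg (leq k.+1) b -> NF k u -> NF k (b * u).
Proof.
move=> Ab Gu; elim: Ab => [|u1 u2 _ h1 _ h2|c u1 _ h1|i u1 ki hi _ h1].
- by rewrite mul1r.
- by rewrite mulrDl; apply: NFD.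
- by rewrite -mulrA; apply: NFZ.
rewrite -mulrA (sE hi) (eXV hi) mulrBl -mulrA mulrDl mul1r.
have NFt v : NF k v -> NF k (t i * v) by apply: NF_t.
apply: NFD; last by apply: NFN; apply: NFt.
apply: NFZ; apply: NFD => //; rewrite mulrBl -mulrA mulrDl mul1r -mulrA.
apply: NFD; last by apply: NFN; apply: NFt.
by apply: NFZ; apply: NFD => //; apply/NFt/NFt.
Qed.

(** Each step replaces s_p e_(p+1) by t_(p+1) e_p e_(p+1), which trades the chain of [s] for one of
    [t]. *)
Lemma Dw_e j : (k + j.+1 < n)%N -> exists2 c, Alg (leq k.+1) c &
  Dw k j * e (k + j)%N = Uw k j * e k * c.
Proof.
elim: j => [|j IHj] hj.
  by exists 1; [apply: Alg1 | rewrite /= !mulr1 !mul1r addn0].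
have [|c Ac Ec] := IHj; first lia.
exists (c * e (k + j.+1)); first by apply: AlgM => //; apply: Alg_eg; lia.
rewrite /= -mulrA (@se_adj _ (k + j.+1)); try lia.
rewrite !mulrA (Alg_comm2 (Q := pred1 (k + j.+1)) (Alg_Dw _)); try lia.
- by rewrite -!mulrA (mulrA (Dw k j)) Ec !mulrA.
- by apply: Alg_tg; rewrite /= ?eqxx //; lia.
- by move=> i i' ? /eqP ->; lia.
Qed.

(** A second chain that is not longer than j slides through with raised indices. A longer one slides
    up to index k + j, where a square of [s] arises; of its three terms, two give chains [Dw] and
    the one with [e] is handled by [Dw_e]. *)
Lemma NF_Dw_Dw j m : (k + j.+1 < n)%N -> (k + m < n)%N ->
  NF k (Dw k j.+1 * Dw k m).
Proof.
move=> hj hm; have [m_j|j_m] := leqP m j.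
  rewrite Dw_Dw //; apply: NF_D => //.
  by apply: AlgS (Alg_Dw _) => [i|]; lia.
have -> : m = (j + (m - j.+1).+1)%N by lia.
set d := (m - j.+1)%N.
rewrite Dw_cat mulrA Dw_Dw // -mulrA; apply: NF_left.
  by apply: AlgS (Alg_Dw _) => [i|]; lia.
rewrite (DwS (k + j)).
have AD : Alg (leq (k + j.+1)) (Dw (k + j).+1 d).
  by apply: AlgS (Alg_Dw _) => [i|]; rewrite /d; lia.
have AD1 : Alg (leq k.+1) (Dw (k + j).+1 d).
  by apply: AlgS AD => i; lia.
have hs : ((k + j).+1 < n)%N by lia.
rewrite -[Dw k j.+1]/(Dw k j * s (k + j)%N) -mulrA (mulrA (s _)) ss // !(mulrBl, mulrDl) mul1r.
rewrite mulrDr mulrBr; apply: NFD; first apply: NFD.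
- rewrite -mulrA mulrA -(br_central H) -mulrA; apply: NFZ.
  rewrite -DwS -Dw_cat -[Dw _ _]mul1r; apply: NF_D; first exact: Alg1.
  by rewrite /d; lia.
- apply: NFN.
  have -> : Dw k j * Dw (k + j).+1 d = Dw (k + j).+1 d * Dw k j.
    apply: (Alg_comm2 (Alg_Dw _) AD); first lia.
    by move=> i i'; lia.
  by apply: NF_D => //; lia.
- rewrite -mulrA mulrA -(br_central H) -mulrA; apply: NFZ.
  have [|c Ac Ec] := Dw_e (j := j); first lia.
  by rewrite mulrA Ec -mulrA; apply: NF_U => //; apply: AlgM.
Qed.

(** Expanding [b] at k + 1 leaves coefficients that commute with [s k], so [s k] joins the chain of
    strand k + 1. On the second shape, all of [Uw] but its last factor [t k.+1] commutes with
    [s k]. *)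
Lemma NF_sk u : (k.+1 < n)%N -> NF k u -> NF k (s k * u).
Proof.
move=> hk; elim=> [|u1 u2 _ h1 _ h2|m b Ab hm|m b Ab hm].
- by rewrite mulr0; apply: NF0.
- by rewrite mulrDr; apply: NFD.
- elim: (IH hk Ab) => [|u1 u2 _ h1 _ h2|j c Ac hj|j c Ac hj].
  + by rewrite mul0r mulr0; apply: NF0.
  + by rewrite mulrDl mulrDr; apply: NFD.
  + have [Es _ _] := comm_Alg2 hk Ac.
    have -> : s k * (c * Dw k.+1 j * Dw k m) = c * (Dw k j.+1 * Dw k m).
      by rewrite DwS !mulrA -Es.
    apply: NF_left; first by apply: AlgS Ac => i; lia.
    by apply: NF_Dw_Dw => //; lia.
  + have [Es Et _] := comm_Alg2 hk Ac.
    have hk1 : (k.+2 < n)%N by lia.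
    have Ac1 : Alg (leq k.+1) c by apply: AlgS Ac => i; lia.
    have -> : s k * (Uw k.+1 j * e k.+1 * c * Dw k m) =
        Uw k.+1 j * (s k * e k.+1 * c * Dw k m).
      rewrite !mulrA (Alg_comm2 (P := pred1 k) _ (Alg_Uw _)) //; try lia.
        by apply: Alg_sg; rewrite /= ?eqxx.
      by move=> i i' /eqP ->; lia.
    apply: NF_left; first by apply: AlgS (Alg_Uw _) => [i|]; lia.
    have Ut : t k.+1 = Uw k 1 by rewrite /= mulr1 addn1.
    case: m => [|m] in hm *.
      rewrite /= mulr1 se_adj //; last by left.
      rewrite mulrA Ut -mulrA; apply: NF_U; last lia.
      by apply: AlgM => //; apply: Alg_eg.
    rewrite DwS mulrA -(mulrA _ c) Es mulrA ses_adj //; last by left.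
    have A : Alg (leq k.+1) (t k.+1 * (c * Dw k.+1 m)).
      apply: AlgM; first by apply: Alg_tg.
      by apply: AlgM => //; apply: AlgS (Alg_Dw _) => [i|]; lia.
    by have := @NF_U k 1 _ A; rewrite /= mulr1 addn1 !mulrA; apply; lia.
case: m => [|m] in hm *.
  by rewrite /= mul1r mulrA br_se //; apply: NF_e.
have hk1 : (k.+2 < n)%N by lia.
have -> : s k * (Uw k m.+1 * e k * b) =
    Uw k.+1 m * (s k * (t k.+1 * e k * b)).
  rewrite UwS !mulrA (Alg_comm2 (P := pred1 k) _ (Alg_Uw _)) //; try lia.
    by apply: Alg_sg; rewrite /= ?eqxx.
  by move=> i i' /eqP ->; lia.
apply: NF_left; first by apply: AlgS (Alg_Uw _) => [i|]; lia.
have Gt : NF k (t k.+1 * e k * b).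
  by have := @NF_U k 1 _ Ab; rewrite /= mulr1 addn1; apply; lia.
rewrite (sE hk) mulrBl -mulrA mulrDl mul1r.
apply: NFD; first (apply: NFZ; apply: NFD => //).
  rewrite !mulrA br_ete //; last by left.
  exact: NF_e.
apply: NFN; rewrite !mulrA tt_ee //; last by right.
rewrite -mulrA; apply: NF_left; first by apply: Alg_eg.
exact: NF_e.
Qed.

Lemma NF_step u : (k < n)%N -> Alg (leq k) u -> NF k u.
Proof.
move=> hk; elim=> [|u1 u2 _ h1 _ h2|c u1 _ h1|i u1 ki hi _ h1].
- rewrite -[1]mulr1; apply: (NF_D (m := 0)); [exact: Alg1 | lia].
- exact: NFD.
- exact: NFZ.
have [E|k_i] := eqVneq k i; first by rewrite -E; apply: NF_sk => //; lia.
by apply: NF_left => //; apply: Alg_sg; lia.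
Qed.
End Step.

Lemma Alg_NF k u : (k < n)%N -> Alg (leq k) u -> NF k u.
Proof.
move: {2}(n - k)%N (leqnn (n - k)) => d; elim: d k u => [|d IHd] k u hd hk.
  lia.
by apply: NF_step => // hk1 v; apply: IHd; lia.
Qed.

(** * Linear span of the normal words *)

Inductive lspan (L : seq B) : B -> Prop :=
| lspan0 : lspan L 0
| lspan_cons c b u : b \in L -> lspan L u -> lspan L (iota c * b + u).

Lemma lspan_mem L b : b \in L -> lspan L b.
Proof.
move=> bL; rewrite -[b]addr0 -[b]mul1r -(rmorph1 iota).
by apply: lspan_cons => //; apply: lspan0.
Qed.

Lemma lspanD L u v : lspan L u -> lspan L v -> lspan L (u + v).
Proof.
move=> Lu Lv; elim: Lu => [|c b w bL _ IH]; first by rewrite add0r.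
by rewrite -addrA; apply: lspan_cons.
Qed.

Lemma lspanZ L c u : lspan L u -> lspan L (iota c * u).
Proof.
elim=> [|d b w bL _ IH]; first by rewrite mulr0; apply: lspan0.
by rewrite mulrDr mulrA -rmorphM; apply: lspan_cons.
Qed.

Definition gev (g : bgen) : B :=
  match g with Bs i => s i | Bt i => t i | Be i => e i end.

Definition wev (w : seq bgen) : B := foldr (fun g u => gev g * u) 1 w.

Lemma wev_cat w1 w2 : wev (w1 ++ w2) = wev w1 * wev w2.
Proof. by elim: w1 => [|g w IH] /=; rewrite ?mul1r // IH mulrA. Qed.

Lemma wev_dwd k m : wev (dwd k m) = Dw k m.
Proof.
by elim: m => //= m IH; rewrite -cats1 wev_cat IH /= mulr1.
Qed.

Lemma wev_uwd k m : wev (uwd k m) = Uw k m.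
Proof. by elim: m => //= m ->. Qed.

Lemma Alg_lspan m k u : (k + m = n)%N -> Alg (leq k) u ->
  lspan [seq wev w | w <- nf_words k m] u.
Proof.
elim: m k u => [|m IH] k u hk Au.
  have Z : lspan [:: 1] 1 by apply: lspan_mem; rewrite inE.
  elim: Au => [|u1 u2 _ h1 _ h2|c u1 _ h1|i u1 ki i_n _ h1] //=.
  - exact: lspanD.
  - exact: lspanZ.
  - lia.
have hk1 : (k < n)%N by lia.
elim: (Alg_NF hk1 Au).
- exact: lspan0.
- by move=> u1 u2 _ h1 _ h2; apply: lspanD.
- move=> j b Ab hj; have Lb := IH k.+1 b ltac:(lia) Ab.
  elim: Lb => [|c b' v /mapP[w wL ->] _ IHv]; first by rewrite mul0r; apply: lspan0.
  rewrite mulrDl; apply: lspanD => //; rewrite -mulrA; apply: lspanZ.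
  apply: lspan_mem; apply/mapP; exists (w ++ dwd k j).
    rewrite mem_cat; apply/orP; left.
    by apply/allpairsP; exists (j, w); split=> //; rewrite mem_iota /=; lia.
  by rewrite wev_cat wev_dwd.
- move=> j b Ab hj; have Lb := IH k.+1 b ltac:(lia) Ab.
  elim: Lb => [|c b' v /mapP[w wL ->] _ IHv]; first by rewrite mulr0; apply: lspan0.
  rewrite mulrDr; apply: lspanD => //.
  rewrite mulrA -(br_central H) -mulrA; apply: lspanZ.
  apply: lspan_mem; apply/mapP; exists (uwd k j ++ Be k :: w).
    rewrite mem_cat; apply/orP; right.
    by apply/allpairsP; exists (j, w); split=> //; rewrite mem_iota /=; lia.
  by rewrite wev_cat wev_uwd /= mulrA.
Qed.
End Span.

Definition bidx (g : bgen) := match g with Bs i | Bt i | Be i => i end.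

Lemma nf_idx n k m u g : (k + m = n)%N -> u \in nf_words k m -> g \in u ->
  (k <= bidx g)%N /\ ((bidx g).+1 < n)%N.
Proof.
have dwdP k' j g' : g' \in dwd k' j -> (k' <= bidx g' < k' + j)%N.
  elim: j => [|j IH] //=; rewrite mem_rcons inE => /orP[/eqP ->|/IH] /=; lia.
have uwdP k' j g' : g' \in uwd k' j -> (k' < bidx g' <= k' + j)%N.
  elim: j => [|j IH] //=; rewrite inE => /orP[/eqP ->|/IH] /=; lia.
elim: m k u => [|m IH] k u hk; first by rewrite inE => /eqP ->.
rewrite mem_cat => /orP[] /allpairsP[[j b] /= [jm bm ->]].
  move: jm; rewrite (mem_iota 0 m.+1) => jm.
  rewrite mem_cat => /orP[gb|/dwdP]; last lia.
  by have := IH k.+1 b; rewrite bm gb => /(_ _ isT isT); lia.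
move: jm; rewrite mem_iota => jm.
rewrite mem_cat inE => /or3P[/uwdP|/eqP ->|gb] /=; [lia|lia|].
by have := IH k.+1 b; rewrite bm gb => /(_ _ isT isT); lia.
Qed.

(** The first letter of index at most k marks the border between [b] and the chain: letters of [b]
    and of [uwd] have larger indices. Its position recovers j or the length of [b], and the letter
    [Be k] separates the two families. *)
Lemma nf_words_uniq k m : uniq (nf_words k m).
Proof.
elim: m k => [|m IH] k //.
rewrite -[nf_words _ _]/([seq b ++ dwd k j | j <- iota 0 m.+1, b <- nf_words k.+1 m]
  ++ [seq uwd k j ++ Be k :: b | j <- iota 0 m, b <- nf_words k.+1 m]).
pose low (g : bgen) := (bidx g <= k)%N.
have idx b : b \in nf_words k.+1 m -> has low b = false.
  move=> bm; apply/hasP => -[g gb]; rewrite /low.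
  by have [] := nf_idx (erefl (k.+1 + m)%N) bm gb; lia.
have size_d j : size (dwd k j) = j by elim: j => //= j; rewrite size_rcons => ->.
have size_u j : size (uwd k j) = j by elim: j => //= j ->.
have uwdP j : has low (uwd k j) = false.
  by elim: j => //= j ->; rewrite /low /=; lia.
have dwdS j : dwd k j.+1 = Bs k :: dwd k.+1 j.
  elim: j => [|j IHj]; first by rewrite /= addn0.
  by rewrite -[LHS]/(rcons (dwd k j.+1) (Bs (k + j.+1))) IHj /= addSnnS.
have findD j b : b \in nf_words k.+1 m -> find low (b ++ dwd k j) = size b.
  move=> bm; rewrite find_cat idx //; case: j => [|j] //=; first by rewrite addn0.
  by rewrite -[rcons _ _]/(dwd k j.+1) dwdS /= /low /= leqnn addn0.
have findU j b : find low (uwd k j ++ Be k :: b) = j.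
  by rewrite find_cat uwdP /= /low /= leqnn addn0 size_u.
rewrite cat_uniq; apply/and3P; split.
- apply: allpairs_uniq; rewrite ?iota_uniq ?IH // => -[j b] [j' b'].
  move=> /allpairsP[p1 [_ b1m E1]] /allpairsP[p2 [_ b2m E2]] /= E.
  move: E1 E2 b1m b2m E => -[-> ->] [-> ->]; case: p1 p2 => [j1 b1] [j2 b2] /= b1m b2m E.
  have /eqP : size b1 = size b2 by rewrite -(findD j1 _ b1m) E findD.
  move=> /eqP sb; move/eqP: E; rewrite eqseq_cat // => /andP[/eqP -> /eqP].
  by move/(congr1 size); rewrite !size_d => ->.
- apply/hasPn => u /allpairsP[p [_ _ ->]].
  apply/negP => /allpairsP[p' [_ bm E]].
  case: p p' E bm => [j b] [j' b'] /= E bm.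
  have : Be k \in b' ++ dwd k j' by rewrite -E mem_cat inE eqxx orbT.
  rewrite mem_cat => /orP[h|].
    by have /hasP[] := idx _ bm; exists (Be k) => //; rewrite /low /=.
  by elim: j' {E} => //= j' IHj; rewrite mem_rcons inE => /orP[/eqP|].
- apply: allpairs_uniq; rewrite ?iota_uniq ?IH // => -[j b] [j' b'].
  move=> /allpairsP[p1 [_ b1m E1]] /allpairsP[p2 [_ b2m E2]] /= E.
  move: E1 E2 b1m b2m E => -[-> ->] [-> ->]; case: p1 p2 => [j1 b1] [j2 b2] /= b1m b2m E.
  have Ej : j1 = j2 by rewrite -(findU j1 b1) E findU.
  move/eqP: E; rewrite Ej eqseq_cat // => /andP[_ /eqP[->]] //.
Qed.

Lemma lspan_seq (R : comPzRingType) (B : pzRingType) (iota : {rmorphism R -> B})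
    (T : eqType) (W : seq T) (f : T -> B) u : uniq W -> lspan iota [seq f w | w <- W] u ->
  exists k : T -> R, u = \sum_(w <- W) iota (k w) * f w.
Proof.
move=> uW; elim=> {u} [|c b u /mapP[w0 wW ->] _ [k ->]].
  by exists (fun=> 0); rewrite big1 // => w _; rewrite rmorph0 mul0r.
exists (fun w => k w + (if w == w0 then c else 0)).
under [RHS]eq_bigr do rewrite rmorphD mulrDl.
rewrite big_split addrC; congr (_ + _); rewrite (bigD1_seq w0) //= eqxx big1 ?addr0 //.
by move=> w /negPf ->; rewrite rmorph0 mul0r.
Qed.

(** * Independence of the words *)

Section Words.
Context (K : fieldType) (q : K) (D : rdata K) (L : nat) (HG : rgood q D L 1).
Hypothesis x0 : xq q != 0.
Local Notation I := (rI D).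
Local Notation S := (@rS K D).
Local Notation Om := (@rOm K D).
Local Notation om := (@rom K D).
(** Infinite words spare all bounds on positions. *)
Local Notation word := (nat -> I).
Local Notation xq := (xq q).
Let HS : bmw_local q S Om om 1 := rg_local HG.
Implicit Types (w : word) (f : word -> K).

(** * Local operators on functions of words *)

Definition upd w i a : word := fun p => if p == i then a else w p.

Lemma upd_id w i a : w i = a -> upd w i a = w.
Proof. by move=> <-; apply/funext => p; rewrite /upd; case: eqP => [->|]. Qed.

Lemma upd_eq w i a : upd w i a i = a. Proof. by rewrite /upd eqxx. Qed.
Lemma upd_neq w i a p : p != i -> upd w i a p = w p.
Proof. by rewrite /upd => /negPf ->. Qed.

Lemma updC w i j a b : i != j -> upd (upd w i a) j b = upd (upd w j b) i a.
Proof.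
move=> ij; apply/funext => p; rewrite /upd.
by case: (eqVneq p j) => [->|] //; rewrite eq_sym (negPf ij).
Qed.

Definition sl2 f i w a b := f (upd (upd w i a) i.+1 b).
Definition sl3 f i w a b c := f (upd (upd (upd w i a) i.+1 b) i.+2 c).

Definition Sop i f w : K := S (sl2 f i w) (w i) (w i.+1).
Definition Eop i f w : K := Om (w i) (w i.+1) * ctr om (sl2 f i w).
Definition Top i f w : K := xq * (f w + Eop i f w) - Sop i f w.

Lemma ii1 i : (i == i.+1) = false. Proof. by lia. Qed.
Lemma sl2_id f i w : sl2 f i w (w i) (w i.+1) = f w.
Proof. by rewrite /sl2 (upd_id (erefl _)) upd_id. Qed.

Lemma sl2_upd f i w a b : sl2 f i (upd (upd w i a) i.+1 b) = sl2 f i w.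
Proof.
apply/funext => c; apply/funext => d; rewrite /sl2; congr f.
by apply/funext => p; rewrite /upd; case: eqP => //; case: eqP.
Qed.

Lemma sl2_op (P : (I -> I -> K) -> I -> I -> K) f i w :
  sl2 (fun w => P (sl2 f i w) (w i) (w i.+1)) i w = P (sl2 f i w).
Proof.
apply/funext => c; apply/funext => d; rewrite {1}/sl2 sl2_upd.
by rewrite upd_neq ?ii1 // !upd_eq.
Qed.

Lemma sl2_Sop f i w : sl2 (Sop i f) i w = S (sl2 f i w).
Proof. exact: (sl2_op (fun F => S F)). Qed.

Lemma sl2_Eop f i w : sl2 (Eop i f) i w = fun a b => Om a b * ctr om (sl2 f i w).
Proof. exact: (sl2_op (fun F a b => Om a b * ctr om F)). Qed.

Lemma Sop_Sop i f w : Sop i (Sop i f) w = xq * Sop i f w - f w + xq * Eop i f w.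
Proof.
rewrite /Sop sl2_Sop (bl_quad HS) sl2_id /Eop; ring.
Qed.

Lemma Sop_Eop i f w : Sop i (Eop i f) w = Eop i f w.
Proof.
rewrite /Sop sl2_Eop.
have -> : (fun a b => Om a b * ctr om (sl2 f i w)) =
  fun a b => ctr om (sl2 f i w) * Om a b.
  by apply/funext => a; apply/funext => b; rewrite mulrC.
by rewrite (S_scale HS) (bl_SOm HS) mul1r mulrC.
Qed.

Lemma Eop_Sop i f w : Eop i (Sop i f) w = Eop i f w.
Proof. by rewrite /Eop sl2_Sop (bl_omS HS) mul1r. Qed.

Lemma Sop_lin i k f g w : Sop i (fun w => k * f w + g w) w = k * Sop i f w + Sop i g w.
Proof. exact: (congr1 (fun F => F (w i) (w i.+1)) (bl_lin HS k _ _)). Qed.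

Lemma Eop_lin i k f g w : Eop i (fun w => k * f w + g w) w = k * Eop i f w + Eop i g w.
Proof. by rewrite /Eop /sl2 ctr_lin; ring. Qed.

Lemma Top_lin i k f g w : Top i (fun w => k * f w + g w) w = k * Top i f w + Top i g w.
Proof. by rewrite /Top Eop_lin Sop_lin; ring. Qed.

Lemma Top_Sop i f w : Top i (Sop i f) w = f w.
Proof. rewrite /Top Sop_Sop Eop_Sop; ring. Qed.

Lemma Sop_scale i k f w : Sop i (fun w => k * f w) w = k * Sop i f w.
Proof. exact: (congr1 (fun F => F (w i) (w i.+1)) (S_scale HS k (sl2 f i w))). Qed.

Lemma Eop_scale i k f w : Eop i (fun w => k * f w) w = k * Eop i f w.
Proof. by rewrite /Eop /sl2 ctr_scale; ring. Qed.

Lemma Top_scale i k f w : Top i (fun w => k * f w) w = k * Top i f w.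
Proof. by rewrite /Top Eop_scale Sop_scale; ring. Qed.

Lemma Sop_Top i f w : Sop i (Top i f) w = f w.
Proof.
have -> : Top i f = fun w => (-1) * Sop i f w + (xq * f w + xq * Eop i f w).
  by apply/funext => v; rewrite /Top; ring.
by rewrite !Sop_lin Sop_scale Sop_Sop Sop_Eop; ring.
Qed.

(** A common form of [Sop] and [Eop], so that products of three operators at adjacent positions are
    reduced to three letters once, in [Pop3]. *)
Definition Pop (P : (I -> I -> K) -> I -> I -> K) i f w :=
  P (sl2 f i w) (w i) (w i.+1).

Lemma sl3_id f i w : sl3 f i w (w i) (w i.+1) (w i.+2) = f w.
Proof. by rewrite /sl3 (upd_id (erefl _)) !(upd_id (erefl _)). Qed.

Lemma sl3_Pop1 P f i w : sl3 (Pop P i f) i w = op12 P (sl3 f i w).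
Proof.
apply/funext => a; apply/funext => b; apply/funext => c; rewrite /op12 {1}/sl3 /Pop.
rewrite (_ : upd _ _ _ i = a); last by rewrite /upd; do ![case: eqP => //]; lia.
rewrite (_ : upd _ _ _ i.+1 = b); last by rewrite /upd; do ![case: eqP => //]; lia.
congr (P _ a b); apply/funext => a'; apply/funext => b'; rewrite /sl2 /sl3.
congr f; apply/funext => p; rewrite /upd.
case: eqP => [->|_]; first by rewrite (_ : i.+1 == i.+2 = false) //; lia.
case: eqP => [->|_]; first by rewrite (_ : i == i.+2 = false) //; lia.
by [].
Qed.

Lemma sl3_Pop2 P f i w : sl3 (Pop P i.+1 f) i w = op23 P (sl3 f i w).
Proof.
apply/funext => a; apply/funext => b; apply/funext => c; rewrite /op23 {1}/sl3 /Pop.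
rewrite (_ : upd _ _ _ i.+1 = b); last by rewrite /upd; do ![case: eqP => //]; lia.
rewrite upd_eq.
congr (P _ b c); apply/funext => a'; apply/funext => b'; rewrite /sl2 /sl3.
congr f; apply/funext => p; rewrite /upd.
by case: eqP => //; case: eqP.
Qed.

Lemma Pop3 P Q R f i w (F := sl3 f i w) :
  (Pop P i (Pop Q i.+1 (Pop R i f)) w =
     op12 P (op23 Q (op12 R F)) (w i) (w i.+1) (w i.+2)) *
  (Pop P i.+1 (Pop Q i (Pop R i.+1 f)) w =
     op23 P (op12 Q (op23 R F)) (w i) (w i.+1) (w i.+2)).
Proof.
split; rewrite -[LHS](sl3_id _ i) ?(sl3_Pop1, sl3_Pop2) //.
Qed.

Lemma Sop_braid i f w :
  Sop i (Sop i.+1 (Sop i f)) w = Sop i.+1 (Sop i (Sop i.+1 f)) w.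
Proof.
have [E1 E2] := Pop3 S S S f i w.
by rewrite [LHS]E1 [RHS]E2 (bl_braid HS).
Qed.

Let eP (F : I -> I -> K) a b := Om a b * ctr om F.

Lemma Eop_Sop_Eop i f w :
  (Eop i (Sop i.+1 (Eop i f)) w = Eop i f w) *
  (Eop i.+1 (Sop i (Eop i.+1 f)) w = Eop i.+1 f w).
Proof.
have [E1 _] := Pop3 eP S eP f i w; have [_ E2] := Pop3 eP S eP f i w.
split.
- rewrite [LHS]E1 -[RHS](sl3_id _ i) (sl3_Pop1 eP).
  rewrite -[op12 eP (sl3 f i w)]/(ins12 Om (ctr12 om (sl3 f i w))).
  rewrite -[LHS]/(ins12 Om (ctr12 om _) _ _ _); congr (ins12 Om _ _ _ _).
  by apply/funext => c; rewrite (bl_pt12 HS) invr1 mul1r.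
- rewrite [LHS]E2 -[RHS](sl3_id _ i) (sl3_Pop2 eP).
  rewrite -[op23 eP (sl3 f i w)]/(ins23 Om (ctr23 om (sl3 f i w))).
  rewrite -[LHS]/(ins23 Om (ctr23 om _) _ _ _); congr (ins23 Om _ _ _ _).
  by apply/funext => c; rewrite (bl_pt23 HS) invr1 mul1r.
Qed.

Lemma Eop_Eop i f w : Eop i (Eop i f) w = (xq^-1 + xq^-1 - 1) * Eop i f w.
Proof.
rewrite {1}/Eop sl2_Eop (_ : ctr om _ = ctr om (sl2 f i w) * ctr om Om).
  have -> : ctr om Om = xq^-1 + xq^-1 - 1.
    have := bl_loop HS; rewrite invr1 => h.
    by apply: (mulfI x0); rewrite mulrBr mulrDr divff // mulr1 -h; ring.
  rewrite /Eop; ring.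
rewrite -ctr_scale; congr (ctr om _).
by apply/funext => a; apply/funext => b; rewrite mulrC.
Qed.

Lemma Eop_Eop_Eop i f w :
  (Eop i (Eop i.+1 (Eop i f)) w = Eop i f w) *
  (Eop i.+1 (Eop i (Eop i.+1 f)) w = Eop i.+1 f w).
Proof.
have [E1 E2] := Pop3 eP eP eP f i w; split.
- rewrite [LHS]E1 -[RHS](sl3_id _ i) (sl3_Pop1 eP).
  rewrite -[op12 eP (sl3 f i w)]/(ins12 Om (ctr12 om (sl3 f i w))).
  rewrite -[LHS]/(ins12 Om (ctr12 om (ins23 Om (ctr23 om (ins12 Om _)))) _ _ _).
  by rewrite (bl_zag HS) (bl_zig HS).
- rewrite [LHS]E2 -[RHS](sl3_id _ i) (sl3_Pop2 eP).
  rewrite -[op23 eP (sl3 f i w)]/(ins23 Om (ctr23 om (sl3 f i w))).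
  rewrite -[LHS]/(ins23 Om (ctr23 om (ins12 Om (ctr12 om (ins23 Om _)))) _ _ _).
  by rewrite (bl_zig HS) (bl_zag HS).
Qed.

(** As T = x (1 + E) - S, the left side is x (E_i E_i + E_i E_j E_i) - E_i S_j E_i. The loop value 2
    / x - 1 makes this 2 E_i - E_i. *)
Lemma Eop_Top_Eop i j f w : j = i.+1 \/ i = j.+1 ->
  Eop i (Top j (Eop i f)) w = Eop i f w.
Proof.
move=> ij; have ESE : Eop i (Sop j (Eop i f)) w = Eop i f w.
  by case: ij => ->; rewrite Eop_Sop_Eop.
have EEE : Eop i (Eop j (Eop i f)) w = Eop i f w.
  by case: ij => ->; rewrite Eop_Eop_Eop.
have -> : Top j (Eop i f) = fun w => (-1) * Sop j (Eop i f) w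
    + (xq * Eop i f w + xq * Eop j (Eop i f) w).
  by apply/funext => v; rewrite /Top; ring.
rewrite !Eop_lin Eop_scale ESE EEE Eop_Eop; field; exact: x0.
Qed.

Lemma Eop_skein i f w : Eop i f w = xq^-1 * (Top i f w + Sop i f w) - f w.
Proof. rewrite /Top; field; exact: x0. Qed.

(** The matrix of [S], known so far only as a linear map; it turns the commutation of distant
    crossings into an interchange of sums. *)
Definition kerS a b c d : K := S (fun a' b' => ((a' == c) && (b' == d))%:R) a b.

Lemma S_kernel F a b : S F a b = \sum_c \sum_d kerS a b c d * F c d.
Proof.
pose dl (p : I * I) a' b' : K := ((a' == p.1) && (b' == p.2))%:R.
have FE : F = fun a' b' => \sum_(p : I * I) F p.1 p.2 * dl p a' b'.
  apply/funext => a'; apply/funext => b'.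
  rewrite (bigD1 (a', b')) //= /dl !eqxx mulr1 big1 ?addr0 // => -[c d] /=.
  rewrite xpair_eqE => /negPf h; rewrite eq_sym [b' == _]eq_sym h mulr0 //.
have lin (J : finType) (r : seq J) (v : J -> K) (G : J -> I -> I -> K) :
    S (fun a b => \sum_(p <- r) v p * G p a b) a b =
    \sum_(p <- r) v p * S (G p) a b.
  elim: r => [|p r IH].
    have -> : (fun a b => \sum_(p <- [::]) v p * G p a b) = fun _ _ => 0.
      by apply/funext => ?; apply/funext => ?; rewrite big_nil.
    by rewrite (S_0 HS) big_nil.
  rewrite big_cons -IH.
  rewrite -[RHS](congr1 (fun F => F a b) (bl_lin HS (v p) (G p) _)).
  congr (S _ a b); apply/funext => ?; apply/funext => ?.
  by rewrite big_cons.
rewrite pair_bigA /= {1}FE lin; apply: eq_bigr => p _.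
by rewrite mulrC.
Qed.

Lemma SopE i f w : Sop i f w = \sum_c \sum_d kerS (w i) (w i.+1) c d *
  f (upd (upd w i c) i.+1 d).
Proof. by rewrite /Sop S_kernel. Qed.

Lemma Sop_comm i j f w : (i.+1 < j)%N -> Sop i (Sop j f) w = Sop j (Sop i f) w.
Proof.
move=> ij; rewrite SopE [RHS]SopE.
under eq_bigr => a _.
  under eq_bigr => b _.
    rewrite SopE !(upd_neq _ _ (i := i.+1)) ?(upd_neq _ _ (i := i)); try lia.
    rewrite big_distrr /=.
    under eq_bigr => c _ do rewrite big_distrr /=.
    over.
  over.
under [RHS]eq_bigr => a _.
  under eq_bigr => b _.
    rewrite SopE !(upd_neq _ _ (i := j.+1)) ?(upd_neq _ _ (i := j)); try lia.
    rewrite big_distrr /=.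
    under eq_bigr => c _ do rewrite big_distrr /=.
    over.
  over.
rewrite [LHS]pair_bigA [RHS]pair_bigA /=.
under eq_bigr => p _ do rewrite pair_bigA /=.
under [RHS]eq_bigr => p _ do rewrite pair_bigA /=.
rewrite exchange_big /=; apply: eq_bigr => p _; apply: eq_bigr => r _.
rewrite mulrCA; congr (_ * (_ * f _)); apply/funext => z; rewrite /upd.
by do ![case: eqP => //]; lia.
Qed.

Definition bop (g : bgen) : (word -> K) -> word -> K :=
  match g with Bs i => Sop i | Bt i => Top i | Be i => Eop i end.
Definition opw (u : seq bgen) f := foldr bop f u.

Lemma opw_cat u v f : opw (u ++ v) f = opw u (opw v f).
Proof. by rewrite /opw foldr_cat. Qed.

(* [phi] does not depend on the positions moved by [g]. *)
Definition indep (phi : word -> K) p := forall w a, phi (upd w p a) = phi w.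

Lemma bop_mul (g : bgen) phi f : indep phi (bidx g) -> indep phi (bidx g).+1 ->
  bop g (fun w => phi w * f w) = fun w => phi w * bop g f w.
Proof.
move=> ph1 ph2.
have slE w : sl2 (fun w => phi w * f w) (bidx g) w =
    fun a b => phi w * sl2 f (bidx g) w a b.
  by apply/funext => a; apply/funext => b; rewrite /sl2 ph2 ph1.
have SE i : bidx g = i -> forall w,
    Sop i (fun w => phi w * f w) w = phi w * Sop i f w.
  by move=> <- w; rewrite /Sop slE (S_scale HS).
have EE i : bidx g = i -> forall w,
    Eop i (fun w => phi w * f w) w = phi w * Eop i f w.
  by move=> <- w; rewrite /Eop slE ctr_scale; ring.
apply/funext => w; case: g {ph1 ph2 slE} SE EE => i /(_ i erefl w) SE /(_ i erefl w) EE /=.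
- exact: SE.
- by rewrite /Top SE EE; ring.
- exact: EE.
Qed.

Lemma opw_mul u phi f :
  (forall g : bgen, g \in u -> indep phi (bidx g) /\ indep phi (bidx g).+1) ->
  opw u (fun w => phi w * f w) = fun w => phi w * opw u f w.
Proof.
elim: u => [|g u IH] //= h.
rewrite IH => [|g' g'u]; last by apply: h; rewrite inE g'u orbT.
by have [|h1 h2] := h g; [rewrite inE eqxx | exact: bop_mul].
Qed.

Lemma bop_indep (g : bgen) f p : p != bidx g -> p != (bidx g).+1 ->
  indep f p -> indep (bop g f) p.
Proof.
move=> p1 p2 hf.
have slE w a : sl2 f (bidx g) (upd w p a) = sl2 f (bidx g) w.
  apply/funext => b; apply/funext => c; rewrite /sl2.
  by rewrite (updC w) // (updC (upd w _ b)) // hf.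
have SE i : bidx g = i -> forall w a, Sop i f (upd w p a) = Sop i f w.
  by move=> <- w a; rewrite /Sop slE !upd_neq // eq_sym.
have EE i : bidx g = i -> forall w a, Eop i f (upd w p a) = Eop i f w.
  by move=> <- w a; rewrite /Eop slE !upd_neq // eq_sym.
move=> w a; case: g {p1 p2 slE} SE EE => i /(_ i erefl w a) SE /(_ i erefl w a) EE /=.
- exact: SE.
- by rewrite /Top SE EE hf.
- exact: EE.
Qed.

Lemma opw_indep u f p : (forall g : bgen, g \in u -> p != bidx g /\ p != (bidx g).+1) ->
  indep f p -> indep (opw u f) p.
Proof.
elim: u => [|g u IH] //= h hf.
have [|h1 h2] := h g; first by rewrite inE eqxx.
apply: bop_indep => //; apply: IH => // g' g'u.
by apply: h; rewrite inE g'u orbT.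
Qed.

Lemma SopC_bop (g : bgen) j f : (j.+1 < bidx g)%N || ((bidx g).+1 < j)%N ->
  bop g (Sop j f) = Sop j (bop g f).
Proof.
move=> far.
have SS i f' : (j.+1 < i)%N || (i.+1 < j)%N -> Sop i (Sop j f') = Sop j (Sop i f').
  move=> h; apply/funext => w.
  by case/orP: h => h; [rewrite -Sop_comm | rewrite Sop_comm].
(* E, and then T, are polynomials in S, so commutation with S is enough. *)
have EE i f' : Eop i f' = fun w => xq^-1 * Sop i (Sop i f') w
    + ((-1) * Sop i f' w + xq^-1 * f' w).
  by apply/funext => w; rewrite Sop_Sop; field; exact: x0.
have SEE i f' : (j.+1 < i)%N || (i.+1 < j)%N -> Eop i (Sop j f') = Sop j (Eop i f').
  move=> h; apply/funext => w.
  by rewrite !EE !Sop_lin Sop_scale !(SS i) //.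
case: g far => i /= far; [exact: SS | | exact: SEE].
have TE f' : Top i f' = fun w => (-1) * Sop i f' w + (xq * f' w + xq * Eop i f' w).
  by apply/funext => w; rewrite /Top; ring.
apply/funext => w; rewrite !TE !Sop_lin Sop_scale SEE // SS //.
Qed.

Lemma SopC_opw u j f :
  (forall g : bgen, g \in u -> (j.+1 < bidx g)%N || ((bidx g).+1 < j)%N) ->
  opw u (Sop j f) = Sop j (opw u f).
Proof.
elim: u => [|g u IH] //= h; rewrite IH => [|g' g'u].
  by rewrite SopC_bop //; apply: h; rewrite inE eqxx.
by apply: h; rewrite inE g'u orbT.
Qed.

(** * Action of the words on nested cups *)

Section Independence.
Context (n : nat).

(* The cups join the positions [i] and [2 n - 1 - i]. *)
Definition nest k w : K := \prod_(k <= i < n) Om (w i) (w (n + n - i.+1)%N).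

Lemma nest_rec k w : (k < n)%N ->
  nest k w = Om (w k) (w (n + n - k.+1)%N) * nest k.+1 w.
Proof. by move=> kn; rewrite /nest big_ltn. Qed.

(** [S_nested] for the cups at i and i + 1; the remaining cups do not involve the four positions. *)
Lemma Sop_nest i k w : (k <= i)%N -> (i.+1 < n)%N ->
  Sop i (nest k) w = Sop (n + n - i.+2)%N (nest k) w.
Proof.
move=> ki i_n; set j := (n + n - i.+2)%N.
have Ej : (n + n - i.+1 = j.+1)%N by rewrite /j; lia.
pose F v p := Om (v p) (v (n + n - p.+1)%N).
pose phi v : K := (\prod_(k <= p < i) F v p) * \prod_(i.+2 <= p < n) F v p.
have EN : nest k = fun w => phi w * (Om (w i.+1) (w j) * Om (w i) (w j.+1)).
  apply/funext => v; rewrite /nest (big_cat_nat (n := i)) //=; last lia.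
  rewrite [X in _ * X]big_ltn; last lia.
  by rewrite [X in _ * (_ * X)]big_ltn // /phi /F -/j Ej; ring.
have ph p : p \in [:: i; i.+1; j; j.+1] -> indep phi p.
  rewrite !inE => pin v a; have far r : (k <= r < i)%N || (i.+1 < r < n)%N ->
    F (upd v p a) r = F v r.
    by move=> hr; rewrite /F !upd_neq //; rewrite /j in pin; lia.
  by rewrite /phi; congr (_ * _); apply: eq_big_nat => r hr; apply: far; lia.
have SM p g : indep phi p -> indep phi p.+1 ->
    Sop p (fun w => phi w * g w) w = phi w * Sop p g w.
  by move=> h1 h2; apply: (congr1 (fun F => F w) (@bop_mul (Bs p) phi g h1 h2)).
rewrite EN !SM; try by apply: ph; rewrite !inE eqxx ?orbT.
congr (_ * _); rewrite /Sop.
pose G v := Om (v i.+1) (v j) * Om (v i) (v j.+1).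
have -> : sl2 G i w = fun a b => Om b (w j) * Om a (w j.+1).
  apply/funext => a; apply/funext => b; rewrite /sl2 /G upd_eq.
  rewrite ![upd _ i.+1 b _]upd_neq; try (rewrite /j; lia).
  by rewrite upd_eq !upd_neq //; rewrite /j; lia.
have -> : sl2 G j w = fun c d => Om (w i.+1) c * Om (w i) d.
  apply/funext => a; apply/funext => b; rewrite /sl2 /G upd_eq.
  rewrite ![upd _ j.+1 b _]upd_neq; try (rewrite /j; lia).
  by rewrite upd_eq !upd_neq //; rewrite /j; lia.
by apply: (S_nested HS); rewrite ?oner_eq0.
Qed.

Fixpoint chS p d f := if d is d'.+1 then Sop p (chS p.+1 d' f) else f.

(** The crossing nearest to the cups is moved to their right ends, from p to 2 n - 2 - p, where it
    commutes with the crossings still on the left; then the next one follows. This frees the left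
    half for the words in higher strands. *)
Lemma opw_dwd k j : (k + j < n)%N ->
  opw (dwd k j) (nest k) = chS (n + n - (k + j).+1)%N j (nest k).
Proof.
elim: j => [|j IH] hj //=; rewrite -cats1 opw_cat /=.
have -> : Sop (k + j)%N (nest k) = Sop (n + n - (k + j).+2)%N (nest k).
  by apply/funext => w; apply: Sop_nest; lia.
rewrite addnS SopC_opw.
  rewrite IH; last lia.
  by have -> : ((n + n - (k + j).+2).+1 = n + n - (k + j).+1)%N by lia.
have : forall g : bgen, g \in dwd k j -> (k <= bidx g < k + j)%N.
  elim: j {IH hj} => [|j IH] g //=; rewrite mem_rcons inE => /orP[/eqP ->|/IH] /=; lia.
by move=> h g /h; lia.
Qed.

Lemma chS_opw u p d f : (forall g : bgen, g \in u -> ((bidx g).+1 < p)%N) ->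
  opw u (chS p d f) = chS p d (opw u f).
Proof.
elim: d p => [|d IH] p h //=; rewrite SopC_opw => [|g /h ->]; last by rewrite orbT.
by rewrite IH // => g /h; lia.
Qed.

(** * Tracing a strand by letters of extreme rank *)

Section Chains.
Context (k m : nat).
Hypothesis m0 : (0 < m)%N.

(** The trace left by a strand from k to r: under the top rank m at k, the letter at r is forced
    down to the bottom. *)
Definition vanish r f := forall w, rk (w k) = m%:Z -> (- m%:Z < rk (w r))%R -> f w = 0.
Definition sw w r := upd (upd w r (w r.+1)) r.+1 (w r).

Lemma Sop_vanish r f : (k < r)%N -> vanish r.+1 f -> vanish r (Sop r f).
Proof.
move=> kr van w wk wr; have [cf _ Hcf] := rk_S HG (w r) (w r.+1).
have sl a b : sl2 f r w a b = f (upd (upd w r a) r.+1 b) by [].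
rewrite /Sop Hcf => [|a b ab]; rewrite sl van ?mulr0 //;
  rewrite ?upd_eq ?upd_neq //; lia.
Qed.

(** With rank - m at r, the assumption of [rk_S] concerns pairs whose second letter is above the
    bottom, and there [vanish r.+1 f] applies. A single term survives. *)
Lemma Sop_move r w : (k < r)%N -> rk (w k) = m%:Z -> rk (w r) = - m%:Z ->
  exists2 cf, cf != 0 & forall f, vanish r.+1 f -> Sop r f w = cf * f (sw w r).
Proof.
move=> kr wk wr; have [cf cf0 Hcf] := rk_S HG (w r) (w r.+1); exists cf => // f van.
rewrite /Sop Hcf // => a b; rewrite wr => ab; rewrite /sl2 van //.
  by rewrite !upd_neq //; lia.
by rewrite upd_eq.
Qed.

Lemma TopE r f w : Top r f w = @rT K q D (sl2 f r w) (w r) (w r.+1).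
Proof. by rewrite /Top /rT sl2_id. Qed.

Lemma Top_vanish r f : (k < r)%N -> vanish r f -> vanish r.+1 (Top r f).
Proof.
move=> kr van w wk wr; have [cf _ Hcf] := rk_T HG (w r) (w r.+1).
have sl a b : sl2 f r w a b = f (upd (upd w r a) r.+1 b) by [].
rewrite TopE Hcf => [|a b ab]; rewrite sl van ?mulr0 //;
  rewrite ?(upd_neq _ _ (i := r.+1)) ?upd_eq ?upd_neq //; lia.
Qed.

Lemma Top_move r w : (k < r)%N -> rk (w k) = m%:Z -> rk (w r.+1) = - m%:Z ->
  exists2 cf, cf != 0 & forall f, vanish r f -> Top r f w = cf * f (sw w r).
Proof.
move=> kr wk wr; have [cf cf0 Hcf] := rk_T HG (w r) (w r.+1); exists cf => // f van.
rewrite TopE Hcf // => a b; rewrite wr => ab; rewrite /sl2 van //.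
  by rewrite !upd_neq //; lia.
by rewrite upd_neq ?upd_eq //; lia.
Qed.

Lemma chS_vanish p d f : (k < p)%N -> vanish (p + d)%N f -> vanish p (chS p d f).
Proof.
elim: d p => [|d IH] p kp van /=; first by rewrite addn0 in van.
by apply: Sop_vanish => //; apply: IH; rewrite ?addSnnS //; lia.
Qed.

(** The letter at p + d is pulled back to p and those between shift up by one place; the chain of d
    crossings undoes this. *)
Definition insS p d w : word := fun r =>
  if r == p then w (p + d)%N else if (p < r <= p + d)%N then w r.-1 else w r.

Lemma sw_insS p d w : sw (insS p d.+1 w) p = insS p.+1 d w.
Proof.
apply/funext => r; rewrite /sw /upd /insS eqxx addSnnS.
have h1 : (p.+1 == p) = false by lia.
have h2 : (p < p.+1 <= p + d.+1)%N = true by lia.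
rewrite h1 h2; have [//|r1] := eqVneq r p.+1.
have [->|r2] := eqVneq r p.
  by have -> : (p.+1 < p <= p + d.+1)%N = false by lia.
by have -> : (p < r <= p + d.+1)%N = (p.+1 < r <= p + d.+1)%N by lia.
Qed.

Lemma chS_move p d w : (k < p)%N -> rk (w k) = m%:Z -> rk (w (p + d)%N) = - m%:Z ->
  exists2 cf, cf != 0 & forall f, vanish (p + d)%N f ->
    chS p d f (insS p d w) = cf * f w.
Proof.
elim: d p => [|d IH] p kp wk wp.
  exists 1 => [|f van]; rewrite ?oner_eq0 // mul1r; congr f.
  apply/funext => r; rewrite /insS addn0; case: eqP => [->|] //.
  by case: ifP => //; lia.
have kp1 : (k < p.+1)%N by lia.
have wp1 : rk (w (p.+1 + d)%N) = - m%:Z by rewrite addSnnS.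
have [cf cf0 Hcf] := IH p.+1 kp1 wk wp1.
have Ek : rk (insS p d.+1 w k) = m%:Z.
  rewrite /insS; have -> : (k == p) = false by lia.
  by have -> : (p < k <= p + d.+1)%N = false by lia.
have Ep : rk (insS p d.+1 w p) = - m%:Z by rewrite /insS eqxx.
have [cf' cf'0 Hcf'] := Sop_move kp Ek Ep.
exists (cf' * cf) => [|f van]; first by rewrite mulf_neq0.
rewrite /= Hcf'; last by apply: chS_vanish; [lia | rewrite addSnnS].
by rewrite -mulrA -(Hcf f) ?sw_insS // addSnnS.
Qed.

Lemma uwd_vanish j f : vanish k.+1 f -> vanish (k.+1 + j)%N (opw (uwd k j) f).
Proof.
elim: j => [|j IH] van /=; first by rewrite addn0.
by rewrite addSnnS addnS; apply: Top_vanish; [lia | rewrite -addSnnS; apply: IH].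
Qed.

Definition insT j w : word := fun r =>
  if r == (k.+1 + j)%N then w k.+1 else if (k < r < k.+1 + j)%N then w r.+1 else w r.

Lemma sw_insT j w : sw (insT j.+1 w) (k + j.+1)%N = insT j w.
Proof.
apply/funext => r; rewrite /sw /upd /insT !addSn !addnS eqxx.
have h1 : ((k + j).+1 == (k + j).+2) = false by lia.
have h2 : (k < (k + j).+1 < (k + j).+2)%N = true by lia.
rewrite h1 h2; have [->|r1] := eqVneq r (k + j).+2.
  have -> : ((k + j).+2 == (k + j).+1) = false by lia.
  by have -> : (k < (k + j).+2 < (k + j).+1)%N = false by lia.
have [//|r2] := eqVneq r (k + j).+1.
by have -> : (k < r < (k + j).+2)%N = (k < r < (k + j).+1)%N by lia.
Qed.

Lemma uwd_move j w : rk (w k) = m%:Z -> rk (w k.+1) = - m%:Z ->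
  exists2 cf, cf != 0 & forall f, vanish k.+1 f ->
    opw (uwd k j) f (insT j w) = cf * f w.
Proof.
move=> wk wk1; elim: j => [|j [cf cf0 Hcf]].
  exists 1 => [|f van]; rewrite ?oner_eq0 // mul1r; congr f.
  apply/funext => r; rewrite /insT addn0; case: eqP => [->|] //.
  by case: ifP => //; lia.
have Ek : rk (insT j.+1 w k) = m%:Z.
  rewrite /insT; have -> : (k == k.+1 + j.+1)%N = false by lia.
  by rewrite ltnn.
have Ep : rk (insT j.+1 w (k + j.+1).+1) = - m%:Z.
  by rewrite /insT addSn eqxx.
have kj : (k < k + j.+1)%N by lia.
have [cf' cf'0 Hcf'] := Top_move kj Ek Ep.
exists (cf' * cf) => [|f van]; first by rewrite mulf_neq0.
rewrite /= Hcf'; last by rewrite addnS -addSn; apply: uwd_vanish.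
by rewrite -mulrA -(Hcf f) // sw_insT.
Qed.
End Chains.

Lemma nest_indep k p : (k <= n)%N -> (p < k)%N || (n + n - k <= p)%N -> indep (nest k) p.
Proof.
move=> kn hp w a; rewrite /nest; apply: eq_big_nat => r hr.
by rewrite !upd_neq //; lia.
Qed.

Lemma nf_nest k m b w : (k.+1 + m = n)%N -> b \in nf_words k.+1 m ->
  opw b (nest k) w = Om (w k) (w (n + n - k.+1)%N) * opw b (nest k.+1) w.
Proof.
move=> hk bm; pose phi w := Om (w k) (w (n + n - k.+1)%N).
have -> : nest k = fun w => phi w * nest k.+1 w.
  by apply/funext => v; rewrite nest_rec //; lia.
rewrite (opw_mul (phi := phi)) // => g gb.
have [g1 g2] := nf_idx hk bm gb.
by split=> v a; rewrite /phi !upd_neq //; lia.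
Qed.

Lemma nf_nest_indep k m b p : (k.+1 + m = n)%N -> b \in nf_words k.+1 m ->
  (p <= k)%N || (n + n - k.+1 <= p)%N -> indep (opw b (nest k.+1)) p.
Proof.
move=> hk bm hp; apply: opw_indep => [g gb|]; last by apply: nest_indep; lia.
by have [g1 g2] := nf_idx hk bm gb; lia.
Qed.

Lemma indep_upd2 f p r w a b : indep f p -> indep f r ->
  f (upd (upd w p a) r b) = f w.
Proof. by move=> fp fr; rewrite fr fp. Qed.

Lemma rk_Om0 a b : rk b != - rk a -> Om a b = 0.
Proof. by rewrite -(rk_Om HG) negbK => /eqP. Qed.

(** * Removing the outermost cup *)

Section Step.
Context (k m : nat) (hk : (k + m.+1 = n)%N) (hL : (m.+1 <= L)%N).
Context (tm tp : I) (Etm : rk tm = m.+1%:Z) (Etp : rk tp = - m.+1%:Z).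
Local Notation last := (n + n - k.+1)%N.

Lemma vanish_D b : b \in nf_words k.+1 m -> vanish k m.+1 last (opw b (nest k)).
Proof.
move=> bm w wk wr; rewrite (nf_nest (m := m)) //; last lia.
by rewrite rk_Om0 ?mul0r // wk; lia.
Qed.

Lemma vanish_U f : vanish k m.+1 k.+1 (Eop k f).
Proof. by move=> w wk wr; rewrite /Eop rk_Om0 ?mul0r // wk; lia. Qed.

Lemma opw_D j b : (j <= m)%N -> b \in nf_words k.+1 m ->
  opw (b ++ dwd k j) (nest k) = chS (last - j)%N j (opw b (nest k)).
Proof.
move=> jm bm; rewrite opw_cat opw_dwd; last lia.
rewrite chS_opw => [|g gb]; last first.
  have hk1 : (k.+1 + m = n)%N by lia.
  by have [g1 g2] := nf_idx hk1 bm gb; lia.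
by have -> : (n + n - (k + j).+1 = last - j)%N by lia.
Qed.

Variable c : seq bgen -> K.

(** The words of [sumD j] join k to last - j, those of [sumU j] join it to k + 1 + j. As k + m + 1 =
    n, these partners are the positions from k + 1 to last, each taken once, so the place of the
    bottom letter isolates one sum. *)
Definition sumD j w := \sum_(b <- nf_words k.+1 m)
  c (b ++ dwd k j) * chS (last - j)%N j (opw b (nest k)) w.
Definition sumU j w := \sum_(b <- nf_words k.+1 m)
  c (uwd k j ++ Be k :: b) * opw (uwd k j) (Eop k (opw b (nest k))) w.

Lemma sum_nf w : \sum_(u <- nf_words k m.+1) c u * opw u (nest k) w =
  \sum_(j <- iota 0 m.+1) sumD j w + \sum_(j <- iota 0 m) sumU j w.
Proof.
rewrite -[nf_words _ _]/([seq b ++ dwd k j | j <- iota 0 m.+1, b <- nf_words k.+1 m]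
  ++ [seq uwd k j ++ Be k :: b | j <- iota 0 m, b <- nf_words k.+1 m]).
rewrite big_cat !big_allpairs_dep; congr (_ + _).
  rewrite big_seq [RHS]big_seq; apply: eq_bigr => j; rewrite mem_iota => jm.
  rewrite /sumD big_seq [RHS]big_seq; apply: eq_bigr => b bm.
  by rewrite opw_D //; lia.
by apply: eq_bigr => j _; apply: eq_bigr => b _; rewrite opw_cat.
Qed.

Lemma sumD0 j w : (j <= m)%N -> rk (w k) = m.+1%:Z ->
  (- m.+1%:Z < rk (w (last - j)%N))%R -> sumD j w = 0.
Proof.
move=> jm wk wr; rewrite /sumD big_seq big1 // => b bm.
rewrite (@chS_vanish k m.+1) ?mulr0 //; first lia.
rewrite subnK; last lia.
exact: vanish_D.
Qed.

Lemma sumU0 j w : rk (w k) = m.+1%:Z ->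
  (- m.+1%:Z < rk (w (k.+1 + j)%N))%R -> sumU j w = 0.
Proof.
move=> wk wr; rewrite /sumU big1 // => b bm.
by rewrite (@uwd_vanish k m.+1 _ j) ?mulr0 //; apply: vanish_U.
Qed.

(* Position [p0] carries the only letter of rank [- m.+1]. *)
Lemma sum_nf_at p0 w : rk (w k) = m.+1%:Z ->
  (forall p, (k < p <= last)%N -> p != p0 -> (- m.+1%:Z < rk (w p))%R) ->
  (forall j, (j <= m)%N -> p0 = (last - j)%N ->
    \sum_(u <- nf_words k m.+1) c u * opw u (nest k) w = sumD j w) /\
  (forall j, (j < m)%N -> p0 = (k.+1 + j)%N ->
    \sum_(u <- nf_words k m.+1) c u * opw u (nest k) w = sumU j w).
Proof.
move=> wk wr; split=> j jm Ep; rewrite sum_nf.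
  rewrite [X in _ + X]big_seq [X in _ + X]big1 => [|i]; last first.
    by rewrite mem_iota => im; apply: sumU0 => //; apply: wr; lia.
  rewrite addr0 (bigD1_seq j) ?(mem_iota 0 m.+1) ?iota_uniq // big_seq_cond.
  rewrite big1 => [|i]; first exact: addr0.
  rewrite (mem_iota 0 m.+1) => /andP[im ij]; apply: sumD0;
    [lia | exact: wk | apply: wr; lia].
rewrite [X in X + _]big_seq [X in X + _]big1 => [|i]; last first.
  rewrite (mem_iota 0 m.+1) => im.
  by apply: sumD0; [lia | exact: wk | apply: wr; lia].
rewrite add0r (bigD1_seq j) ?mem_iota ?iota_uniq // big_seq_cond.
rewrite big1 => [|i]; first exact: addr0.
rewrite mem_iota => /andP[im ij]; apply: sumU0 => //.
by apply: wr; lia.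
Qed.

Lemma hk1 : (k.+1 + m = n)%N. Proof. by lia. Qed.

Hypothesis Hsum : forall w,
  (forall p, (k <= p < n + n - k)%N -> (`|rk (w p)| <= m.+1)%N) ->
  \sum_(u <- nf_words k m.+1) c u * opw u (nest k) w = 0.

Variable y : word.
Hypothesis Hy : forall p, (k < p < last)%N -> (`|rk (y p)| <= m)%N.

(** In [yD] the extreme letters label the outermost cup. In [yU] they label the cup of [Eop k]; the
    strand that ended at k + 1 now ends at last, so the letter of [y] at k + 1 is placed there. *)
Let yD := upd (upd y k tm) last tp.
Let yU := upd (upd (upd y last (y k.+1)) k.+1 tp) k tm.

Lemma Om_tmp : Om tm tp != 0.
Proof. by rewrite (rk_Om HG) Etm Etp. Qed.

Lemma nf_nest_y b a d : b \in nf_words k.+1 m ->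
  opw b (nest k.+1) (upd (upd y k a) last d) = opw b (nest k.+1) y.
Proof.
by move=> bm; apply: indep_upd2; apply: (nf_nest_indep hk1 bm); rewrite leqnn ?orbT.
Qed.

Lemma sumD_y j : (j <= m)%N ->
  \sum_(b <- nf_words k.+1 m) c (b ++ dwd k j) * opw b (nest k.+1) y = 0.
Proof.
(* The chain of [sumD j] carries this word back to [yD]. *)
move=> jm; pose w := insS (last - j)%N j yD.
have wk : w k = tm.
  rewrite /w /insS; have -> : (k == last - j)%N = false by lia.
  have -> : (last - j < k <= last - j + j)%N = false by lia.
  by rewrite /yD upd_neq ?upd_eq //; lia.
have yDl : yD last = tp by rewrite /yD upd_eq.
have yDk : yD k = tm by rewrite /yD upd_neq ?upd_eq //; lia.
have yDr r : (k < r < last)%N -> yD r = y r.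
  by move=> hr; rewrite /yD !upd_neq //; lia.
have Ej : (last - j + j = last)%N by lia.
have wr r : (k < r <= last)%N -> (r != last - j)%N -> (`|rk (w r)| <= m)%N.
  move=> hr rj; rewrite /w /insS (negPf rj) Ej.
  case: ifP => h; first by rewrite yDr; [apply: Hy | ]; lia.
  by rewrite yDr; [apply: Hy | ]; lia.
have wj : w (last - j)%N = tp by rewrite /w /insS eqxx Ej.
have bw p : (k <= p < n + n - k)%N -> (`|rk (w p)| <= m.+1)%N.
  move=> hp; have [->|pk] := eqVneq p k; first by rewrite wk Etm; lia.
  have [->|pj] := eqVneq p (last - j)%N; first by rewrite wj Etp; lia.
  by have := wr p; rewrite pj => /(_ _ isT); lia.
have wkr : rk (w k) = m.+1%:Z by rewrite wk.
have kj : (k < last - j)%N by lia.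
have ykr : rk (yD k) = m.+1%:Z by rewrite yDk.
have yjr : rk (yD (last - j + j)%N) = - m.+1%:Z by rewrite Ej yDl.
have [cf cf0 Hcf] := chS_move (ltn0Sn m) kj ykr yjr.
have wlt p : (k < p <= last)%N -> (p != last - j)%N -> (- m.+1%:Z < rk (w p))%R.
  by move=> hp pj; have := wr p hp pj; lia.
have [HD _] := sum_nf_at wkr wlt.
have := Hsum bw; rewrite (HD j) // /sumD.
rewrite big_seq (eq_bigr (fun b => (cf * Om tm tp) *
  (c (b ++ dwd k j) * opw b (nest k.+1) y))) => [|b bm]; last first.
  rewrite Hcf; last by rewrite Ej; apply: vanish_D.
  rewrite (nf_nest _ hk1 bm) yDk yDl (nf_nest_y _ _ bm); ring.
rewrite -big_seq -mulr_sumr => /eqP; rewrite !mulf_eq0 (negPf cf0) (negPf Om_tmp) /=.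
by move/eqP.
Qed.

(** The cap of [Eop k] and the outermost cup straighten to a strand from last to k + 1. In the
    contraction only the pair formed by the dual [zs] and the letter at last contributes, which
    restores [y]. *)
Lemma Eop_y b (v : word) zs : b \in nf_words k.+1 m -> rk zs = - rk (y k.+1) ->
  v k = tm -> v k.+1 = tp -> v last = y k.+1 ->
  (forall p, (k.+1 < p)%N -> (p != last)%N -> v p = y p) ->
  (forall p, (p < k)%N -> v p = y p) -> (k.+1 < last)%N ->
  Eop k (opw b (nest k)) v =
  Om tm tp * (om zs (y k.+1) * Om zs (y k.+1)) * opw b (nest k.+1) y.
Proof.
move=> bm Ezs vk vk1 vl vp vp' kl; rewrite /Eop vk vk1 -mulrA; congr (_ * _).
set z := y k.+1 in Ezs vl *.
have slE a d : sl2 (opw b (nest k)) k v a d =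
    Om a z * opw b (nest k.+1) (upd (upd v k a) k.+1 d).
  rewrite /sl2 (nf_nest _ hk1 bm); congr (Om _ _ * _).
    by rewrite upd_neq ?upd_eq //; lia.
  by rewrite !upd_neq //; lia.
rewrite /ctr (bigD1 zs) //= [X in _ + X]big1 => [|a azs]; last first.
  apply: big1 => d _; rewrite slE rk_Om0 ?mul0r ?mulr0 //.
  apply: contra azs => /eqP E; apply/eqP/(rk_inj HG); lia.
rewrite addr0 (bigD1 z) //= [X in _ + X]big1 => [|d dz]; last first.
  have -> : om zs d = 0; last by rewrite mul0r.
  apply/eqP; rewrite -[_ == 0]negbK (rk_om HG); apply: contra dz => /eqP E.
  by apply/eqP/(rk_inj HG); lia.
rewrite addr0 slE -mulrA -(nf_nest_y zs z bm); congr (_ * (_ * opw _ _ _)).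
apply/funext => p; rewrite /upd.
have [->|pk1] := eqVneq p k.+1.
  have -> : (k.+1 == last) = false by lia.
  by have -> : (k.+1 == k) = false by lia.
have [->|pk] := eqVneq p k; first by have -> : (k == last) = false by lia.
have [->|pl] := eqVneq p last; first by rewrite vl.
by have [pk'|pk'] := ltnP p k; [apply: vp' | apply: vp; lia].
Qed.

Lemma sumU_y j : (j < m)%N ->
  \sum_(b <- nf_words k.+1 m) c (uwd k j ++ Be k :: b) * opw b (nest k.+1) y = 0.
Proof.
move=> jm; pose w := insT k j yU.
have yUl : yU last = y k.+1.
  rewrite /yU upd_neq; last lia.
  by rewrite upd_neq ?upd_eq //; lia.
have yUk : yU k = tm by rewrite /yU upd_eq.
have yUk1 : yU k.+1 = tp by rewrite /yU upd_neq ?upd_eq //; lia.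
have yUr r : (r != k)%N -> (r != k.+1)%N -> (r != last)%N -> yU r = y r.
  by move=> h1 h2 h3; rewrite /yU !upd_neq.
have wk : w k = tm.
  rewrite /w /insT; have -> : (k == k.+1 + j)%N = false by lia.
  by rewrite ltnn.
have wr r : (k < r <= last)%N -> (r != k.+1 + j)%N -> (`|rk (w r)| <= m)%N.
  move=> hr rj; rewrite /w /insT (negPf rj); case: ifP => h.
    by rewrite yUr; [apply: Hy | | |]; lia.
  have [->|rl] := eqVneq r last; first by rewrite yUl; apply: Hy; lia.
  by rewrite yUr; [apply: Hy | | |]; lia.
have wj : w (k.+1 + j)%N = tp by rewrite /w /insT eqxx.
have bw p : (k <= p < n + n - k)%N -> (`|rk (w p)| <= m.+1)%N.
  move=> hp; have [->|pk] := eqVneq p k; first by rewrite wk Etm; lia.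
  have [->|pj] := eqVneq p (k.+1 + j)%N; first by rewrite wj Etp; lia.
  by have := wr p; rewrite pj => /(_ _ isT); lia.
have wkr : rk (w k) = m.+1%:Z by rewrite wk.
have ykr : rk (yU k) = m.+1%:Z by rewrite yUk.
have yk1r : rk (yU k.+1) = - m.+1%:Z by rewrite yUk1.
have [cf cf0 Hcf] := uwd_move (ltn0Sn m) j ykr yk1r.
have wlt p : (k < p <= last)%N -> (p != k.+1 + j)%N -> (- m.+1%:Z < rk (w p))%R.
  by move=> hp pj; have := wr p hp pj; lia.
have [_ HU] := sum_nf_at wkr wlt.
have [zs Ezs] : exists zs : I, rk zs = - rk (y k.+1).
  by apply: (rk_surj HG); have := rk_bound HG (y k.+1); lia.
have C0 : om zs (y k.+1) * Om zs (y k.+1) != 0.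
  by rewrite mulf_neq0 ?(rk_om HG) ?(rk_Om HG) // Ezs opprK.
have := Hsum bw; rewrite (HU j) // /sumU.
rewrite big_seq (eq_bigr (fun b => (cf * (Om tm tp * (om zs (y k.+1) * Om zs (y k.+1)))) *
  (c (uwd k j ++ Be k :: b) * opw b (nest k.+1) y))) => [|b bm]; last first.
  rewrite Hcf; last exact: vanish_U.
  rewrite (@Eop_y b yU zs) //; first by ring.
  - by move=> p h1 h2; apply: yUr; lia.
  - by move=> p h; apply: yUr; lia.
  - lia.
have nz : cf * (Om tm tp * (om zs (y k.+1) * Om zs (y k.+1))) != 0.
  by rewrite mulf_neq0 // mulf_neq0 // Om_tmp.
by rewrite -big_seq -mulr_sumr => /eqP; rewrite mulf_eq0 (negPf nz) => /eqP.
Qed.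
End Step.

(** The relation is known for letters of absolute rank at most m. Spending the pair of rank m on the
    strand of position k leaves, for each partner, a relation between inner words tested on letters
    of rank below m. *)
Lemma nf_independent m k (c : seq bgen -> K) : (k + m = n)%N -> (m <= L)%N ->
  (0 < L)%N ->
  (forall w, (forall p, (k <= p < n + n - k)%N -> (`|rk (w p)| <= m)%N) ->
    \sum_(u <- nf_words k m) c u * opw u (nest k) w = 0) ->
  forall u, u \in nf_words k m -> c u = 0.
Proof.
elim: m k c => [|m IH] k c hk hm L0 Hc.
  (* No cups remain and the product is 1; a letter is needed only to have some word to evaluate
     at. *)
  have [a _] := rk_surj HG (z := 1) ltac:(by []).
  move=> u; rewrite inE => /eqP ->; have := Hc (fun _ => a).
  rewrite big_seq1 /= /nest big_geq; last lia.
  by rewrite mulr1; apply => p; lia.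
have [tm Etm] := rk_surj HG (z := m.+1%:Z) ltac:(lia).
have [tp Etp] := rk_surj HG (z := - m.+1%:Z) ltac:(lia).
move=> u; rewrite mem_cat => /orP[] /allpairsP[[j b] /= [jm bm ->]].
  move: jm; rewrite (mem_iota 0 m.+1) => jm.
  apply: (IH k.+1 (fun b => c (b ++ dwd k j))) => //; try lia.
  move=> y Hy; apply: (sumD_y hk hm Etm Etp Hc) => //; lia.
move: jm; rewrite mem_iota => jm.
apply: (IH k.+1 (fun b => c (uwd k j ++ Be k :: b))) => //; try lia.
move=> y Hy; apply: (sumU_y hk hm Etm Etp Hc) => //; lia.
Qed.
End Independence.
End Words.

(** * Evaluation of scalars *)

(* A point (a, x) = (ev_a, ev_x) of Spec A. *)
Record evpt := EvPt {
  ev_x : algC; ev_a : algC; ev_x0 : ev_x != 0; ev_a2 : ev_a * ev_a = 1 }.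

Lemma laurentQP (f : laurentQ) :
  exists pk : {poly rat} * nat, val f = tofrac pk.1 / tofrac 'X ^+ pk.2.
Proof. by case: f => f /= /asboolP[p [k ->]]; exists (p, k). Qed.

(** A chosen numerator and exponent; by [levE] the value computed from them does not depend on the
    choice. *)
Definition lnum (f : laurentQ) := proj1_sig (cid (laurentQP f)).
Lemma lnumP f : val f = tofrac (lnum f).1 / tofrac 'X ^+ (lnum f).2.
Proof. exact: proj2_sig (cid (laurentQP f)). Qed.

Section Eval.
Context (P : evpt).
Local Notation z := (ev_x P).
Local Notation eps := (ev_a P).
Let z0 : z != 0 := ev_x0 P.
Let eps2 : eps * eps = 1 := ev_a2 P.

Definition evq (p : {poly rat}) : algC := (map_poly ratr p).[z].

Lemma evqD p r : evq (p + r) = evq p + evq r.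
Proof. by rewrite /evq rmorphD hornerD. Qed.
Lemma evqM p r : evq (p * r) = evq p * evq r.
Proof. by rewrite /evq rmorphM hornerM. Qed.
Lemma evqXn k : evq 'X^k = z ^+ k.
Proof. by rewrite /evq rmorphXn /= map_polyX hornerXn. Qed.

Definition lev (f : laurentQ) : algC := evq (lnum f).1 / z ^+ (lnum f).2.

Lemma levE f p k : val f = tofrac p / tofrac 'X ^+ k -> lev f = evq p / z ^+ k.
Proof.
rewrite lnumP /lev; move: (lnum f) => [r l] /= E.
have X0 i : tofrac ('X : {poly rat}) ^+ i != 0 by rewrite expf_neq0 // fracX_neq0.
move/eqP: E; rewrite eqr_div ?X0 // -!tofracXn -!tofracM => /eqP/eqP.
rewrite tofrac_eq => /eqP/(congr1 evq); rewrite !evqM !evqXn => E.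
by apply/eqP; rewrite eqr_div ?expf_neq0 // E.
Qed.

Lemma lev_is_zmod : zmod_morphism lev.
Proof.
move=> f g; have X0 i : tofrac ('X : {poly rat}) ^+ i != 0.
  by rewrite expf_neq0 // fracX_neq0.
rewrite (@levE _ ((lnum f).1 * 'X^((lnum g).2) - (lnum g).1 * 'X^((lnum f).2))
  ((lnum f).2 + (lnum g).2)%N); last first.
  rewrite rmorphB /= !lnumP tofracB !tofracM !tofracXn exprD.
  by rewrite -mulNr addf_div ?X0 // mulNr.
rewrite /lev -mulNr evqD -mulNr !evqM !evqXn addf_div ?expf_neq0 // exprD.
congr ((_ + _ * _) / _).
by rewrite /evq rmorphN hornerN.
Qed.

Lemma lev_is_monoid : monoid_morphism lev.
Proof.
split=> [|f g].
  rewrite (@levE _ 1 0) ?expr0 ?divr1 ?tofrac1 ?rmorph1 //.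
  by rewrite /evq rmorph1 hornerC.
rewrite (@levE _ ((lnum f).1 * (lnum g).1) ((lnum f).2 + (lnum g).2)%N).
  by rewrite evqM exprD /lev mulf_div.
by rewrite rmorphM /= !lnumP tofracM exprD mulf_div.
Qed.

HB.instance Definition _ := GRing.isZmodMorphism.Build laurentQ algC lev lev_is_zmod.
HB.instance Definition _ := GRing.isMonoidMorphism.Build laurentQ algC lev lev_is_monoid.

Lemma lev_X : lev laurentX = z.
Proof.
by rewrite (@levE _ 'X 0) ?expr0 ?divr1 // -[X in evq X]expr1 evqXn expr1.
Qed.

Lemma lev_XV : lev laurentXV = z^-1.
Proof.
apply: (mulfI z0); rewrite -{1}lev_X -rmorphM laurentXK rmorph1 divff //.
Qed.

Definition bev (c : baseA) : algC := (map_poly lev (c : {poly laurentQ})).[eps].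

Lemma bev_mod (p : {poly laurentQ}) :
  (map_poly lev (Pdiv.Ring.rmodp p (mk_monic ('X^2 - 1)))).[eps] = (map_poly lev p).[eps].
Proof.
rewrite mk_monic_baseA.
have Xm : ('X^2 - 1 : {poly laurentQ}) \is monic by rewrite -polyC1 monicXnsubC.
rewrite {2}(Pdiv.RingMonic.rdivp_eq Xm p) rmorphD rmorphM /= hornerD hornerM.
rewrite rmorphB /= map_polyXn rmorph1 hornerD hornerN hornerXn hornerC.
by rewrite [eps ^+ 2]expr2 eps2 subrr mulr0 add0r.
Qed.

Lemma bev_in (p : {poly laurentQ}) : bev (in_qpoly ('X^2 - 1) p) = (map_poly lev p).[eps].
Proof. exact: bev_mod. Qed.

Lemma bev_is_zmod : zmod_morphism bev.
Proof.
move=> c d; rewrite /bev -hornerN -hornerD -rmorphB; congr (map_poly lev _).[_].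
Qed.

Lemma bev_is_monoid : monoid_morphism bev.
Proof.
split=> [|c d].
  by rewrite -in_qpoly1 bev_in rmorph1 hornerC.
by rewrite {1}/bev bev_mod rmorphM hornerM.
Qed.

HB.instance Definition _ := GRing.isZmodMorphism.Build baseA algC bev bev_is_zmod.
HB.instance Definition _ := GRing.isMonoidMorphism.Build baseA algC bev bev_is_monoid.

Lemma bev_a : bev baseA_a = eps.
Proof. by rewrite bev_in map_polyX hornerX. Qed.
Lemma bev_x : bev baseA_x = z.
Proof. by rewrite bev_in map_polyC hornerC /= lev_X. Qed.
Lemma bev_xV : bev baseA_xV = z^-1.
Proof. by rewrite bev_in map_polyC hornerC /= lev_XV. Qed.
End Eval.

(** * Scalars vanishing at values coming from roots of unity *)

Lemma poly_rat_many_roots (p : {poly rat}) (l : nat) (eps w : algC) :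
  (4 * l - 1).-primitive_root w -> eps != 0 -> (size p < 2 * l)%N ->
  (forall j, (0 < j < 2 * l)%N ->
     (map_poly ratr p).[eps * (w ^+ j + (w ^+ j)^-1)] = 0) ->
  p = 0.
Proof.
move=> prw eps0 sp h; apply/eqP; rewrite -(map_poly_eq0 (ratr : rat -> algC)).
have w0 : w != 0.
  by apply/eqP => E; have := prim_expr_order prw; rewrite E expr0n;
    case: eqP (prim_order_gt0 prw) => [->//|_ _ /esym/eqP]; rewrite oner_eq0.
pose f j := eps * (w ^+ j + (w ^+ j)^-1).
apply/negPn/negP => p0.
have := max_poly_roots p0 (rs := [seq f j | j <- iota 1 (2 * l - 1)]).
rewrite size_map size_iota size_map_poly => H.
suff : (2 * l - 1 < size p)%N by lia.
apply: H.
  apply/allP => y /mapP[j]; rewrite mem_iota => jl ->; apply/rootP; apply: h; lia.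
rewrite map_inj_in_uniq ?iota_uniq // => i j; rewrite !mem_iota => il jl.
move/(mulfI eps0) => E.
have wi0 : w ^+ i != 0 by rewrite expf_neq0.
have wj0 : w ^+ j != 0 by rewrite expf_neq0.
(* The indices j and 4 l - 1 - j give the same value, whence the range below 2 l: there i + j < 4 l
   - 1, so the second factor is nonzero. *)
have : (w ^+ i - w ^+ j) * (w ^+ i * w ^+ j - 1) = 0.
  move/(congr1 (fun y => y * (w ^+ i * w ^+ j))): E => E.
  have E' : w ^+ i * (w ^+ i * w ^+ j) + w ^+ j = w ^+ j * (w ^+ i * w ^+ j) + w ^+ i.
    apply: etrans (etrans E _); field; rewrite ?wi0 ?wj0 //.
  by rewrite -(subrr (w ^+ i * (w ^+ i * w ^+ j) + w ^+ j)) {2}E'; ring.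
move/eqP; rewrite mulf_eq0 !subr_eq0 -exprD => /orP[].
  rewrite (eq_prim_root_expr prw) !modn_small //; [move/eqP | |]; lia.
rewrite -(prim_order_dvd prw) => /dvdn_leq; lia.
Qed.

Section OddRoots.
Context (l : nat) (y : algC) (l0 : (0 < l)%N) (y1 : y ^+ (4 * l - 1) = 1).

Lemma odd_root_neq0 : y != 0.
Proof.
apply/eqP => E; move: y1; rewrite E expr0n.
have -> : (4 * l - 1 == 0)%N = false by lia.
by move/esym/eqP; rewrite oner_eq0.
Qed.

(** No power of an element of odd order is -1. In [odd_root_x1] this is used for y^3, which would be
    -1 if y + y^-1 = 1. *)
Lemma odd_root_sqr : y ^+ 2 + 1 != 0.
Proof.
apply/eqP => /eqP; rewrite addr_eq0 => /eqP E.
have : (y ^+ 2) ^+ (4 * l - 1) = 1 by rewrite exprAC y1 expr1n.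
rewrite E -signr_odd (_ : odd (4 * l - 1)); last by lia.
by rewrite expr1 => /eqP; rewrite eqNr oner_eq0.
Qed.

Lemma odd_root_x : y + y^-1 != 0.
Proof.
have -> : y + y^-1 = (y ^+ 2 + 1) / y by field; exact: odd_root_neq0.
by rewrite mulf_neq0 ?invr_neq0 ?odd_root_neq0 ?odd_root_sqr.
Qed.

(** The values 1 and 2 are excluded as the zeros of the augmentation of [C], see [aug_C_neq0]. *)
Lemma odd_root_x1 : y + y^-1 != 1.
Proof.
apply/eqP => E; have E3 : y ^+ 3 = -1.
  have : y * (y + y^-1) = y by rewrite E mulr1.
  rewrite mulrDr divff ?odd_root_neq0 // => h.
  have -> : y ^+ 3 = (y * y + 1) * (y + 1) - y * y - y - 1 by ring.
  by rewrite h; ring.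
have : (y ^+ 3) ^+ (4 * l - 1) = 1 by rewrite exprAC y1 expr1n.
rewrite E3 -signr_odd (_ : odd (4 * l - 1)); last by lia.
by rewrite expr1 => /eqP; rewrite eqNr oner_eq0.
Qed.

Lemma odd_root_x2 : y != 1 -> y + y^-1 != 2.
Proof.
move=> yn1; apply: contra yn1 => /eqP E; rewrite -subr_eq0 -sqrf_eq0.
apply/eqP; have : y * (y + y^-1) = y * 2 by rewrite E.
rewrite mulrDr divff ?odd_root_neq0 // => h.
have -> : (y - 1) ^+ 2 = y * y + 1 - y * 2 by ring.
by rewrite h subrr.
Qed.
End OddRoots.

Lemma lev_eq0 (f : laurentQ) (l : nat) (eps w : algC) : eps * eps = 1 ->
  (4 * l - 1).-primitive_root w -> (size (lnum f).1 < 2 * l)%N ->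
  (forall j (P : evpt), (0 < j < 2 * l)%N -> ev_a P = eps ->
     ev_x P = eps * (w ^+ j + (w ^+ j)^-1) -> lev P f = 0) -> f = 0.
Proof.
move=> eps2 prw sl h.
have eps0 : eps != 0.
  by apply: contra_eq_neq eps2 => ->; rewrite mul0r eq_sym oner_eq0.
have E : (lnum f).1 = 0.
  apply: (poly_rat_many_roots prw eps0 sl) => j jl.
  have yj : (w ^+ j) ^+ (4 * l - 1) = 1.
    by rewrite exprAC (prim_expr_order prw) expr1n.
  have l0 : (0 < l)%N by lia.
  have x0 : eps * (w ^+ j + (w ^+ j)^-1) != 0.
    by rewrite mulf_neq0 ?(odd_root_x l0).
  have /eqP := h j (EvPt x0 eps2) jl erefl erefl.
  by rewrite mulf_eq0 invr_eq0 expf_eq0 (negPf x0) andbF orbF => /eqP.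
by apply: val_inj; rewrite lnumP E tofrac0 mul0r.
Qed.

(** For c = p0 + p1 a, the points with a = 1 and a = -1 give p0 + p1 = 0 and p0 - p1 = 0. Since l is
    chosen after [c], it can exceed the sizes of both numerators; the bound [N] lets the caller ask
    for enough letters. *)
Lemma baseA_eq0 (c : baseA) (N : nat) :
  (forall l w j (P : evpt), (N <= l)%N -> (4 * l - 1).-primitive_root w ->
    (0 < j < 2 * l)%N -> ev_x P = ev_a P * (w ^+ j + (w ^+ j)^-1) ->
    bev P c = 0) -> c = 0.
Proof.
move=> h; pose p : {poly laurentQ} := c.
have sp : (size p <= 2)%N.
  rewrite -ltnS; apply: leq_trans (size_mk_monic c) _.
  by rewrite mk_monic_baseA -polyC1 size_XnsubC.
have bE P : bev P c = lev P p`_0 + lev P p`_1 * ev_a P.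
  rewrite /bev -/p (horner_coef_wide _ (n := 2)) ?size_map_poly_leq //; last first.
    by apply: leq_trans sp; apply: size_poly.
  by rewrite !big_ord_recl big_ord0 /= !coef_map /= expr0 expr1 mulr1 addr0.
pose fp := p`_0 + p`_1; pose fm := p`_0 - p`_1.
pose l := (N + size (lnum fp).1 + size (lnum fm).1 + 1)%N.
have l0 : (0 < 4 * l - 1)%N by lia.
have [w prw] := C_prim_root_exists l0.
have fp0 : fp = 0.
  apply: (@lev_eq0 _ l 1 w) => //; [exact: mulr1 | lia |] => j P jl Pa Px.
  have := h l w j P ltac:(lia) prw jl; rewrite Pa Px => /(_ erefl).
  by rewrite bE Pa mulr1 -rmorphD.
have fm0 : fm = 0.
  apply: (@lev_eq0 _ l (-1) w) => //; [by rewrite mulrNN mulr1 | lia |] => j P jl Pa Px.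
  have := h l w j P ltac:(lia) prw jl; rewrite Pa Px => /(_ erefl).
  by rewrite bE Pa mulrN1 -rmorphB.
have two0 (f : laurentQ) : f + f = 0 -> f = 0.
  have u2 : (2%:R : {fraction {poly rat}}) != 0.
    have -> : 2%:R = tofrac (2%:R : {poly rat}) by rewrite rmorph_nat.
    by rewrite tofrac_eq0 -polyC_natr polyC_eq0.
  move/(congr1 val) => /= /eqP; rewrite -mulr2n -mulr_natl mulf_eq0 (negPf u2) /=.
  by move/eqP => E; apply: val_inj.
have p0 : p`_0 = 0.
  apply: two0; have <- : fp + fm = p`_0 + p`_0.
    by rewrite /fp /fm addrACA subrr addr0.
  by rewrite fp0 fm0 addr0.
have p1 : p`_1 = 0 by move: fp0; rewrite /fp p0 add0r.
apply: val_inj; apply/polyP => i; rewrite coef0.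
case: i => [|[|i]]; [exact: p0 | exact: p1 | ].
by rewrite nth_default //; apply: leq_trans sp _.
Qed.

(** * Action of the free algebra *)

Section Action.
Context (q : algC) (D : rdata algC) (L : nat) (HG : rgood q D L 1).
Hypothesis x0 : xq q != 0.
Context (P : evpt) (HP : ev_x P = ev_a P * xq q) (n : nat).
Local Notation word := (nat -> rI D).
Local Notation eps := (ev_a P).
Implicit Types (f : word -> algC) (w : word) (u v : F_free n).

Definition gact (g : F_gen n) f w : algC :=
  match g with
  | GenS i => eps * Sop i f w
  | GenSV i => eps * Top q i f w
  | GenE i => eps * Eop i f w
  | GenC => 0
  end.

Definition mact (m : seq (F_gen n)) f : word -> algC := foldr gact f m.
(** Extended from monomials separately for each [f] and [w], so that additivity in [u] is immediate;
    compatibility with products is [actM]. *)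
Definition act u f w : algC := mmap (bev P) (fun m : {fmonom (F_gen n)} => mact m f w) u.

Lemma gact_lin g k f1 f2 w :
  gact g (fun w => k * f1 w + f2 w) w = k * gact g f1 w + gact g f2 w.
Proof.
case: g => [i|i|i|] /=; rewrite ?(Sop_lin HG) ?(Top_lin HG) ?Eop_lin; ring.
Qed.

Lemma gact0 g w : gact g (fun _ => 0) w = 0.
Proof.
have := gact_lin g (-1) (fun _ => 0) (fun _ => 0) w.
have -> : (fun w : word => -1 * (0 : algC) + 0) = fun _ => 0.
  by apply/funext => ?; rewrite mulr0 addr0.
by rewrite mulN1r addNr.
Qed.

Lemma mact_lin m k f1 f2 w :
  mact m (fun w => k * f1 w + f2 w) w = k * mact m f1 w + mact m f2 w.
Proof.
elim: m w => [|g m IH] w //=; rewrite -gact_lin; congr (gact g _ w).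
by apply/funext => v; apply: IH.
Qed.

Lemma mact0 m w : mact m (fun _ => 0) w = 0.
Proof.
elim: m w => [|g m IH] w //=; rewrite -[RHS](gact0 g w); congr (gact g _ w).
by apply/funext => v; apply: IH.
Qed.

Lemma mact_sum m (J : Type) (r : seq J) (c : J -> algC) (F : J -> word -> algC) w :
  mact m (fun w => \sum_(j <- r) c j * F j w) w = \sum_(j <- r) c j * mact m (F j) w.
Proof.
elim: r => [|j r IH].
  rewrite big_nil -[RHS](mact0 m w); congr (mact m _ w).
  by apply/funext => v; rewrite big_nil.
rewrite big_cons -IH -mact_lin; congr (mact m _ w).
by apply/funext => v; rewrite big_cons.
Qed.

Lemma actD u v f w : act (u + v) f w = act u f w + act v f w.
Proof. exact: raddfD. Qed.
Lemma actB u v f w : act (u - v) f w = act u f w - act v f w.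
Proof. exact: raddfB. Qed.
Lemma act0 f w : act 0 f w = 0.
Proof. exact: raddf0. Qed.
Lemma act_sum (J : Type) (r : seq J) (F : J -> F_free n) f w :
  act (\sum_(j <- r) F j) f w = \sum_(j <- r) act (F j) f w.
Proof. exact: raddf_sum. Qed.

Lemma actM u v f w : act (u * v) f w = act u (act v f) w.
Proof.
rewrite [u * v]malgME act_sum [RHS]mmapE; apply: eq_bigr => i _.
rewrite act_sum; have -> : act v f = fun w =>
    \sum_(k <- msupp v) bev P v@_k * mact k f w by [].
rewrite mact_sum big_distrr; apply: eq_bigr => j _ /=.
by rewrite /act mmapU -[X in X * _]/(bev P _) rmorphM fmM /mact foldr_cat mulrA.
Qed.

Lemma act_zero u w : act u (fun _ => 0) w = 0.
Proof. by rewrite /act mmapE big1 // => m _; rewrite mact0 mulr0. Qed.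

Lemma act1 f w : act 1 f w = f w.
Proof.
have <- : (malgC 1 : F_free n) = 1 by [].
rewrite /act mmapU -[X in X * _]/(bev P _).
by rewrite rmorph1 mul1r fm1.
Qed.

Lemma act_var g f w : act (F_var g) f w = gact g f w.
Proof. by rewrite /act /F_var mmapU -[X in X * _]/(bev P _) rmorph1 mul1r fmuE. Qed.

Lemma actZ k u f w : act (k *: u) f w = bev P k * act u f w.
Proof.
rewrite -mul_malgC actM; set g := act u f.
by rewrite /act mmapU fm1.
Qed.

Lemma act_varE g f : act (F_var g) f = gact g f.
Proof. by apply/funext => w; apply: act_var. Qed.

Lemma eps0 : eps != 0.
Proof.
have := ev_a2 P; apply: contra_eq_neq => ->.
by rewrite mul0r eq_sym oner_eq0.
Qed.

(** The scalar is kept apart from the operator, so that the powers of [ev_a P] in a product can be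
    collected. *)
Definition acts u k (A : (word -> algC) -> word -> algC) :=
  forall f w, act u f w = k * A f w.

Lemma actsM u v k l A B : acts u k A -> acts v l B ->
  (forall c f w, A (fun w => c * f w) w = c * A f w) ->
  acts (u * v) (k * l) (fun f => A (B f)).
Proof.
move=> hu hv Ac f w; rewrite actM hu -mulrA -(Ac l (B f)); congr (_ * A _ _).
by apply/funext => w'; apply: hv.
Qed.

Lemma actsM3 u v t k l m A B C : acts u k A -> acts v l B -> acts t m C ->
  (forall c f w, A (fun w => c * f w) w = c * A f w) ->
  (forall c f w, B (fun w => c * f w) w = c * B f w) ->
  acts (u * v * t) (k * l * m) (fun f => A (B (C f))).
Proof.
move=> hu hv ht Ac Bc; apply: (actsM (actsM hu hv Ac) ht) => c f w.
by rewrite -Ac; congr (A _ w); apply/funext => ?; apply: Bc.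
Qed.

Lemma acts_eq u v k l A B f w : acts u k A -> acts v l B ->
  k * A f w = l * B f w -> act u f w = act v f w.
Proof. by move=> hu hv E; rewrite hu E hv. Qed.

Lemma acts_S i : acts (F_var (GenS i)) eps (Sop i).
Proof. by move=> f w; rewrite act_var. Qed.
Lemma acts_T i : acts (F_var (GenSV i)) eps (Top q i).
Proof. by move=> f w; rewrite act_var. Qed.
Lemma acts_E i : acts (F_var (GenE i)) eps (Eop i).
Proof. by move=> f w; rewrite act_var. Qed.

Lemma signed_quad (K : comPzRingType) (e X S T f : K) : e * e = 1 ->
  e * e * (X * S - f + X * T) - e * X * (e * S) + f = X * T.
Proof. by move=> ee; rewrite mulrACA ee; ring. Qed.

Lemma act_rel u v f w : F_relations u v -> act u f w = act v f w.
Proof.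
have epsK : eps * eps = 1 := ev_a2 P.
have SZ (i : nat) k f' w' : Sop i (fun w : word => k * f' w) w' = k * Sop i f' w'.
  exact: Sop_scale HG _ _ _ _.
have TZ (i : nat) k f' w' : Top q i (fun w : word => k * f' w) w' = k * Top q i f' w'.
  exact: Top_scale HG _ _ _ _.
have EZ (i : nat) k f' w' : Eop i (fun w : word => k * f' w) w' = k * Eop i f' w'.
  exact: Eop_scale.
have xE : bev P baseA_x = eps * xq q by rewrite bev_x HP.
have xVE : bev P baseA_xV = eps * (xq q)^-1.
  rewrite bev_xV HP invfM; congr (_ * _).
  by apply: (mulfI eps0); rewrite ev_a2 divff // eps0.
have aC f' : act (F_var GenC) f' = fun _ => 0 by rewrite act_varE.
case=> {u v} [i|i|i j ij|i j ij|i|i|i|i j ij|i j ij|i|i].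
- have -> := actsM (acts_S i) (acts_T i) (SZ i) f w.
  by rewrite act1 (Sop_Top HG) ?x0 // epsK mul1r.
- have -> := actsM (acts_T i) (acts_S i) (TZ i) f w.
  by rewrite act1 (Top_Sop HG) ?x0 // epsK mul1r.
- apply: (acts_eq (actsM3 (acts_S i) (acts_S j) (acts_S i) (SZ i) (SZ j))
                  (actsM3 (acts_S j) (acts_S i) (acts_S j) (SZ j) (SZ i))).
  by rewrite ij (Sop_braid HG).
- apply: (acts_eq (actsM (acts_S i) (acts_S j) (SZ i))
                  (actsM (acts_S j) (acts_S i) (SZ j))).
  by case: ij => ij; [rewrite (Sop_comm HG) | rewrite -(Sop_comm HG)].
- rewrite actM actB actZ act1 acts_S bev_a act0.
  set g := act _ f.
  (* The quadratic factor acts by x E, and S fixes the image of E, so s - a kills it. *)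
  have gE : g = fun w => xq q * Eop i f w.
    apply/funext => w'; rewrite /g actD actB actZ act1 xE acts_S.
    rewrite expr2; have -> := actsM (acts_S i) (acts_S i) (SZ i) f w'.
    by rewrite (Sop_Sop HG) //; apply: signed_quad.
  by rewrite gE SZ (Sop_Eop HG) // subrr.
- rewrite acts_E actZ actB actZ actD act1 acts_T acts_S bev_a xVE.
  rewrite (Eop_skein x0) /=; congr (_ * (_ - _)).
  by rewrite -mulrDr mulrACA epsK mul1r.
- have -> := actsM (acts_S i) (acts_E i) (SZ i) f w.
  by rewrite (Sop_Eop HG) // actZ acts_E bev_a mulrA.
(* Of the three signs [eps] one remains, and [C] acts by 0. *)
- rewrite (actsM3 (acts_E i) (acts_S j) (acts_E i) (EZ i) (SZ j) f w).
  rewrite actD aC addr0 acts_E epsK mul1r; congr (_ * _).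
  by case: ij => ij; rewrite ij (Eop_Sop_Eop HG).
- rewrite (actsM3 (acts_E i) (acts_T j) (acts_E i) (EZ i) (TZ j) f w).
  rewrite actD aC addr0 acts_E epsK mul1r; congr (_ * _).
  by rewrite (Eop_Top_Eop HG).
- by rewrite actM actZ aC act_zero mulr0.
- by rewrite actM actZ !aC mulr0.
Qed.

Lemma act_ideal u : rel_ideal (@F_relations n) u -> forall f w, act u f w = 0.
Proof.
elim=> {u} [u v /act_rel uv||u v _ u0 _ v0|u v _ v0|u v _ u0] f w.
- by rewrite actB uv subrr.
- exact: act0.
- by rewrite actD u0 v0 addr0.
- rewrite actM; have -> : act v f = fun _ => 0 by apply/funext => ?; apply: v0.
  exact: act_zero.
- by rewrite actM u0.
Qed.
End Action.

Local Open Scope quotient_scope.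

Lemma tower_trace (K : fieldType) (q : K) l : (0 < l)%N -> q != 0 ->
  q ^+ (4 * l - 1) = 1 -> q * (- q ^- 2) ^+ (2 * l) = 1.
Proof.
move=> l0 q0 q1; have Eq : q ^+ (2 * 2 * l) = q.
  by rewrite (_ : (2 * 2 * l = (4 * l - 1).+1)%N) ?exprS ?q1 ?mulr1 //; lia.
by rewrite exprM sqrrN !exprVn -!exprM [(2 * _)%N]mulnA Eq divff.
Qed.

(** * Bases of F_n *)

Section Presented.
Context (R : nzRingType) (B : lalgType R) (rels : B -> B -> Prop).
Local Notation Q := (presented rels).
Definition pr (u : B) : Q := \pi u.

Lemma prD u v : pr (u + v) = pr u + pr v.
Proof. exact: pi_presented_add. Qed.
Lemma prN u : pr (- u) = - pr u.
Proof. exact: pi_presented_opp. Qed.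
Lemma prM u v : pr (u * v) = pr u * pr v.
Proof. exact: pi_presented_mul. Qed.
Lemma prZ k u : pr (k *: u) = k *: pr u.
Proof. exact: pi_presented_scale. Qed.
Lemma pr1 : pr 1 = 1.
Proof. by rewrite /pr !piE. Qed.
Lemma pr0 : pr 0 = 0.
Proof. by rewrite /pr !piE. Qed.
Lemma prP u v : pr u = pr v <-> rel_ideal rels (u - v).
Proof. by split=> [/eqP/presentedP|/presentedP/eqP]. Qed.
Lemma pr_rel u v : rels u v -> pr u = pr v.
Proof. by move=> uv; apply/prP; apply: rel_ideal_rel. Qed.
Lemma pr_repr q : pr (repr q) = q.
Proof. exact: reprK. Qed.
End Presented.

Section Scales.
Context (R : comNzRingType) (A : algType R) (c : A).

(** If all elements have this property, the multiples of [c] form a two-sided ideal. *)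
Definition scales (z : A) : Prop :=
  (exists d, z * c = d *: c) /\ (exists d, c * z = d *: c).

Lemma scalesD y z : scales y -> scales z -> scales (y + z).
Proof.
move=> [[d1 E1] [d2 E2]] [[d3 E3] [d4 E4]]; split.
  by exists (d1 + d3); rewrite mulrDl E1 E3 scalerDl.
by exists (d2 + d4); rewrite mulrDr E2 E4 scalerDl.
Qed.

Lemma scalesZ k z : scales z -> scales (k *: z).
Proof.
move=> [[d1 E1] [d2 E2]]; split.
  by exists (k * d1); rewrite -scalerAl E1 scalerA.
by exists (k * d2); rewrite -scalerAr E2 scalerA.
Qed.

Lemma scalesM y z : scales y -> scales z -> scales (y * z).
Proof.
move=> [[d1 E1] [d2 E2]] [[d3 E3] [d4 E4]]; split.
  by exists (d3 * d1); rewrite -mulrA E3 -scalerAr E1 scalerA.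
by exists (d2 * d4); rewrite mulrA E2 -scalerAl E4 scalerA.
Qed.

Lemma scales1 : scales 1.
Proof. by split; exists 1; rewrite ?mul1r ?mulr1 scale1r. Qed.

Lemma scalesN z : scales z -> scales (- z).
Proof. by rewrite -scaleN1r; apply: scalesZ. Qed.

Lemma scales_inv s t a : s * t = 1 -> t * s = 1 -> a * a = 1 ->
  s * c = a *: c -> c * s = a *: c -> scales t.
Proof.
move=> st ts aa sc cs; split; exists a.
  by rewrite -[in LHS](scale1r c) -aa -scalerA -sc -scalerAr mulrA ts mul1r.
by rewrite -[in LHS](scale1r c) -aa -scalerA -cs -scalerAl -mulrA st mulr1.
Qed.

Lemma scales_mull z d : scales z -> exists d', z * (d *: c) = d' *: c.
Proof. by move=> [[d' E] _]; exists (d * d'); rewrite -scalerAr E scalerA. Qed.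

Lemma scales_mulr z d : scales z -> exists d', (d *: c) * z = d' *: c.
Proof. by move=> [_ [d' E]]; exists (d * d'); rewrite -scalerAl E scalerA. Qed.
End Scales.

(** * Generation by the words and [C] *)

Section Spanning.
Context (n : nat).
Local Notation C := (F_var (@GenC n)).

(** Only spanning is deduced from this quotient, so it is treated as a possibly zero ring, hence
    [pzRingType] in the part on words. *)
Definition rel_mod_C (u v : F_free n) : Prop :=
  F_relations u v \/ u = C /\ v = 0.
Local Notation Q := (presented rel_mod_C).
Local Notation prQ := (pr rel_mod_C).

Definition scalQ (k : baseA) : Q := prQ (k *: 1).

Fact scalQ_is_zmod : zmod_morphism scalQ.
Proof. by move=> k l; rewrite /scalQ scalerBl prD prN. Qed.
Fact scalQ_is_monoid : monoid_morphism scalQ.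
Proof.
split=> [|k l]; first by rewrite /scalQ scale1r pr1.
by rewrite /scalQ -prM -scalerAl mul1r scalerA.
Qed.
HB.instance Definition _ := GRing.isZmodMorphism.Build baseA Q scalQ scalQ_is_zmod.
HB.instance Definition _ :=
  GRing.isMonoidMorphism.Build baseA Q scalQ scalQ_is_monoid.

Lemma scalQM k u : scalQ k * prQ u = prQ (k *: u).
Proof. by rewrite -prM -scalerAl mul1r. Qed.

Lemma scalQMr k u : prQ u * scalQ k = prQ (k *: u).
Proof. by rewrite -prM -malg_scaleAr mulr1. Qed.

Lemma prQ_C : prQ C = 0.
Proof. by rewrite -(pr0 rel_mod_C); apply: pr_rel; right. Qed.

(* The generators twisted by [a], indexed by [nat] with the junk value [0] out of
   range. *)
Definition tw (h : 'I_n.-1 -> F_gen n) (i : nat) : F_free n :=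
  if insub i is Some i' then baseA_a *: F_var (h i') else 0.

Lemma twE h (i : 'I_n.-1) : tw h i = baseA_a *: F_var (h i).
Proof. by rewrite /tw valK. Qed.

Lemma tw_mul h1 h2 (i j : 'I_n.-1) :
  tw h1 i * tw h2 j = F_var (h1 i) * F_var (h2 j).
Proof.
by rewrite !twE -scalerAl -malg_scaleAr scalerA baseA_aa scale1r.
Qed.

Lemma tw_mul3 h1 h2 h3 (i j k : 'I_n.-1) : tw h1 i * tw h2 j * tw h3 k =
  baseA_a *: (F_var (h1 i) * F_var (h2 j) * F_var (h3 k)).
Proof. by rewrite tw_mul twE malg_scaleAr. Qed.

Lemma twist_sum (k : baseA) (u v : F_free n) :
  (baseA_a * k) *: (baseA_a *: u + baseA_a *: v) = k *: (v + u).
Proof.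
have E : baseA_a * k * baseA_a = k by rewrite mulrC mulrA baseA_aa mul1r.
by rewrite -scalerDr scalerA E addrC.
Qed.

Lemma F_var_tw h (i : 'I_n.-1) : F_var (h i) = baseA_a *: tw h i.
Proof. by rewrite twE scalerA baseA_aa scale1r. Qed.

Local Notation sF := (tw (@GenS n)).
Local Notation tF := (tw (@GenSV n)).
Local Notation eF := (tw (@GenE n)).
Local Notation sQ := (fun i => prQ (sF i)).
Local Notation tQ := (fun i => prQ (tF i)).
Local Notation eQ := (fun i => prQ (eF i)).

Lemma pr_frel u v : F_relations u v -> prQ u = prQ v.
Proof. by move=> uv; apply: pr_rel; left. Qed.

Lemma pr_scaleI k u v : prQ u = prQ v -> prQ (k *: u) = prQ (k *: v).
Proof.
move=> uv; apply: etrans (prZ _ k u) _; rewrite uv; apply: esym; exact: prZ.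
Qed.

Lemma ord_of i : (i.+1 < n)%N -> exists i' : 'I_n.-1, i = i'.
Proof. by move=> h; have h' : (i < n.-1)%N by [lia]; exists (Ordinal h'). Qed.

Lemma bmw_relQ : bmw_rel scalQ (baseA_a * baseA_x) (baseA_a * baseA_xV) n sQ tQ eQ.
Proof.
split.
- by move=> k u; rewrite -(pr_repr u) scalQM scalQMr.
- by rewrite mulrACA baseA_aa baseA_xxV mul1r.
- move=> _ /ord_of[i ->]; rewrite -prM tw_mul -pr1; apply: pr_frel; exact: F_rel_ssV.
- move=> _ /ord_of[i ->]; rewrite -prM tw_mul -pr1; apply: pr_frel; exact: F_rel_sVs.
- move=> _ /ord_of[i ->]; rewrite -prD scalQM -pr1 -prN -prD !twE.
  rewrite twist_sum prZ (pr_frel (F_rel_e _ _ _ _ _ _ _ i)) -prZ.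
  by rewrite scalerA baseA_aa scale1r.
- move=> _ /ord_of[i ->]; rewrite -prM tw_mul twE.
  by apply: pr_frel; exact: F_rel_se.
- move=> i hi; have [j /esym Ej] := ord_of hi; have /ord_of[k Ek] : (i.+1 < n)%N by lia.
  rewrite -!prM -Ej Ek; apply: etrans (congr1 prQ (tw_mul3 _ _ _ k j k)) _.
  apply: etrans (esym (congr1 prQ (tw_mul3 _ _ _ j k j))).
  by apply: pr_scaleI; apply: pr_frel; apply: F_rel_braid; rewrite Ej Ek.
- move=> i j ij jn; have [k Ek] := ord_of jn; have /ord_of[l El] : (i.+1 < n)%N by lia.
  rewrite -!prM Ek El; apply: etrans (congr1 prQ (tw_mul _ _ l k)) _.
  apply: etrans (esym (congr1 prQ (tw_mul _ _ k l))).
  apply: pr_frel; apply: F_rel_comm.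
  by left; rewrite -Ek -El.
- move=> _ _ /ord_of[i ->] /ord_of[j ->] ij; rewrite -2!prM tw_mul3 twE.
  apply: pr_scaleI; rewrite (pr_frel (F_rel_ese _ _ _ _ _ _ _ _)).
    by rewrite prD prQ_C addr0.
  by case: ij; [left|right].
- move=> _ _ /ord_of[i ->] /ord_of[j ->] ij; rewrite -2!prM tw_mul3 twE.
  apply: pr_scaleI; rewrite (pr_frel (F_rel_esVe _ _ _ _ _ _ _ _)).
    by rewrite prD prQ_C addr0.
  by case: ij; [left|right].
Qed.

Lemma mulg_ind (T : F_free n -> Prop) : T 1 -> (forall u v, T u -> T v -> T (u + v)) ->
  (forall k u, T u -> T (k *: u)) -> (forall g u, T u -> T (F_var g * u)) ->
  forall u, T u.
Proof.
move=> T1 TD TZ Tg u; rewrite [u]monalgE; elim/big_ind: _ => [|u1 u2|m _].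
- by rewrite -(scale0r 1); apply: TZ.
- exact: TD.
- have UU (c1 c2 : baseA) k1 k2 :
      << c1 *g k1 >> * << c2 *g k2 >> = << c1 * c2 *g mmul k1 k2 >> :> F_free n.
    by rewrite -[LHS]/(fgmul _ _) fgmulUU.
  have -> : << u@_m *g m >> = u@_m *: << m >> :> F_free n.
    by rewrite -mul_malgC UU mulr1 mul1m.
  apply: TZ; case: m => s; elim: s => [|g s IH].
    have -> : FMonom [::] = mone :> {fmonom (F_gen n)} by apply/eqP; rewrite fmP fm1.
    exact: T1.
  have -> : FMonom (g :: s) = mmul (fmu g) (FMonom s) :> {fmonom (F_gen n)}.
    by apply/eqP; rewrite fmP fmM fmuE.
  by have := Tg g _ IH; rewrite UU mulr1.
Qed.

Lemma AlgQ u : Alg scalQ n sQ (leq 0) (prQ u).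
Proof.
elim/mulg_ind: u => [|u v Au Av|k u Au|g u Au].
- rewrite pr1; exact: Alg1.
- rewrite prD; exact: AlgD.
- rewrite -scalQM; exact: AlgZ.
- rewrite prM; apply: AlgM => //.
  have lt_n (i : 'I_n.-1) : (i.+1 < n)%N by have := ltn_ord i; lia.
  case: g => [i|i|i|].
  + rewrite (F_var_tw (@GenS n)) -scalQM; apply: AlgZ.
    exact: (Alg_sg (P := leq 0) scalQ sQ (leq0n i) (lt_n i)).
  + rewrite (F_var_tw (@GenSV n)) -scalQM; apply: AlgZ.
    exact: (Alg_tg bmw_relQ (leq0n i) (lt_n i)).
  + rewrite (F_var_tw (@GenE n)) -scalQM; apply: AlgZ.
    exact: (Alg_eg bmw_relQ (leq0n i) (lt_n i)).
  + rewrite prQ_C; have := AlgZ 0 (Alg1 scalQ n sQ (leq 0)).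
    by rewrite mulr1 /= /scalQ scale0r pr0.
Qed.

Definition piF (u : F_free n) : F n := pr (@F_relations n) u.

Lemma piFD u v : piF (u + v) = piF u + piF v. Proof. exact: prD. Qed.
Lemma piFN u : piF (- u) = - piF u. Proof. exact: prN. Qed.
Lemma piFM u v : piF (u * v) = piF u * piF v. Proof. exact: prM. Qed.
Lemma piFZ k u : piF (k *: u) = k *: piF u. Proof. exact: prZ. Qed.
Lemma piF1 : piF 1 = 1. Proof. exact: pr1. Qed.
Lemma piF_rel u v : F_relations u v -> piF u = piF v. Proof. exact: pr_rel. Qed.
Lemma piF_repr z : piF (repr z) = z. Proof. exact: pr_repr. Qed.
Lemma piF_eq u v : piF u = piF v -> rel_ideal (@F_relations n) (u - v).
Proof. by move/prP. Qed.

Local Notation c := (piF C).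
Local Notation scales_C := (scales c).

(** For [C] itself: it equals e_0 s_1 e_0 - e_0, where n > 2 provides the second index. *)
Lemma scales_C_gen g : (2 < n)%N -> scales_C (piF (F_var g)).
Proof.
move=> n2.
have S i : scales_C (piF (F_var (GenS i))).
  split; exists baseA_a; rewrite -piFM -piFZ; apply: piF_rel.
    exact: F_rel_sC.
  exact: F_rel_Cs.
have T i : scales_C (piF (F_var (GenSV i))).
  apply: (@scales_inv _ _ _ (piF (F_var (GenS i))) _ baseA_a); rewrite -?piFM -?piFZ -?piF1.
  - by apply: piF_rel; apply: F_rel_ssV.
  - by apply: piF_rel; apply: F_rel_sVs.
  - exact: baseA_aa.
  - by apply: piF_rel; apply: F_rel_sC.
  - by apply: piF_rel; apply: F_rel_Cs.
have E i : scales_C (piF (F_var (GenE i))).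
  have -> : piF (F_var (GenE i)) = baseA_a *: (baseA_xV *:
      (piF (F_var (GenSV i)) + piF (F_var (GenS i))) - 1).
    rewrite -piF1 -piFD -piFZ -piFN -piFD -piFZ; apply: piF_rel.
    exact: F_rel_e.
  apply/scalesZ/scalesD; last exact/scalesN/scales1.
  exact/scalesZ/scalesD.
case: g => // .
have i0 : (0 < n.-1)%N by lia.
have i1 : (1 < n.-1)%N by lia.
have := piF_rel (F_rel_ese _ _ _ _ _ _ _ (i := Ordinal i0) (j := Ordinal i1) (or_introl erefl)).
rewrite piFD 2!piFM => /esym/(canRL (addKr _)) Ec.
rewrite [X in scales _ X]Ec.
exact: scalesD (scalesN (E _)) (scalesM (scalesM (E _) (S _)) (E _)).
Qed.

Lemma scales_C_all u : (2 < n)%N -> scales_C (piF u).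
Proof.
move=> n2; elim/mulg_ind: u => [|u v|k u|g u Cu].
- rewrite piF1; exact: scales1.
- rewrite piFD; exact: scalesD.
- rewrite piFZ; exact: scalesZ.
- by rewrite piFM; apply: scalesM => //; apply: scales_C_gen.
Qed.

(** By [scales_C_all], multiplication on either side keeps the multiples of [c], so killing [C] adds
    nothing else to the ideal. *)
Lemma rel_mod_C_ideal u : (2 < n)%N -> rel_ideal rel_mod_C u ->
  exists d, piF u = d *: c.
Proof.
move=> n2; elim=> {u} [u v [/piF_rel uv|[-> ->]]||u v _ [d1 E1] _ [d2 E2]|u v _ [d E]|u v _ [d E]].
- by exists 0; rewrite piFD piFN uv subrr scale0r.
- by exists 1; rewrite subr0 scale1r.
- by exists 0; rewrite scale0r; exact: pr0.
- by exists (d1 + d2); rewrite piFD E1 E2 scalerDl.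
- by rewrite piFM E; apply: scales_mull; apply: scales_C_all.
- by rewrite piFM E; apply: scales_mulr; apply: scales_C_all.
Qed.

Definition wF (w : seq bgen) : F_free n := wev sF tF eF w.

Lemma pr_wF w : prQ (wF w) = wev sQ tQ eQ w.
Proof.
elim: w => [|g w IH]; first exact: pr1.
by rewrite [wF _]/= [RHS]/= -IH prM; case: g.
Qed.

Lemma prQ_sum (T : Type) (r : seq T) (f : T -> F_free n) :
  prQ (\sum_(i <- r) f i) = \sum_(i <- r) prQ (f i).
Proof.
elim: r => [|i r IH]; first by rewrite 2!big_nil pr0.
by rewrite 2!big_cons prD IH.
Qed.

Lemma F_span z : (2 < n)%N -> exists (k : seq bgen -> baseA) d,
  z = piF (\sum_(w <- nf_words 0 n) k w *: wF w + d *: C).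
Proof.
move=> n2; have := Alg_lspan bmw_relQ (add0n n) (AlgQ (repr z)).
move=> /(lspan_seq (nf_words_uniq 0 n))[k Ek]; exists k.
have E : prQ (repr z) = prQ (\sum_(w <- nf_words 0 n) k w *: wF w).
  rewrite Ek prQ_sum; apply: eq_bigr => w _.
  by rewrite -scalQM pr_wF.
move/prP: E => /(rel_mod_C_ideal n2)[d E]; exists d.
rewrite [RHS]piFD piFZ -E piFD piFN addrC subrK.
exact: esym (piF_repr z).
Qed.

(** * Independence of the words and [C] *)

Section Evaluation.
Context (q : algC) (D : rdata algC) (L : nat) (HG : rgood q D L 1).
Hypothesis x0 : xq q != 0.
Context (P : evpt) (HP : ev_x P = ev_a P * xq q).

(** The twist of the generators by a cancels the sign with which they act. *)
Lemma act_wF (w : seq bgen) (f : (nat -> rI D) -> algC) v :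
  (forall g, g \in w -> (bidx g).+1 < n)%N ->
  act q P (wF w) f v = opw q w f v.
Proof.
elim: w v => [|g w IH] v hw; first exact: act1.
have -> : opw q (g :: w) f = bop q g (act q P (wF w) f).
  congr (bop q g _); apply/funext => v'; apply/esym/IH => h hh.
  by apply: hw; rewrite inE hh orbT.
have aM (h : 'I_n.-1 -> F_gen n) (i : 'I_n.-1) (f' : (nat -> rI D) -> algC) v' :
    act q P (tw h i * wF w) f' v' = ev_a P * gact q P (h i) (act q P (wF w) f') v'.
  by rewrite (actM HG) twE (actZ HG) bev_a act_var.
have aK z : ev_a P * (ev_a P * z) = z by rewrite mulrA ev_a2 mul1r.
have := hw g (mem_head _ _).
by case: g {hw} => i /= /ord_of[j ->]; rewrite aM /= aK.
Qed.
End Evaluation.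

(** With e = a (2 / X - 1), the image of [C] is a e^2 - e = a (2 / X - 1) (2 / X - 2). *)
Lemma aug_C_neq0 (P : evpt) X : ev_x P = ev_a P * X -> X != 1 -> X != 2 ->
  bev P (F_aug C) != 0.
Proof.
move=> HX X1 X2.
have e0 : ev_a P != 0.
  by apply: contra_eq_neq (ev_a2 P) => ->; rewrite mul0r eq_sym oner_eq0.
have X0 : X != 0 by apply: contraNneq (ev_x0 P) => X0; rewrite HX X0 mulr0.
have aV : (ev_a P)^-1 = ev_a P by apply: (mulfI e0); rewrite divff // ev_a2.
rewrite F_aug_var /= rmorphB 2!rmorphM rmorphB rmorphD /= bev_a bev_xV HX invfM aV.
have -> : (ev_a P / X + ev_a P / X - ev_a P) * ev_a P *
    (ev_a P / X + ev_a P / X - ev_a P) - (ev_a P / X + ev_a P / X - ev_a P) =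
    ev_a P * (ev_a P * ev_a P) * (2 / X - 1) ^+ 2 - ev_a P * (2 / X - 1) by ring.
rewrite ev_a2 mulr1 -mulrBr expr2 -[X in _ - X]mulr1 -mulrBr.
have X1' : 2 / X - 1 - 1 = 2 * (X^-1 - 1) by ring.
rewrite X1' !mulf_neq0 ?pnatr_eq0 //.
  by rewrite subr_eq0; apply: contra_neq X2 => /(canRL (mulfVK X0)) ->; rewrite mul1r.
by rewrite subr_eq0; apply: contra_neq X1 => E; rewrite -[X]invrK E invr1.
Qed.

(** The order matters: the action kills [C] and so isolates the words, whereas the augmentation is
    nonzero on words too and can detect [d] only once their coefficients are gone. *)
Lemma F_indep (k : seq bgen -> baseA) d : (0 < n)%N ->
  piF (\sum_(w <- nf_words 0 n) k w *: wF w + d *: C) = 0 ->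
  (forall w, w \in nf_words 0 n -> k w = 0) /\ d = 0.
Proof.
move=> n0 E.
have I : rel_ideal (@F_relations n) (\sum_(w <- nf_words 0 n) k w *: wF w + d *: C).
  by rewrite -[X in rel_ideal _ X]subr0; apply: piF_eq; rewrite E; exact/esym/pr0.
have k0 w : w \in nf_words 0 n -> k w = 0.
  move=> wW; apply: (@baseA_eq0 _ n.+1) => l y j P nl yp jl HP.
  have l0 : (0 < l)%N by lia.
  have q1 : (y ^+ j) ^+ (4 * l - 1) = 1.
    by rewrite -exprM mulnC exprM (prim_expr_order yp) expr1n.
  have q0 := odd_root_neq0 l0 q1.
  have x0 : xq (y ^+ j) != 0 := odd_root_x l0 q1.
  have [HG th] := rtower_good (2 * l) q0 x0.
  have th1 : (rtower (y ^+ j) (2 * l)).2 = 1.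
    by rewrite th tower_trace.
  rewrite th1 in HG.
  apply: (nf_independent HG x0 (c := fun w => bev P (k w)) (add0n n) _ _ _ wW); try lia.
  move=> v _; have := act_ideal HG x0 HP I (nest n 0) v.
  rewrite actD act_sum (actZ HG) act_var mulr0 addr0 => E0; rewrite -[RHS]E0.
  apply: eq_big_seq => u uW; rewrite (actZ HG) (act_wF HG) // => g gu.
  by have [] := nf_idx (add0n n) uW gu.
split=> //.
have {}I : F_aug (d *: C) = 0.
  move: I; rewrite big_seq big1 ?add0r => [/F_aug_ideal //|w wW].
  by rewrite k0 // scale0r.
apply: (@baseA_eq0 _ n.+1) => l y j P nl yp jl HP.
have l0 : (0 < l)%N by lia.
have q1 : (y ^+ j) ^+ (4 * l - 1) = 1.
  by rewrite -exprM mulnC exprM (prim_expr_order yp) expr1n.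
have yj : y ^+ j != 1.
  rewrite -(prim_order_dvd yp); apply/negP => /dvdn_leq; lia.
have := aug_C_neq0 HP (odd_root_x1 l0 q1) (odd_root_x2 l0 q1 yj).
apply: contraNeq => dP; apply/eqP.
have /eqP := congr1 (bev P) I; rewrite linearZ rmorphM rmorph0 mulf_eq0.
by rewrite (negPf dP) => /eqP.
Qed.
End Spanning.

Lemma free_of_rank_seq (R : nzRingType) (M : lmodType R) (T : eqType) (W : seq T)
    (f : T -> M) (c : M) : uniq W ->
  (forall z, exists k d, z = \sum_(w <- W) k w *: f w + d *: c) ->
  (forall k d, \sum_(w <- W) k w *: f w + d *: c = 0 ->
     (forall w, w \in W -> k w = 0) /\ d = 0) ->
  free_of_rank M (1 + size W).
Proof.
case: W => [|w0 W'].
  (* An empty [W] offers no default value for [nth]. *)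
  move=> _ span indep; exists (fun=> c) => z; have [k [d]] := span z.
  rewrite big_nil add0r => ->; exists [ffun=> d]; split=> [|g E].
    by rewrite big_ord1 ffunE.
  apply/ffunP => i; rewrite ffunE (ord1 i).
  have [|_ /eqP] := indep (fun=> 0) (d - g ord0).
    by rewrite big_nil add0r scalerBl E big_ord1 subrr.
  by rewrite subr_eq0 => /eqP.
move: (w0 :: W') => W uW span indep.
pose b (i : 'I_(1 + size W)) := if split i is inr j then f (nth w0 W j) else c.
have sumb (g : 'I_(1 + size W) -> R) (k : T -> R) :
    (forall j, g (rshift 1 j) = k (nth w0 W j)) ->
    \sum_i g i *: b i = \sum_(w <- W) k w *: f w + g ord0 *: c.
  move=> gk; rewrite big_split_ord big_ord1 [RHS]addrC; congr (_ + _).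
    have -> : lshift (size W) ord0 = ord0 :> 'I_(1 + size W) by apply: val_inj.
    by rewrite /b; case: splitP.
  rewrite (big_nth w0) big_mkord; apply: eq_bigr => j _.
  by rewrite gk /b; case: splitP => [[]|j' /addnI/val_inj <-] //=; lia.
exists b => z; have [k [d Ez]] := span z.
pose g : {ffun 'I_(1 + size W) -> R} := [ffun i => if split i is inr j then k (nth w0 W j) else d].
have gk j : g (rshift 1 j) = k (nth w0 W j).
  by rewrite ffunE; case: splitP => [[]|j' /addnI/val_inj <-] //=; lia.
have g0 : g ord0 = d by rewrite ffunE; case: splitP.
exists g; split; first by rewrite (sumb _ _ gk) g0.
move=> h Eh.
(* The coordinates [h] are turned back into a function on [W] through the index of an element. *)
pose k' w := if insub (index w W) is Some j then h (rshift 1 j) else 0.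
have hk' j : h (rshift 1 j) = k' (nth w0 W j) by rewrite /k' index_uniq // valK.
have [|k0 /eqP] := indep (fun w => k w - k' w) (d - h ord0).
  have := congr1 (fun y => z - y) Eh; rewrite subrr (sumb _ _ hk') {1}Ez => E.
  rewrite [RHS]E opprD addrACA -scalerBl; congr (_ + _).
  by rewrite -sumrB; apply: eq_bigr => w _; rewrite scalerBl.
rewrite subr_eq0 => /eqP dh; apply/ffunP => i.
rewrite -[i]splitK; case: (split i) => j /=; last first.
  by rewrite gk hk'; apply/eqP; rewrite -subr_eq0 k0 // mem_nth.
have -> : lshift (size W) j = ord0 by apply: val_inj; rewrite (ord1 j).
by rewrite g0.
Qed.

Theorem corollary6p6 (n : nat) (hn : (3 <= n)%N) :
  free_of_rank (F n) (1 + BMW_dim n)%N.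
Proof.
rewrite /BMW_dim -(size_nf_words 0 n).
have sumE (k : seq bgen -> baseA) d :
    piF (\sum_(w <- nf_words 0 n) k w *: wF n w + d *: F_var GenC) =
    \sum_(w <- nf_words 0 n) k w *: piF (wF n w) + d *: piF (F_var GenC).
  rewrite piFD piFZ; congr (_ + _); elim: (nf_words 0 n) => [|w r IH].
    by rewrite 2!big_nil; exact: pr0.
  by rewrite 2!big_cons piFD piFZ IH.
apply: (free_of_rank_seq (f := fun w => piF (wF n w)) (c := piF (F_var (@GenC n)))).
- exact: nf_words_uniq.
- by move=> z; have [k [d ->]] := F_span z hn; exists k, d; rewrite sumE.
- by move=> k d; rewrite -sumE => /F_indep; apply; lia.
Qed.
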